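(* Let $\ell\geqslant2$ be an integer. The limiting gap measure $\widetilde\nu_\ell$ of the sequence of sets $(\widetilde{\mathcal F}_{Q,\ell})_Q$, as $Q\to\infty$, exists, and its distribution function is given for $\xi>0$ by $$\widetilde F_\ell(\xi)=\int_0^\xi d\widetilde\nu_\ell=\frac{1}{\widetilde K_\ell}\,G_\ell\Big(\frac{\xi}{\widetilde K_\ell}\Big),$$ where, for $\xi>0$, $$G_\ell(\xi)=\Big(\frac{1}{\zeta(2)}-\frac{2C(\ell)}{\ell}\Big)A(\xi)+\frac{C(\ell)}{\ell}\sum_{1\leqslant K\leqslant\xi}A_K(\xi),$$ the sum being over integers $K$.
   Context: For a positive integer $Q$, $\mathcal F_Q$ is the set of rational numbers $\frac{a}{q}\in(0,1]$ with $(a,q)=1$ and $1\leqslant q\leqslant Q$, and $\widetilde{\mathcal F}_{Q,\ell}$ is the set of those $\frac aq\in\mathcal F_Q$ (in lowest terms) with $\ell\nmid a$. Gap distribution: for a finite list $A=\{x_0\leqslant x_1\leqslant\cdots\leqslant x_N\}$ of numbers in $[0,1]$ (with $N\geqslant 1$ and $x_0<x_N$), put $\tilde{x}_j=\frac{N x_j}{x_N-x_0}$. The gap distribution measure of $A$ is the finitely supported probability measure $\nu_A$ on $[0,\infty)$ defined by $\nu_A[0,\xi]=\frac1N\#\{j\in\{1,\dots,N\}:\tilde x_j-\tilde x_{j-1}\leqslant\xi\}$ for $\xi\geqslant 0$. The limiting gap measure of a sequence $(A_n)$ of finite lists is, if it exists, the weak limit of the probability measures $\nu_{A_n}$ as $n\to\infty$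 (the lists are the elements of the sets in increasing order). Constants: $C(\ell)=\frac{1}{\zeta(2)}\prod_{p\mid\ell,\ p\text{ prime}}\big(1+\frac1p\big)^{-1}$ and $\widetilde K_\ell=\frac{1}{2\zeta(2)}-\frac{C(\ell)}{2\ell}$. Areas: for $\xi>0$, $A(\xi)$ is the area (Lebesgue measure) of $\{(x,y)\in(0,1]^2: x+y>1,\ xy\geqslant\frac1\xi\}$. Let $\mathcal T=\{(x,y)\in(0,1]^2:x+y>1\}$ and, for each integer $K\geqslant1$, $\mathcal T_K=\{(x,y)\in\mathcal T:\lfloor\frac{1+x}{y}\rfloor=K\}$. Then $A_K(\xi)$ is the area of $\Omega_K(\xi)=\{(v,u)\in\mathcal T_K: u\geqslant\frac vK+\frac{1}{\xi v}\}$. *)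

(* Defs.v *)
From HB Require Import structures.
From mathcomp Require Import all_boot all_order all_algebra.
From mathcomp Require Import all_classical all_reals all_analysis.

Set Implicit Arguments.
Unset Strict Implicit.
Unset Printing Implicit Defensive.

Import Order.TTheory GRing.Theory Num.Theory.
Import numFieldNormedType.Exports.

Local Open Scope classical_set_scope.
Local Open Scope ring_scope.

Definition farey (Q : nat) : seq rat :=
  undup [seq (a%:R / q%:R : rat) |
    q <- iota 1 Q, a <- [seq a <- iota 1 q | coprime a q]].

Definition farey_ndvd (l Q : nat) : seq rat :=
  [seq x <- farey Q | ~~ (l %| `|numq x|)%N].

Lemma mem_farey (Q : nat) (x : rat) :
  (x \in farey Q) = (0 < x <= 1) && (`|denq x| <= Q)%N.
Proof.
rewrite mem_undup; apply/allpairsPdep/idP.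
  move=> [q [a []]]; rewrite mem_iota mem_filter mem_iota !add1n !ltnS.
  move=> /andP[q0 qQ] /and3P[cop a0 aq] ->.
  rewrite divr_gt0 ?ltr0n//= ler_pdivrMr ?ltr0n// mul1r ler_nat aq/=.
  by rewrite (@coprimeq_den a%:Z q%:Z)// eqz_nat gtn_eqF.
move=> /andP[/andP[x0 x1] dQ].
have n0 : 0 < numq x by rewrite numq_gt0.
have d0 := denq_gt0 x.
have E : x = (`|numq x|%N%:R / `|denq x|%N%:R : rat).
  by rewrite -[LHS]divq_num_den !natr_absz !gtr0_norm.
exists `|denq x|%N, `|numq x|%N; split => //.
- by rewrite mem_iota add1n ltnS dQ andbT absz_gt0 gt_eqF.
- rewrite mem_filter coprime_num_den mem_iota add1n ltnS absz_gt0 gt_eqF//=.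
  by move: x1; rewrite E ler_pdivrMr ?ltr0n ?absz_gt0 ?gt_eqF// mul1r ler_nat -E.
Qed.

Section GapMeasure.
Variable R : realType.

(* For A = [:: x_0; ...; x_N] this is the normalized gap
   N (x_{j+1} - x_j) / (x_N - x_0), with 0 <= j < N = (size A).-1. *)
Definition gap (A : seq R) (j : nat) : R :=
  let N := (size A).-1 in
  let xt k := N%:R * A`_k / (A`_N - A`_0) in xt j.+1 - xt j.

(* The zero measure when N = 0. *)
Definition gap_measure (A : seq R) : {measure set (measurableTypeR R) -> \bar R} :=
  let N := (size A).-1 in
  mscale (N%:R^-1)%:nng
    (msum (fun j => \d_(gap A j : measurableTypeR R)) N).

Lemma gap_measure_cdf (A : seq R) (xi : R) :
  sorted <=%R A -> 0 <= xi ->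
  gap_measure A `[0, xi]%classic =
    ((size A).-1%:R^-1 * #|[set j : 'I_(size A).-1 | gap A j <= xi]%SET|%:R)%:E.
Proof.
move=> sA xi0; rewrite /gap_measure /mscale /= /msum EFinM; congr *%E.
have nd i j : (i <= j)%N -> (j < size A)%N -> A`_i <= A`_j.
  move=> ij js; apply: (sorted_leq_nth le_trans le_refl) => //.
  by rewrite inE (leq_ltn_trans ij).
have gap_ge0 (j : 'I_(size A).-1) : 0 <= gap A j.
  have jA : (j.+1 < size A)%N by rewrite -ltn_predRL.
  have NA : ((size A).-1 < size A)%N by rewrite prednK// (leq_trans _ jA).
  rewrite /gap -mulrBl -mulrBr divr_ge0 ?mulr_ge0 ?subr_ge0//; exact: nd.
rewrite -sum1_card natr_sum -sumEFin [RHS]big_mkcond /=; apply: eq_bigr => j _.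
transitivity ((gap A j \in `[0, xi]%classic)%:R%:E : \bar R); first exact: diracE.
rewrite inE; case: ifPn => h.
  by rewrite mem_set//= in_itv/= gap_ge0.
by rewrite memNset//= in_itv/= => /andP[_]; exact/negP.
Qed.

(* Measures on [0, +oo[ are encoded as measures on R carried by [0, +oo[;
   this is weak convergence of their restrictions to that half-line. *)
Definition weak_cvg_nneg (nu_ : nat -> {measure set (measurableTypeR R) -> \bar R})
    (nu : {measure set (measurableTypeR R) -> \bar R}) : Prop :=
  forall f : R -> R, {within `[0, +oo[, continuous f} ->
    [bounded f x | x in `[0, +oo[] ->
    (\int[nu_ n]_(x in `[0%R, +oo[) (f x)%:E)%E @[n --> \oo] -->
    (\int[nu]_(x in `[0%R, +oo[) (f x)%:E)%E.

Definition limiting_gap_measure (A_ : nat -> seq R)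
    (nu : probability (measurableTypeR R) R) : Prop :=
  nu `[0, +oo[%classic = 1%E /\ weak_cvg_nneg (fun n => gap_measure (A_ n)) nu.

Definition farey_ndvd_list (l Q : nat) : seq R :=
  [seq ratr x | x <- sort <=%O (farey_ndvd l Q)].

End GapMeasure.

Section Constants.
Variable R : realType.

Definition zeta (s : nat) : R := limn (series (fun n : nat => (n.+1%:R ^+ s)^-1 : R)).

Definition C_const (l : nat) : R :=
  (zeta 2)^-1 * \prod_(p <- primes l) (1 + p%:R^-1)^-1.

Definition K_const (l : nat) : R :=
  (2 * zeta 2)^-1 - C_const l / (2 * l%:R).

Definition area (S : set (R * R)) : R :=
  fine ((@lebesgue_measure R \x @lebesgue_measure R)%E S).

Definition triangle : set (R * R) :=
  [set z | [/\ 0 < z.1 <= 1, 0 < z.2 <= 1 & 1 < z.1 + z.2]].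

Definition triangle_floor (K : nat) : set (R * R) :=
  [set z | triangle z /\ Num.floor ((1 + z.1) / z.2) = K%:Z].

Definition area_hyp (xi : R) : R :=
  area [set z | triangle z /\ xi^-1 <= z.1 * z.2].

(* Here z = (v, u). *)
Definition area_K (K : nat) (xi : R) : R :=
  area [set z | triangle_floor K z /\ z.1 / K%:R + (xi * z.1)^-1 <= z.2].

Definition G_fun (l : nat) (xi : R) : R :=
  ((zeta 2)^-1 - 2 * C_const l / l%:R) * area_hyp xi +
  C_const l / l%:R * \sum_(1 <= K < (Num.truncn xi).+1) area_K K xi.

End Constants.

(* Main.v *)
Require Import Defs.
From HB Require Import structures.
From mathcomp Require Import all_boot all_order all_algebra all_field all_solvable.
From mathcomp Require Import ring lra zify.
From mathcomp Require Import all_classical all_reals all_analysis.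
From mathcomp Require Import measurable_realfun.
Import Order.TTheory GRing.Theory Num.Theory.
Import numFieldNormedType.Exports.

(** The predecessor and the successor of a/n in the Farey sequence of order Q have
denominators p = a^-1 and s = -a^-1 modulo n in the window ]Q - n, Q], at distances
1/(np) and 1/(ns) from a/n.  Deleting the fractions whose numerator is divisible by l
merges the two gaps around each of them, and no two neighbours are both deleted.
Hence the number of small gaps that remain is an alternating sum of numbers of
fractions a/n whose normalised pair (p/Q, n/Q) lies in a fixed planar region, taken
over all a, and over the multiples of l.

These pairs equidistribute in the triangle x + y > 1.  For fixed n, a multiple a = l b
with p in an interval is a point of the modular hyperbola b p = l^-1 (mod n) in a
rectangle.  Such points are counted by Fourier analysis and a bound for the fourth
moment of Kloosterman sums, which is enough for all but few n <= Q.  The main term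
is governed by the mean of phi(n)/n over n <= N coprime to l, which tends to C(l):
this mean satisfies a convolution identity that is a contraction because
zeta(2) - 1 < 1.

The gap functions 1/(xy) and K/(x(Ky - x)) (where K is the integer part of (1 + x)/y,
so that K y - x is s/Q) have null level sets, so the limit of the gap distribution
functions is continuous; it is the distribution function of a Lebesgue-Stieltjes
measure, to which the gap measures converge weakly. *)

Set Implicit Arguments.
Unset Strict Implicit.
Unset Printing Implicit Defensive.

Local Open Scope ring_scope.

(** * Fourier analysis and Kloosterman sums on a finite ring *)

(** For most moduli n only an error of e n, for each fixed e, is needed, not a power saving. This
    lets composite moduli, with their zero divisors, be treated by elementary means. The bound for a
    Kloosterman sum involves the annihilator of a frequency, which is bounded for the low
    frequencies other than 0, and the number of solutions of x y (x + y + 2) = 0, which is small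
    against n^2 unless n has too many large divisors; Markov's inequality makes this rare. No decay
    of the Fourier coefficients of an interval is used: an interval is almost invariant under short
    translations, and this alone makes its high frequencies negligible in mean square. For planar
    regions only lower bounds are proved, for open sets, by filling them with small squares. The
    upper bound is the lower bound for the complement, because the total number of pairs is known
    and boundaries are null. The counts are made at thresholds tau / Q^2 with tau fixed, whereas
    normalising the gaps produces a tau that varies with Q. Monotonicity in tau and continuity of
    the limit reconcile the two. *)

Section FourierAnalysis.
Variables (A : finComUnitRingType) (e : A -> algC).
Hypothesis eD : forall x y, e (x + y) = e x * e y.
Hypothesis norm_e : forall x, `|e x| = 1.
(** Nondegeneracy: the additive character [e] makes the ring its own dual through the pairing
    [e (m * x)], so frequencies are again elements of [A]. *)
Hypothesis sum_e : forall m, \sum_x e (m * x) = #|A|%:R *+ (m == 0).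

Lemma char_neq0 x : e x != 0.
Proof. by rewrite -normr_gt0 norm_e ltr01. Qed.

Lemma char0 : e 0 = 1.
Proof. by apply: (mulfI (char_neq0 0)); rewrite -eD addr0 mulr1. Qed.

Lemma charMn x h : e (x *+ h) = e x ^+ h.
Proof.
elim: h => [|h IH]; first by rewrite mulr0n char0 expr0.
by rewrite mulrS eD IH exprS.
Qed.

Lemma conj_char x : (e x)^* = e (- x).
Proof.
apply: (mulfI (char_neq0 x)).
by rewrite -normCK norm_e expr1n -eD subrr char0.
Qed.

Lemma sqr_norm_sum (T : finType) (a : T -> algC) :
  `|\sum_i a i| ^+ 2 = \sum_i \sum_j a i * (a j)^*.
Proof.
rewrite normCK rmorph_sum mulr_suml; apply: eq_bigr => i _.
by rewrite mulr_sumr.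
Qed.

Lemma parseval (c : A -> algC) :
  \sum_x `|\sum_m c m * e (m * x)| ^+ 2 = #|A|%:R * \sum_m `|c m| ^+ 2.
Proof.
under eq_bigr do rewrite sqr_norm_sum.
rewrite exchange_big/= mulr_sumr; apply: eq_bigr => m _.
rewrite exchange_big/= (bigD1 m)//= [X in _ + X]big1 => [|k km].
  rewrite addr0 (eq_bigr (fun=> `|c m| ^+ 2)) => [|x _].
    by rewrite sumr_const mulr_natl.
  by rewrite -normCK normrM norm_e mulr1.
transitivity (c m * (c k)^* * \sum_x e ((m - k) * x)).
  rewrite mulr_sumr; apply: eq_bigr => x _.
  by rewrite rmorphM/= conj_char mulrBl eD mulrACA.
by rewrite sum_e subr_eq0 eq_sym (negPf km) mulr0n mulr0.
Qed.

Definition fourier (f : A -> algC) m := \sum_x f x * e (- (m * x)).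

Lemma fourier_parseval (f : A -> algC) :
  \sum_m `|fourier f m| ^+ 2 = #|A|%:R * \sum_x `|f x| ^+ 2.
Proof.
rewrite -parseval (reindex_inj oppr_inj)/=; apply: eq_bigr => m _.
congr (`|_| ^+ 2); by apply: eq_bigr => x _; rewrite mulNr opprK [m * x]mulrC.
Qed.

Lemma fourier_inv (f : A -> algC) x : \sum_m fourier f m * e (m * x) = #|A|%:R * f x.
Proof.
under eq_bigr do rewrite mulr_suml.
rewrite exchange_big/= (bigD1 x)//= [X in _ + X]big1 => [|y yx].
  rewrite addr0 (eq_bigr (fun=> f x)) => [|m _].
    by rewrite sumr_const mulr_natl.
  by rewrite -mulrA -eD addNr char0 mulr1.
transitivity (f y * \sum_m e ((x - y) * m)).
  rewrite mulr_sumr; apply: eq_bigr => m _.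
  by rewrite -mulrA -eD addrC mulrBl ![m * _]mulrC.
by rewrite sum_e subr_eq0 eq_sym (negPf yx) mulr0n mulr0.
Qed.

Lemma fourier_shift f h m :
  fourier (fun x => f (x + h)) m = e (m * h) * fourier f m.
Proof.
rewrite /fourier [in RHS](reindex_inj (@addIr _ h))/= mulr_sumr.
apply: eq_bigr => x _; rewrite mulrCA -eD; congr (_ * e _).
by rewrite mulrDr opprD addrCA subrr addr0.
Qed.

End FourierAnalysis.

(** * Additive characters of Z/n *)

Section Characters.
Variable N : nat.
Let n := N.+2.
Let A := 'Z_n.
Variables (w : algC) (w_prim : n.-primitive_root w).

Definition echar (x : 'Z_N.+2) : algC := w ^+ x.
Local Notation e := echar.

Lemma echarD x y : e (x + y) = e x * e y.
Proof. by rewrite /e -exprD -[RHS](prim_expr_mod w_prim). Qed.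

Lemma echar0 : e 0 = 1.
Proof. by rewrite /e expr0. Qed.

Lemma norm_echar x : `|e x| = 1.
Proof.
rewrite normrX; suff -> : `|w| = 1 by rewrite expr1n.
apply/eqP; rewrite -(@pexpr_eq1 _ _ n)// -normrX.
by rewrite (prim_expr_order w_prim) normr1.
Qed.

Lemma echar_eq1 x : (e x == 1) = (x == 0).
Proof.
rewrite /e -(prim_order_dvd w_prim); apply/idP/eqP => [|->]; last by rewrite dvdn0.
move=> dvd; apply/val_inj => /=; apply/eqP; rewrite eqn0Ngt; apply: contraL dvd => x0.
by rewrite gtnNdvd// (leq_trans (ltn_ord x)).
Qed.

(** Translating the variable by 1 multiplies the sum by [e m], which differs from 1 when [m] is
    nonzero. *)
Lemma sum_echar m : \sum_(x : 'Z_N.+2) e (m * x) = n%:R *+ (m == 0).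
Proof.
case: eqVneq => [->|m0].
  rewrite (eq_bigr (fun=> 1)) => [|i _]; last by rewrite mul0r echar0.
  by rewrite sumr_const card_ord.
rewrite mulr0n; apply/eqP.
have em1 : e m - 1 != 0 by rewrite subr_eq0 echar_eq1.
apply/eqP/(mulfI em1); rewrite mulr0 mulrBl mul1r mulr_sumr.
apply/eqP; rewrite subr_eq0; apply/eqP.
rewrite [RHS](reindex_inj (@addrI _ 1))/=; apply: eq_bigr => x _.
by rewrite mulrDr mulr1 echarD.
Qed.

End Characters.

(** Eliminating z = x + y - 1 from the second equation leaves (x - 1)(y - 1)(x + y) = 0. Zero
    divisors forbid any further conclusion, so the product itself is kept, in terms of x - 1 and y -
    1 to match [triple0]. *)
Lemma unit_system_factor (R : comUnitRingType) (x y z : R) :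
  x \is a GRing.unit -> y \is a GRing.unit -> z \is a GRing.unit ->
  x + y = z + 1 -> x^-1 + y^-1 = z^-1 + 1 ->
  (x - 1) * (y - 1) * (x - 1 + (y - 1) + 2) = 0.
Proof.
move=> xu yu zu E1 E2.
have zE : z = x + y - 1 by rewrite E1 addrK.
have E3 : (x + y) * z = x * y * (1 + z).
  have -> : (x + y) * z = (x^-1 + y^-1) * (x * y) * z.
    by congr (_ * _); rewrite mulrDl mulrA mulVr// mul1r mulrCA mulVr// mulr1 addrC.
  rewrite E2 mulrAC mulrDl mulVr// mul1r; ring.
have -> : (x - 1) * (y - 1) * (x - 1 + (y - 1) + 2) =
          x * y * (1 + (x + y - 1)) - (x + y) * (x + y - 1) by ring.
by rewrite -zE E3 subrr.
Qed.

Lemma scale_sum_eq (R : comUnitRingType) (x y z u : R) : u \is a GRing.unit ->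
  (x * u + y * u == z * u + u) = (x + y == z + 1).
Proof.
by move=> uu; rewrite -mulrDl -[X in _ == _ + X]mul1r -mulrDl (inj_eq (mulIr uu)).
Qed.

Lemma scale_sumV_eq (R : comUnitRingType) (x y z u : R) :
  x \is a GRing.unit -> y \is a GRing.unit -> z \is a GRing.unit ->
  u \is a GRing.unit ->
  ((x * u)^-1 + (y * u)^-1 == (z * u)^-1 + u^-1) =
  (x^-1 + y^-1 == z^-1 + 1^-1).
Proof.
move=> xu yu zu uu; rewrite !invrM// -mulrDr -[X in _ == _ + X]mulr1 -mulrDr.
by rewrite invr1 (inj_eq (mulrI _))// unitrV.
Qed.

(** * Fourth moment of Kloosterman sums *)

Section Kloosterman.
Variables (A : finComUnitRingType) (e : A -> algC).
Hypothesis eD : forall x y, e (x + y) = e x * e y.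
Hypothesis norm_e : forall x, `|e x| = 1.
Hypothesis sum_e : forall m, \sum_x e (m * x) = #|A|%:R *+ (m == 0).

Definition kloos (m k : A) : algC :=
  \sum_(x : A | x \is a GRing.unit) e (m * x + k * x^-1).

(** The size of the annihilator of [m], hence of every nonempty fibre of multiplication by [m]. *)
Definition annz (m : A) : nat := \sum_(t : A) (m * t == 0)%R.

(* With x and y standing for x - 1 and y - 1, the solutions in units of
   x + y = z + 1, x^-1 + y^-1 = z^-1 + 1, which the fourth moment counts. *)
Definition triple0 : nat :=
  \sum_(x : A) \sum_(y : A) (x * y * (x + y + 2) == 0)%R.

Lemma reindex_mul_unit (V : Type) (idx : V) (op : Monoid.com_law idx)
    (F : A -> V) (t : A) :
  t \is a GRing.unit ->
  \big[op/idx]_(x : A | x \is a GRing.unit) F x =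
  \big[op/idx]_(x : A | x \is a GRing.unit) F (x * t).
Proof.
move=> tu; rewrite (reindex_inj (@mulIr _ t tu))/=.
by apply: eq_bigl => x; rewrite unitrMl.
Qed.

(** The substitution of [x * t] for [x]. One value of the sum is thus repeated along a whole orbit
    of frequencies, which is why a moment over all frequencies bounds an individual sum. *)
Lemma kloos_scale t m k : t \is a GRing.unit ->
  kloos (m * t) (k / t) = kloos m k.
Proof.
move=> tu; rewrite /kloos [RHS](reindex_mul_unit _ _ tu)//.
apply: eq_bigr => x xu; congr (e _).
by rewrite invrM// [x * t]mulrC !mulrA.
Qed.

Lemma kloosC m k : kloos m k = kloos k m.
Proof.
rewrite /kloos (reindex_inj (@invr_inj _))/=.
apply: eq_big => [x|x xu]; first by rewrite unitrV.
by rewrite invrK addrC.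
Qed.

Lemma sum_unit_pairs (V : Type) (idx : V) (op : Monoid.com_law idx)
    (F : A -> A -> V) :
  \big[op/idx]_(t : A * A | (t.1 \is a GRing.unit) && (t.2 \is a GRing.unit))
     F t.1 t.2 =
  \big[op/idx]_(x : A | x \is a GRing.unit)
     \big[op/idx]_(y : A | y \is a GRing.unit) F x y.
Proof. by rewrite pair_big. Qed.

(** Orthogonality in [m] and in [k] keeps only the pairs (t, s) with the same [a] and the same
    [b]. *)
Lemma second_moment (T : finType) (P : pred T) (a b : T -> A) :
  \sum_(m : A) \sum_(k : A)
    `|\sum_(t | P t) e (m * a t + k * b t)| ^+ 2 =
  #|A|%:R ^+ 2 *
  (\sum_(t | P t) \sum_(s | P s) ((a t == a s) && (b t == b s)))%:R.
Proof.
have H (m k : A) : `|\sum_(t | P t) e (m * a t + k * b t)| ^+ 2 =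
   \sum_(t | P t) \sum_(s | P s) (e ((a t - a s) * m) * e ((b t - b s) * k)).
  rewrite normCK rmorph_sum mulr_suml; apply: eq_bigr => t _.
  rewrite mulr_sumr; apply: eq_bigr => s _.
  by rewrite /= (conj_char eD norm_e) -!eD; congr (e _); ring.
rewrite (eq_bigr _ (fun m _ => eq_bigr _ (fun k _ => H m k))).
under eq_bigr do rewrite exchange_big/=.
rewrite exchange_big/= natr_sum mulr_sumr; apply: eq_bigr => t _.
under eq_bigr do rewrite exchange_big/=.
rewrite exchange_big/= natr_sum mulr_sumr; apply: eq_bigr => s _.
under eq_bigr do rewrite -mulr_sumr sum_e.
rewrite -mulr_suml sum_e !subr_eq0.
by case: eqP; case: eqP => _ _ /=; rewrite ?mulr0n ?mulr1n ?mulr0 ?mul0r ?mulr1 ?expr2.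
Qed.

Definition phiz : nat := \sum_(x : A | x \is a GRing.unit) 1.

Lemma phiz_gt0 : (0 < phiz)%N.
Proof. by rewrite /phiz (bigD1 1)//= unitr1. Qed.

(** The system is homogeneous: dividing x, y, z by the unit u reduces to u = 1, which costs a factor
    [phiz]. Then z is determined by x and y, and (x - 1, y - 1) is a solution counted by
    [triple0]. *)
Lemma energy_le :
  (\sum_(t : A * A | (t.1 \is a GRing.unit) && (t.2 \is a GRing.unit))
   \sum_(s : A * A | (s.1 \is a GRing.unit) && (s.2 \is a GRing.unit))
     ((t.1 + t.2 == s.1 + s.2) && (t.1^-1 + t.2^-1 == s.1^-1 + s.2^-1))%R <=
   phiz * triple0)%N.
Proof.
rewrite exchange_big/=.
pose g (x y z : A) (u : A) : nat :=
  (x + y == z + u) && (x^-1 + y^-1 == z^-1 + u^-1).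
rewrite [leqLHS](sum_unit_pairs _
  (fun z u => \sum_(t : A * A | (t.1 \is a GRing.unit) && (t.2 \is a GRing.unit)) g t.1 t.2 z u)%N).
rewrite exchange_big/= /phiz big_distrl/=; apply: leq_sum => u uu.
rewrite mul1n (reindex_mul_unit _ _ uu)//.
have step z : z \is a GRing.unit ->
  (\sum_(t : A * A | (t.1 \is a GRing.unit) && (t.2 \is a GRing.unit)) g t.1 t.2 (z * u)%R u =
   \sum_(x : A | x \is a GRing.unit) \sum_(y : A | y \is a GRing.unit) g x y z 1%R)%N.
  move=> zu.
  rewrite [LHS](sum_unit_pairs _ (fun x y => g x y (z * u)%R u)).
  rewrite (reindex_mul_unit _ _ uu)//; apply: eq_bigr => x xu.
  rewrite (reindex_mul_unit _ _ uu)//; apply: eq_bigr => y yu.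
  rewrite /g; congr (nat_of_bool (_ && _)).
    exact: scale_sum_eq.
  exact: scale_sumV_eq.
rewrite (eq_bigr _ step)/= exchange_big/= /triple0.
rewrite [leqRHS](reindex_inj (@addIr _ (-1)))/=.
rewrite [leqRHS](bigID (fun x : A => x \is a GRing.unit))/=.
apply: leq_trans (leq_addr _ _); apply: leq_sum => x xu.
rewrite exchange_big/= [leqRHS](reindex_inj (@addIr _ (-1)))/=.
rewrite [leqRHS](bigID (fun x : A => x \is a GRing.unit))/=.
apply: leq_trans (leq_addr _ _); apply: leq_sum => y yu.
case: (boolP (_ == 0)) => [_|ne0].
  apply: (@leq_trans (\sum_(z : A) (z == x + y - 1)%R)%N).
    rewrite [leqRHS](bigID (fun x : A => x \is a GRing.unit))/=.
    apply: leq_trans (leq_addr _ _); apply: leq_sum => z zu.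
    rewrite /g; case: eqP => //= -> ; rewrite addrK eqxx; exact: leq_b1.
  rewrite (bigD1 (x + y - 1))//= eqxx big1// => z /negPf ->//.
rewrite big1// => z zu; rewrite /g invr1; apply/eqP; rewrite eqb0.
apply: contra ne0 => /andP[/eqP E1 /eqP E2]; apply/eqP.
exact: (@unit_system_factor _ x y z).
Qed.

Lemma annz_coset (m m' : A) :
  (\sum_(t : A) (m * t == m')%R <= annz m)%N.
Proof.
case: (pickP (fun t : A => m * t == m')) => [t0 /eqP <-|none].
  rewrite /annz (reindex_inj (@addIr _ t0))/=; apply: leq_sum => t _.
  by rewrite mulrDr -subr_eq0 addrK.
by rewrite big1// => t _; rewrite none.
Qed.

(** Summed over the units t, the fourth powers at (m t, k / t) give [phiz] times the one at (m, k),
    and a given frequency pair is reached for at most [annz m] values of t. The full fourth moment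
    is the second moment of the squares, evaluated by [energy_le]; the factor [phiz] cancels. *)
Lemma kloos_bound m k :
  `|kloos m k| ^+ 4 <= (annz m)%:R * #|A|%:R ^+ 2 * triple0%:R.
Proof.
have sq m' k' : `|kloos m' k'| ^+ 4 =
  `|\sum_(t : A * A | (t.1 \is a GRing.unit) && (t.2 \is a GRing.unit))
      e (m' * (t.1 + t.2) + k' * (t.1^-1 + t.2^-1))| ^+ 2.
  rewrite (_ : 4%N = (2 * 2)%N)// exprM -normrX; congr (`|_| ^+ 2).
  rewrite expr2 /kloos [RHS](sum_unit_pairs _
    (fun x y => e (m' * (x + y) + k' * (x^-1 + y^-1)))).
  rewrite mulr_suml; apply: eq_bigr => x _.
  rewrite mulr_sumr; apply: eq_bigr => y _.
  by rewrite -eD; congr (e _); ring.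
have phi0 : 0 < phiz%:R :> algC by rewrite ltr0n phiz_gt0.
rewrite -(ler_pM2l phi0).
have -> : phiz%:R * `|kloos m k| ^+ 4 =
  \sum_(t : A | t \is a GRing.unit) `|kloos (m * t) (k / t)| ^+ 4.
  rewrite /phiz natr_sum mulr_suml; apply: eq_bigr => t tu.
  by rewrite mul1r kloos_scale.
have -> : \sum_(t : A | t \is a GRing.unit) `|kloos (m * t) (k / t)| ^+ 4 =
  \sum_(m' : A) \sum_(k' : A)
   (\sum_(t : A | t \is a GRing.unit) ((m * t == m') && (k / t == k'))%:R) *
     `|kloos m' k'| ^+ 4.
  under [RHS]eq_bigr do under eq_bigr do rewrite mulr_suml.
  under [RHS]eq_bigr do rewrite exchange_big/=.
  rewrite [RHS]exchange_big/=; apply: eq_bigr => t tu.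
  rewrite (bigD1 (m * t))//= (bigD1 (k / t))//= !eqxx mul1r.
  rewrite big1 => [|k' /negPf k'n]; last by rewrite eq_sym k'n mul0r.
  rewrite addr0 big1 ?addr0// => m' /negPf m'n.
  by rewrite big1// => k' _; rewrite eq_sym m'n mul0r.
apply: (@le_trans _ _ (\sum_(m' : A) \sum_(k' : A)
   (annz m)%:R * `|kloos m' k'| ^+ 4)).
  apply: ler_sum => m' _; apply: ler_sum => k' _.
  rewrite ler_wpM2r ?exprn_ge0// -natr_sum ler_nat.
  apply: leq_trans (annz_coset m m').
  rewrite [leqRHS](bigID (fun x : A => x \is a GRing.unit))/=.
  apply: leq_trans (leq_addr _ _); apply: leq_sum => t _.
  by case: (m * t == m') => //=; case: (_ == _).
under eq_bigr do rewrite -mulr_sumr.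
rewrite -mulr_sumr.
under eq_bigr do under eq_bigr do rewrite sq.
rewrite (second_moment _ (fun t : A * A => t.1 + t.2) (fun t : A * A => t.1^-1 + t.2^-1)).
rewrite [leRHS](_ : _ = (annz m)%:R * (#|A|%:R ^+ 2 * (phiz * triple0)%:R)).
  by rewrite ler_wpM2l// ler_wpM2l ?exprn_ge0// ler_nat energy_le.
by rewrite natrM; ring.
Qed.

End Kloosterman.

(** Lagrange's identity: twice the defect is the sum of the squares of a_i b_j - a_j b_i. *)
Lemma sum_mul_sqr_le (R : numDomainType) (T : finType) (a b : T -> R) :
  (forall i, 0 <= a i) -> (forall i, 0 <= b i) ->
  (\sum_i a i * b i) ^+ 2 <= (\sum_i a i ^+ 2) * (\sum_i b i ^+ 2).
Proof.
move=> a0 b0; rewrite -subr_ge0 -(pmulrn_lge0 _ (isT : (0 < 2)%N)).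
have -> : ((\sum_i a i ^+ 2) * (\sum_i b i ^+ 2) - (\sum_i a i * b i) ^+ 2) *+ 2
  = \sum_i \sum_j (a i * b j - a j * b i) ^+ 2.
  rewrite mulrnBl mulr2n {2}[(\sum_i a i ^+ 2) * _]mulrC expr2 !mulr_suml.
  rewrite -big_split -sumrMnl -sumrB/=; apply: eq_bigr => i _.
  rewrite !mulr_sumr -big_split -sumrMnl -sumrB/=; apply: eq_bigr => j _.
  by ring.
apply: sumr_ge0 => i _; apply: sumr_ge0 => j _.
by rewrite real_exprn_even_ge0// rpredB// ger0_real// mulr_ge0.
Qed.

Lemma norm_sum_mul_sqr_le (T : finType) (P : pred T) (a b : T -> algC) :
  `|\sum_(i | P i) a i * b i| ^+ 2 <=
  (\sum_i `|a i| ^+ 2) * (\sum_(i | P i) `|b i| ^+ 2).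
Proof.
pose b' i : algC := if P i then b i else 0.
have -> : \sum_(i | P i) `|b i| ^+ 2 = \sum_i `|b' i| ^+ 2.
  rewrite big_mkcond/=; apply: eq_bigr => i _; rewrite /b'.
  by case: ifP => // _; rewrite normr0 expr0n.
have -> : \sum_(i | P i) a i * b i = \sum_i a i * b' i.
  rewrite big_mkcond/=; apply: eq_bigr => i _; rewrite /b'.
  by case: ifP => // _; rewrite mulr0.
apply: le_trans (sum_mul_sqr_le _ _) => //.
apply: lerXn2r; rewrite ?nnegrE//.
  by apply: sumr_ge0 => i _; rewrite mulr_ge0.
apply: le_trans (ler_norm_sum _ _ _) _; apply: ler_sum => i _.
by rewrite normrM.
Qed.

(** * Splitting into low and high frequencies *)

Section LowFrequencies.
Variables (A : finComUnitRingType) (e : A -> algC).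
Hypothesis eD : forall x y, e (x + y) = e x * e y.
Hypothesis norm_e : forall x, `|e x| = 1.
Hypothesis sum_e : forall m, \sum_x e (m * x) = #|A|%:R *+ (m == 0).
Variable H : nat.
Hypothesis H_gt0 : (0 < H)%N.

Definition geom (m : A) : algC := \sum_(i < H) e (m * i%:R).

(* The frequencies m that are "low" at scale #|A| / H: no size is attached to
   m, only the lack of cancellation in a geometric sum of length H. *)
Definition low (m : A) : bool := H%:R < 2 * `|geom m|.

Lemma geom0 : geom 0 = H%:R.
Proof.
rewrite /geom (eq_bigr (fun=> 1)) => [|i _]; last by rewrite mul0r (char0 eD norm_e).
by rewrite sumr_const card_ord.
Qed.

Lemma low0 : low 0.
Proof. by rewrite /low geom0 normr_nat -natrM ltr_nat; lia. Qed.

(** Chebyshev's inequality: since 0, ..., H - 1 are distinct in [A], the squares of the geometric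
    sums add up to |A| H, and each low frequency contributes more than H^2 / 4. *)
Lemma card_low : (forall i j : 'I_H, i%:R = j%:R :> A -> i = j) ->
  ((\sum_(m | low m) 1) * H <= 4 * #|A|)%N.
Proof.
move=> inj.
have E : \sum_m `|geom m| ^+ 2 = (#|A| * H)%:R.
  transitivity (\sum_m \sum_(i < H) \sum_(j < H) e ((i%:R - j%:R) * m)).
    apply: eq_bigr => m _; rewrite /geom sqr_norm_sum.
    apply: eq_bigr => i _; apply: eq_bigr => j _.
    by rewrite (conj_char eD norm_e) -eD; congr (e _); ring.
  rewrite exchange_big/= mulnC natrM mulr_natl.
  rewrite -[X in _ *+ X](card_ord H) -sumr_const; apply: eq_bigr => i _.
  rewrite exchange_big/= (bigD1 i)//= sum_e subrr eqxx big1 ?addr0// => j ji.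
  rewrite sum_e subr_eq0; case: eqP => // /inj ij.
  by rewrite ij eqxx in ji.
have : (\sum_(m | low m) 1)%:R * H%:R ^+ 2 <= 4 * (#|A| * H)%:R :> algC.
  rewrite -E mulr_sumr [leRHS](bigID low)/= -[leLHS]addr0 lerD//; last first.
    by apply: sumr_ge0 => m _; rewrite mulr_ge0// exprn_ge0.
  rewrite natr_sum mulr_suml; apply: ler_sum => m /ltW lm.
  rewrite mul1r (_ : 4 = 2 ^+ 2); last by rewrite expr2 -natrM.
  by rewrite -exprMn lerXn2r ?nnegrE ?mulr_ge0.
rewrite expr2 mulrA natrM mulrA -!natrM ler_nat.
by rewrite leq_pmul2r.
Qed.

(** By Parseval, a translation by i weights the spectrum of [f] by |e(m i) - 1|^2. Summed over i <
    H, this weight is at least H at every frequency that is not low, whereas each translation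
    changes [f] by at most 2 H in mean square. *)
Lemma tail_energy (f : A -> algC) :
  (forall i : 'I_H, \sum_x `|f (x + i%:R) - f x| ^+ 2 <= (2 * H)%:R) ->
  \sum_(m | ~~ low m) `|fourier e f m| ^+ 2 <= (#|A| * (2 * H))%:R.
Proof.
move=> fH.
have E (i : 'I_H) : \sum_m `|fourier e f m| ^+ 2 * `|e (m * i%:R) - 1| ^+ 2 <=
    (#|A| * (2 * H))%:R.
  rewrite natrM; apply: le_trans (ler_wpM2l _ (fH i)) => //.
  rewrite -(fourier_parseval eD norm_e sum_e (fun x => f (x + i%:R) - f x)).
  apply: ler_sum => m _; rewrite -exprMn -normrM mulrC.
  rewrite mulrBl mul1r -(fourier_shift eD) /fourier -sumrB.
  by rewrite le_eqVlt; apply/orP; left; apply/eqP; congr (`|_| ^+ 2);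
     apply: eq_bigr => x _; rewrite mulrBl.
(* The sum equals 2 H - 2 Re(geom m), and 2 |geom m| is at most H. *)
have G m : ~~ low m -> H%:R <= \sum_(i < H) `|e (m * i%:R) - 1| ^+ 2.
  move=> nl.
  have -> : \sum_(i < H) `|e (m * i%:R) - 1| ^+ 2 =
      2 * H%:R - (geom m + (geom m)^*).
    rewrite /geom rmorph_sum -big_split/= mulr_natr -[X in _ *+ X](card_ord H).
    rewrite -sumr_const -sumrB; apply: eq_bigr => i _.
    rewrite normCK rmorphB rmorph1 mulrBl !mulrBr mul1r mulr1 -normCK norm_e expr1n.
    by rewrite /=; ring.
  have re : geom m + (geom m)^* \is Num.real.
    by apply/CrealP; rewrite rmorphD/= conjCK addrC.
  have : geom m + (geom m)^* <= H%:R.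
    apply: le_trans (real_ler_norm re) _; apply: le_trans (ler_normD _ _) _.
    rewrite norm_conjC -mulr2n; move: nl; rewrite /low mulr_natl -real_leNgt//.
  rewrite -subr_ge0 => S0; rewrite -subr_ge0 (le_trans S0)//.
  by rewrite le_eqVlt; apply/orP; left; apply/eqP; ring.
have : H%:R * \sum_(m | ~~ low m) `|fourier e f m| ^+ 2 <= H%:R * (#|A| * (2 * H))%:R.
  apply: (@le_trans _ _ (\sum_(i < H)
      \sum_m `|fourier e f m| ^+ 2 * `|e (m * i%:R) - 1| ^+ 2)).
    rewrite exchange_big/= [leRHS](bigID low)/= -[leLHS]add0r lerD//.
      by apply: sumr_ge0 => m _; apply: sumr_ge0 => i _; rewrite mulr_ge0// exprn_ge0.
    rewrite mulr_sumr; apply: ler_sum => m nl; rewrite -mulr_sumr mulrC.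
    by rewrite ler_wpM2l ?exprn_ge0// G.
  rewrite mulr_natl -[X in _ *+ X](card_ord H) -sumr_const.
  by apply: ler_sum => i _.
by rewrite ler_pM2l// ltr0n.
Qed.

Definition low_part (f : A -> algC) (x : A) : algC :=
  #|A|%:R^-1 * \sum_m (if low m then fourier e f m else 0) * e (m * x).
Definition high_part (f : A -> algC) (x : A) : algC :=
  #|A|%:R^-1 * \sum_m (if low m then 0 else fourier e f m) * e (m * x).

Lemma cardA_neq0 : #|A|%:R != 0 :> algC.
Proof. by rewrite pnatr_eq0 -lt0n; apply/card_gt0P; exists 0. Qed.

Lemma cardA_gt0 : 0 < #|A|%:R :> algC.
Proof. by rewrite lt0r cardA_neq0/=. Qed.

Lemma cardA_normVM : `|#|A|%:R^-1| ^+ 2 * #|A|%:R = #|A|%:R^-1 :> algC.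
Proof. by rewrite normfV normr_nat expr2 -mulrA mulVf ?cardA_neq0// mulr1. Qed.

Lemma low_high f x : f x = low_part f x + high_part f x.
Proof.
rewrite /low_part /high_part -mulrDr -big_split/=.
rewrite [X in _ * X](_ : _ = \sum_m fourier e f m * e (m * x)).
  by rewrite (fourier_inv eD norm_e sum_e) mulKf// cardA_neq0.
apply: eq_bigr => m _; rewrite -mulrDl; case: ifP => _; by rewrite ?addr0 ?add0r.
Qed.

Lemma low_part_energy f :
  \sum_x `|low_part f x| ^+ 2 <= \sum_x `|f x| ^+ 2.
Proof.
under eq_bigr do rewrite /low_part normrM exprMn.
rewrite -mulr_sumr (parseval eD norm_e sum_e) mulrA.
rewrite cardA_normVM.
rewrite -(ler_pM2l cardA_gt0) mulVKf ?cardA_neq0// -(fourier_parseval eD norm_e sum_e).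
apply: ler_sum => m _; case: ifP => // _.
by rewrite normr0 expr0n exprn_ge0.
Qed.

Lemma high_part_energy (f : A -> algC) :
  (forall i : 'I_H, \sum_x `|f (x + i%:R) - f x| ^+ 2 <= (2 * H)%:R) ->
  \sum_x `|high_part f x| ^+ 2 <= (2 * H)%:R.
Proof.
move=> fH.
under eq_bigr do rewrite /high_part normrM exprMn.
rewrite -mulr_sumr (parseval eD norm_e sum_e) mulrA.
rewrite cardA_normVM.
rewrite -(ler_pM2l cardA_gt0) mulVKf ?cardA_neq0// -natrM.
apply: le_trans (tail_energy fH); rewrite [leRHS]big_mkcond/=.
by apply: ler_sum => m _; case: ifP => //; rewrite normr0 expr0n.
Qed.

(** The product splits as high times all, low times high, and low times low. The first two are at
    most the square root of 2 H |A| by Cauchy-Schwarz, and the condition on [h] makes this at most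
    |A| / h. The third is a combination of Kloosterman sums over low frequencies, whose term at (0,
    0) is the main term. *)
Lemma hyperbola_equidistribution (f g : A -> algC) (c : A) (h : nat) (K : algC) :
  c \is a GRing.unit -> (0 < h)%N -> (2 * H * h ^ 2 <= #|A|)%N ->
  (forall x, `|f x| <= 1) -> (forall x, `|g x| <= 1) ->
  (forall i : 'I_H, \sum_x `|f (x + i%:R) - f x| ^+ 2 <= (2 * H)%:R) ->
  (forall i : 'I_H, \sum_x `|g (x + i%:R) - g x| ^+ 2 <= (2 * H)%:R) ->
  0 <= K ->
  (forall m k, low m -> low k -> (m != 0) || (k != 0) ->
    `|kloos e m (k * c)| <= K) ->
  `|\sum_(x | x \is a GRing.unit) f x * g (c * x^-1) -
     #|A|%:R ^- 2 * (\sum_x f x) * (\sum_x g x) * (phiz A)%:R| <=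
   2 * (#|A|%:R / h%:R) + (\sum_(m | low m) 1)%:R ^+ 2 * K.
Proof.
move=> cu h0 Hh f1 g1 fH gH K0 klK.
set n := #|A| in Hh *; have n0 : 0 < n%:R :> algC by exact: cardA_gt0.
have energy (u : A -> algC) : (forall x, `|u x| <= 1) ->
    \sum_x `|u x| ^+ 2 <= n%:R.
  move=> u1; apply: (@le_trans _ _ (\sum_(x : A) 1)); last by rewrite sumr_const.
  by apply: ler_sum => x _; rewrite exprn_ile1.
have small (z : algC) : `|z| ^+ 2 <= (2 * H * n)%:R -> `|z| <= n%:R / h%:R.
  move=> zH; rewrite -(@ler_pXn2r _ 2)// ?nnegrE ?divr_ge0//.
  apply: le_trans zH _; rewrite expr_div_n ler_pdivlMr ?exprn_gt0 ?ltr0n//.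
  by rewrite -!natrX -natrM ler_nat; nia.
have e1 : `|\sum_(x | x \is a GRing.unit) high_part f x * g (c * x^-1)| <= n%:R / h%:R.
  apply: small; apply: le_trans (norm_sum_mul_sqr_le _ _ _) _.
  rewrite natrM; apply: ler_pM; try by apply: sumr_ge0 => i _; rewrite exprn_ge0.
    exact: high_part_energy.
  apply: (@le_trans _ _ (\sum_(x : A) 1)); last by rewrite sumr_const.
  rewrite big_mkcond/=; apply: ler_sum => x _; case: ifP => // _.
  by rewrite exprn_ile1.
have e2 : `|\sum_(x | x \is a GRing.unit) low_part f x * high_part g (c * x^-1)| <=
    n%:R / h%:R.
  apply: small; apply: le_trans (norm_sum_mul_sqr_le _ _ _) _.
  rewrite mulnC natrM; apply: ler_pM; try by apply: sumr_ge0 => i _; rewrite exprn_ge0.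
    exact: le_trans (low_part_energy f) (energy _ f1).
  apply: le_trans (high_part_energy gH).
  have inj : injective (fun x : A => c * x^-1).
    by move=> x y /(mulrI cu)/invr_inj.
  rewrite [leRHS](reindex_inj inj)/= big_mkcond/=.
  by apply: ler_sum => x _; case: ifP => // _; rewrite exprn_ge0.
pose lf m := if low m then fourier e f m else 0.
pose lg m := if low m then fourier e g m else 0.
have e3 : \sum_(x | x \is a GRing.unit) low_part f x * low_part g (c * x^-1) =
    n%:R ^- 2 * \sum_m \sum_k lf m * lg k * kloos e m (k * c).
  transitivity (n%:R ^- 2 * \sum_(x | x \is a GRing.unit) \sum_m \sum_k
      lf m * lg k * e (m * x + k * c * x^-1)).
    rewrite mulr_sumr; apply: eq_bigr => x xu; rewrite /low_part mulrACA -expr2 exprVn.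
    rewrite mulr_suml; congr (_ * _); apply: eq_bigr => m _.
    rewrite mulr_sumr; apply: eq_bigr => k _.
    by rewrite eD mulrACA -/(lf m) -/(lg k) !mulrA.
  congr (_ * _); rewrite exchange_big/=; apply: eq_bigr => m _.
  rewrite exchange_big/=; apply: eq_bigr => k _.
  by rewrite /kloos mulr_sumr.
have fh0 u : fourier e u 0 = \sum_x u x.
  by apply: eq_bigr => x _; rewrite mul0r oppr0 (char0 eD norm_e) mulr1.
have k00 : kloos e 0 (0 * c) = (phiz A)%:R.
  rewrite /kloos /phiz natr_sum; apply: eq_bigr => x _.
  by rewrite !mul0r addr0 (char0 eD norm_e).
have fhn u m : (forall x, `|u x| <= 1) -> `|fourier e u m| <= n%:R.
  move=> u1; apply: le_trans (ler_norm_sum _ _ _) _.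
  apply: (@le_trans _ _ (\sum_(x : A) 1)); last by rewrite sumr_const.
  by apply: ler_sum => x _; rewrite normrM norm_e mulr1.
have e4 : `|n%:R ^- 2 * (\sum_m \sum_k lf m * lg k * kloos e m (k * c)) -
     n%:R ^- 2 * (\sum_x f x) * (\sum_x g x) * (phiz A)%:R| <=
    (\sum_(m | low m) 1)%:R ^+ 2 * K.
  rewrite -mulrA -mulrA -mulrBr normrM normfV normrX normr_nat.
  rewrite ler_pdivrMl ?exprn_gt0//.
  pose F m k := lf m * lg k * kloos e m (k * c) *+ ((m != 0) || (k != 0)).
  have -> : \sum_m \sum_k lf m * lg k * kloos e m (k * c) -
      (\sum_x f x) * ((\sum_x g x) * (phiz A)%:R) = \sum_m \sum_k F m k.
    rewrite (bigD1 0)//= [in RHS](bigD1 0)//= (bigD1 0)//= [in RHS](bigD1 0)//=.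
    rewrite k00 /lf /lg low0 !fh0 {1}/F eqxx/= mulr0n add0r [X in _ - X]mulrA.
    have E (a b d : algC) : a + b + d - a = b + d by ring.
    rewrite E; congr (_ + _).
      by apply: eq_bigr => k k0; rewrite /F k0 orbT mulr1n /lf /lg low0 fh0.
    apply: eq_bigr => m m0; apply: eq_bigr => k _.
    by rewrite /F m0 mulr1n /lf /lg.
  apply: le_trans (ler_norm_sum _ _ _) _.
  apply: (@le_trans _ _ (\sum_(m | low m) \sum_(k | low k) n%:R ^+ 2 * K)).
    rewrite [leRHS]big_mkcond/=; apply: ler_sum => m _.
    apply: le_trans (ler_norm_sum _ _ _) _; rewrite /F /lf.
    case: ifP => lm; last first.
      by rewrite big1// => k _; rewrite !mul0r mul0rn normr0.
    rewrite [leRHS]big_mkcond/=; apply: ler_sum => k _; rewrite /lg.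
    case: ifP => lk; last by rewrite mulr0 mul0r mul0rn normr0.
    case: (boolP (_ || _)) => mk; last first.
      by rewrite mulr0n normr0 mulr_ge0 ?exprn_ge0.
    by rewrite mulr1n !normrM expr2 ler_pM ?mulr_ge0// ?klK// ler_pM// fhn.
  have cst (z : algC) : \sum_(m | low m) z = (\sum_(m | low m) 1)%:R * z.
    by rewrite natr_sum mulr_suml; apply: eq_bigr => m _; rewrite mul1r.
  by rewrite !cst le_eqVlt; apply/orP; left; apply/eqP; ring.
have -> : \sum_(x | x \is a GRing.unit) f x * g (c * x^-1) =
    \sum_(x | x \is a GRing.unit) high_part f x * g (c * x^-1) +
    \sum_(x | x \is a GRing.unit) low_part f x * high_part g (c * x^-1) +
    \sum_(x | x \is a GRing.unit) low_part f x * low_part g (c * x^-1).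
  rewrite -!big_split/=; apply: eq_bigr => x _.
  by rewrite {1}(low_high f x) mulrDl {1}(low_high g) mulrDr; ring.
rewrite -!addrA; apply: le_trans (ler_normD _ _) _.
rewrite mulr_natl mulr2n -addrA lerD//.
apply: le_trans (ler_normD _ _) _; rewrite lerD//.
by rewrite e3.
Qed.

End LowFrequencies.

(** * Modular hyperbolas *)

Section LowFrequencyAnnihilators.
Variables (A : finComUnitRingType) (e : A -> algC).
Hypothesis eD : forall x y, e (x + y) = e x * e y.
Hypothesis norm_e : forall x, `|e x| = 1.
Variable H : nat.

(** The ratio has order r > 1, so complete blocks of r consecutive terms vanish and fewer than r
    terms remain. *)
Lemma geom_lt (m : A) (r : nat) : r.-primitive_root (e m) -> (1 < r)%N ->
  `|geom e H m| < r%:R.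
Proof.
move=> pr r1.
have E k : \sum_(i < k) e (m * i%:R) = \sum_(i < k) e m ^+ i.
  by apply: eq_bigr => i _; rewrite mulr_natr (charMn eD norm_e).
have z1 : e m - 1 != 0.
  rewrite subr_eq0 -(expr1 (e m)) -(prim_order_dvd pr) dvdn1; lia.
have -> : geom e H m = \sum_(i < H %% r) e m ^+ i.
  rewrite /geom E; apply: (mulfI z1).
  by rewrite -!subrX1 (prim_expr_mod pr).
apply: (@le_lt_trans _ _ (H %% r)%:R); last first.
  by rewrite ltr_nat ltn_mod ltnW.
apply: le_trans (ler_norm_sum _ _ _) _.
rewrite -[X in _ <= X%:R](card_ord (H %% r)) -sumr_const.
by apply: ler_sum => i _; rewrite normrX norm_e expr1n.
Qed.

(** The translates of the annihilator of [m] by 0, ..., r - 1 are disjoint: m i is constant on a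
    coset of the annihilator, and its image under [e] determines i modulo r. *)
Lemma annz_order (m : A) (r : nat) : r.-primitive_root (e m) ->
  (annz m * r <= #|A|)%N.
Proof.
move=> pr.
have em_neq0 := char_neq0 norm_e m.
apply: (@leq_trans (\sum_(x : A) \sum_(i < r) (m * (x - i%:R) == 0)%R)).
  rewrite exchange_big/= mulnC -[X in (X * _ <= _)%N](card_ord r) -sum_nat_const.
  apply: leq_sum => i _; rewrite /annz [leqRHS](reindex_inj (@addIr _ i%:R))/=.
  by apply: leq_sum => t _; rewrite addrK.
rewrite -sum1_card; apply: leq_sum => x _.
case: (pickP (fun i : 'I_r => m * (x - i%:R) == 0)) => [i0 /eqP i0E|none]; last first.
  by rewrite big1// => i _; rewrite none.
rewrite (bigD1 i0)//= i0E eqxx big1// => i ii0.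
apply/eqP; rewrite eqb0; apply: contra ii0 => /eqP iE.
have : e (m * i%:R) = e (m * i0%:R).
  congr e; apply/eqP; rewrite -subr_eq0 -opprB oppr_eq0 -mulrBr.
  have -> : i0%:R - i%:R = (x - i%:R) - (x - i0%:R) :> A by ring.
  by rewrite mulrBr iE i0E subrr.
rewrite !mulr_natr !(charMn eD norm_e) => /eqP.
rewrite (eq_prim_root_expr pr) !modn_small// => /eqP E.
Qed.

(** Being low forces H < 2 r by [geom_lt], and an annihilator with r disjoint translates has at most
    |A| / r elements. *)
Lemma annz_low (m : A) (r : nat) : r.-primitive_root (e m) -> (1 < r)%N ->
  low e H m -> (annz m * H <= 2 * #|A|)%N.
Proof.
move=> pr r1; rewrite /low => lowm.
have Hr : (H < 2 * r)%N.
  rewrite -(ltr_nat algC) natrM; apply: lt_le_trans lowm _.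
  by rewrite ler_wpM2l// ltW// geom_lt.
by have := annz_order pr; nia.
Qed.

End LowFrequencyAnnihilators.

Lemma sum_dvdn_ord (d k : nat) : (0 < d)%N -> (\sum_(0 <= x < k * d) (d %| x) = k)%N.
Proof.
move=> d0; elim: k => [|k IH]; first by rewrite mul0n big_geq.
rewrite mulSn addnC (@big_cat_nat _ _ _ (k * d))//= ?leq_addr// IH.
rewrite -{1}[(k * d)%N]add0n big_addn addKn -addn1; congr addn.
under eq_bigr do rewrite dvdn_addl ?dvdn_mull//.
rewrite big_ltn// dvdn0 big_nat big1// => i /andP[i0 id].
by rewrite gtnNdvd.
Qed.

(** Bounds the number of residues x modulo n with gcd(x, n) > D, since such an x is a multiple of
    some divisor d > D. Divided by n it is the sum of 1 / d over these divisors, which is small on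
    average over n. *)
Definition large_divisor_sum (D n : nat) : nat :=
  (\sum_(d <- divisors n | D < d) n %/ d)%N.

Section ConcreteModulus.
Variable N : nat.
Let n := N.+2.

Lemma card_large_gcd (D : nat) :
  (\sum_(x : 'Z_N.+2) (D < gcdn x n) <= large_divisor_sum D n)%N.
Proof.
apply: (@leq_trans (\sum_(x : 'Z_N.+2) \sum_(d <- divisors n | D < d) (d %| x))%N).
  apply: leq_sum => x _; case: ltnP => // Dg.
  rewrite (big_rem (gcdn x n))/=; last by rewrite -dvdn_divisors// dvdn_gcdr.
  by rewrite Dg dvdn_gcdl.
rewrite exchange_big/= /large_divisor_sum big_seq_cond [leqRHS]big_seq_cond.
apply: leq_sum => d /andP[]; rewrite -dvdn_divisors// => dn _.
have d0 : (0 < d)%N by apply: dvdn_gt0 dn.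
have : (\sum_(x : 'Z_N.+2) (d %| x) = n %/ d)%N.
  rewrite -[RHS](@sum_dvdn_ord d) // divnK// big_mkord.
  by [].
by move=> ->.
Qed.

(** If n divides x y z then n divides the product of the three gcds with n, so one of them exceeds D
    as soon as D^3 < n. With one variable fixed, each of x, y and x + y + 2 runs uniformly over the
    residues. *)
Lemma triple0_le (D : nat) : (D ^ 3 < n)%N ->
  (triple0 'Z_N.+2 <= 3 * n * large_divisor_sum D n)%N.
Proof.
move=> Dn.
have cardZ (a : nat) : (\sum_(x : 'Z_N.+2) a = n * a)%N.
  by rewrite sum_nat_const card_ord.
pose G (x : 'Z_N.+2) : nat := (D < gcdn x n)%N.
have key (x y z : 'Z_N.+2) : x * y * z = 0 -> (1 <= G x + G y + G z)%N.
  move=> /(congr1 val)/= /eqP; rewrite modnMml => E0.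
  have nd : (n %| x * y * z)%N by [].
  rewrite lt0n; apply: contraL Dn => /eqP G0; rewrite -leqNgt.
  have [gx gy gz] : [/\ (gcdn x n <= D)%N, (gcdn y n <= D)%N & (gcdn z n <= D)%N].
    by move: G0; rewrite /G; do 3 case: ltnP => //.
  apply: (@leq_trans (gcdn x n * gcdn y n * gcdn z n)).
    apply: dvdn_leq; first by rewrite !muln_gt0 !gcdn_gt0 !orbT.
    have step a b : (n %| a * b -> n %| gcdn a n * b)%N.
      by move=> nab; rewrite muln_gcdl dvdn_gcd nab dvdn_mulr.
    rewrite -mulnA; apply: (step _ _); rewrite mulnCA; apply: (step _ _).
    by rewrite mulnA mulnC; apply: (step _ _); rewrite mulnC [(y * x)%N]mulnC.
  by rewrite -[(D ^ 3)%N]/(D * (D * D))%N mulnA leq_mul// leq_mul.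
apply: (@leq_trans (\sum_(x : 'Z_N.+2) \sum_(y : 'Z_N.+2) (G x + G y + G (x + y + 2)%R))).
  apply: leq_sum => x _; apply: leq_sum => y _; case: eqP => // E.
  exact: key.
under eq_bigr do rewrite !big_split/=.
rewrite !big_split/=.
have S1 : (\sum_(x : 'Z_N.+2) \sum_(y : 'Z_N.+2) G x = n * \sum_x G x)%N.
  by rewrite big_distrr/=; apply: eq_bigr => x _; rewrite cardZ.
have S2 : (\sum_(x : 'Z_N.+2) \sum_(y : 'Z_N.+2) G y = n * \sum_x G x)%N.
  by rewrite cardZ.
have S3 : (\sum_(x : 'Z_N.+2) \sum_(y : 'Z_N.+2) G (x + y + 2)%R = n * \sum_x G x)%N.
  rewrite -cardZ; apply: eq_bigr => x _.
  rewrite [RHS](reindex_inj (@addIr _ (x + 2)))/=; apply: eq_bigr => y _.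
  by congr G; ring.
rewrite S1 S2 S3.
have S : (\sum_x G x <= large_divisor_sum D n)%N := card_large_gcd D.
have := leq_mul (leqnn n) S; move: (\sum_x G x)%N => s; lia.
Qed.

End ConcreteModulus.

(** * Points of a modular hyperbola in a box *)

Section HyperbolaCount.
Variable N : nat.
Let n := N.+2.

(** The cyclic interval of [L] residues starting at [s]. *)
Definition arc (L : nat) (s x : 'Z_N.+2) : bool := (nat_of_ord (x - s)%R < L)%N.

Lemma arc_shift (L : nat) (s : 'Z_N.+2) (i : nat) :
  (\sum_(x : 'Z_N.+2) (arc L s (x + i%:R)%R != arc L s x) <= 2 * i)%N.
Proof.
elim: i => [|i IH].
  by rewrite big1// => x _; rewrite addr0 eqxx.
apply: (@leq_trans (\sum_(x : 'Z_N.+2)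
   ((arc L s (x + i%:R + 1)%R != arc L s (x + i%:R)%R) +
    (arc L s (x + i%:R)%R != arc L s x)))).
  apply: leq_sum => x _; rewrite -addrA natr1.
  by case: (arc _ _ _); case: (arc _ _ _); case: (arc _ _ _).
rewrite big_split/= mulnS leq_add//.
have -> : (\sum_(x : 'Z_N.+2) (arc L s (x + i%:R + 1)%R != arc L s (x + i%:R)%R) =
  \sum_(x : 'Z_N.+2) (arc L s (x + 1)%R != arc L s x))%N.
  by rewrite [RHS](reindex_inj (@addIr _ i%:R)).
rewrite (reindex_inj (@addIr _ s))/=.
(* A shift by one changes membership only just before the arc and at its last element. *)
apply: (@leq_trans (\sum_(x : 'Z_N.+2) ((val x == n.-1) + (val x == L.-1)))).
  apply: leq_sum => x _; rewrite /arc addrAC !addrK /=.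
  have xn : (x < N.+2)%N by apply: ltn_ord.
  rewrite modnDmr addn1; have [xn1|xn1] := eqVneq (x : nat) N.+1.
    by case: (_ != _).
  have -> : (x.+1 %% (Zp_trunc N.+2).+2 = x.+1)%N.
    by apply: modn_small; change (x.+1 < N.+2)%N; lia.
  rewrite add0n; case: (eqVneq (x : nat) L.-1) => [_|]; first by case: (_ != _).
  by case: ltnP; case: ltnP => //; lia.
rewrite big_split/=.
have one a : (\sum_(x : 'Z_N.+2) (val x == a) <= 1)%N.
  case: (pickP (fun x : 'Z_N.+2 => val x == a)) => [x0 /eqP x0E|none].
    rewrite (bigD1 x0)//= x0E eqxx big1// => x xx0; apply/eqP; rewrite eqb0.
    by apply: contra xx0 => /eqP xa; apply/eqP/val_inj/(etrans xa); rewrite x0E.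
  by rewrite big1// => x _; rewrite none.
by apply: (@leq_trans (1 + 1)); rewrite ?leq_add ?one.
Qed.

Lemma card_arc (L : nat) (s : 'Z_N.+2) : (L <= n)%N ->
  (\sum_(x : 'Z_N.+2) arc L s x = L)%N.
Proof.
move=> Ln; rewrite (reindex_inj (@addIr _ s))/=.
under eq_bigr do rewrite /arc addrK.
rewrite -(big_mkord predT (fun i => (i < L)%N : nat)).
rewrite (@big_cat_nat _ _ _ L)//=.
rewrite (eq_big_nat _ _ (F2 := fun=> 1%N)); last by move=> i /andP[_ ->].
have -> : (\sum_(L <= i < (Zp_trunc N.+2).+2) (i < L) = 0)%N.
  by rewrite big_nat big1// => i /andP[Li _]; rewrite ltnNge Li.
by rewrite sum_nat_const_nat subn0 muln1 addn0.
Qed.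

(** The factor 8 h^2 bounds the annihilator of a nonzero low frequency. The quantity 256 h^5 is the
    saving required of each Kloosterman sum: there are at most 16 h^2 low frequencies, so (16 h^2)^2
    pairs, each allowed n / (256 h^5), for a total of n / h. *)
Definition gain_const (h : nat) : nat := (8 * h ^ 2 * (256 * h ^ 5) ^ 4)%N.

Definition hyperbola_card (L L' : nat) (s s' c : 'Z_N.+2) : nat :=
  \sum_(x : 'Z_N.+2 | x \is a GRing.unit) (arc L s x && arc L' s' (c * x^-1)%R).

Lemma hyperbola_card_approx (L L' h : nat) (s s' c : 'Z_N.+2) :
  c \is a GRing.unit -> (0 < h)%N -> (2 * h ^ 2 <= n)%N ->
  (L <= n)%N -> (L' <= n)%N ->
  (gain_const h * triple0 'Z_N.+2 <= n ^ 2)%N ->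
  `|(hyperbola_card L L' s s' c)%:R -
     n%:R ^- 2 * L%:R * L'%:R * (phiz 'Z_N.+2)%:R| <= 3 * (n%:R / h%:R) :> algC.
Proof.
move=> cu h0 hn Ln Ln' small.
have [w pw] := C_prim_root_exists (isT : (0 < n)%N).
pose e := @echar N w.
have eD := echarD pw : forall x y, e (x + y) = e x * e y.
have norm_e : forall x, `|e x| = 1 := norm_echar pw.
have cardA : #|'Z_N.+2| = n by rewrite card_ord.
have sum_e (m : 'Z_N.+2) : \sum_x e (m * x) = #|'Z_N.+2|%:R *+ (m == 0).
  by rewrite cardA; exact: sum_echar.
have faithful x : e x = 1 -> x = 0 by move=> /eqP; rewrite (echar_eq1 pw) => /eqP.
(* The largest [H] with 2 H h^2 <= n. Since n <= 4 h^2 H, the bound 4 n / H for the number of low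
   frequencies is at most 16 h^2, and the bound 2 n / H for annihilators at most 8 h^2. *)
pose H := (n %/ (2 * h ^ 2))%N.
have H0 : (0 < H)%N by rewrite divn_gt0// muln_gt0 expn_gt0 h0.
have nH : (n <= 4 * h ^ 2 * H)%N.
  have := divn_eq n (2 * h ^ 2); have := @ltn_pmod n (2 * h ^ 2).
  rewrite muln_gt0 expn_gt0 h0/= -/H => /(_ isT); nia.
have Hn : (2 * H * h ^ 2 <= n)%N.
  by have := leq_trunc_div n (2 * h ^ 2); rewrite -/H; nia.
pose f L s (x : 'Z_N.+2) : algC := (arc L s x)%:R.
have f1 L0 s0 x : `|f L0 s0 x| <= 1 by rewrite normr_nat (ler_nat _ _ 1) leq_b1.
have fH L0 s0 (i : 'I_H) :
    \sum_x `|f L0 s0 (x + i%:R) - f L0 s0 x| ^+ 2 <= (2 * H)%:R.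
  apply: (@le_trans _ _ ((\sum_(x : 'Z_N.+2) (arc L0 s0 (x + i%:R)%R != arc L0 s0 x))%N%:R : algC)).
    rewrite natr_sum; apply: ler_sum => x _; rewrite /f.
    by case: (arc _ _ _); case: (arc _ _ _) => /=;
      rewrite ?subrr ?subr0 ?sub0r ?normrN ?normr0 ?normr1 ?expr0n ?expr1n.
  rewrite ler_nat; apply: leq_trans (arc_shift _ _ _) _.
  by rewrite leq_mul2l/= ltnW.
have inj (i j : 'I_H) : i%:R = j%:R :> 'Z_N.+2 -> i = j.
  have Hln : (H <= n)%N by nia.
  move=> /(congr1 val)/=; rewrite !val_Zp_nat//.
  by rewrite !modn_small ?(leq_trans (ltn_ord _) Hln)// => /val_inj.
have nlow := card_low eD norm_e sum_e H0 inj.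
rewrite cardA in nlow.
have nlow' : (\sum_(m : 'Z_N.+2 | low e H m) 1 <= 16 * h ^ 2)%N.
  by rewrite -(leq_pmul2r H0); apply: leq_trans nlow _; nia.
pose K : algC := n%:R / (256 * h ^ 5)%:R.
have c0 : (0 < 256 * h ^ 5)%N by rewrite muln_gt0 expn_gt0 h0.
have K0 : 0 <= K by rewrite divr_ge0.
have ann m : m != 0 -> low e H m -> (annz m <= 8 * h ^ 2)%N.
  move=> m0 lm.
  have pr : (n %/ gcdn m n).-primitive_root (e m) := exp_prim_root pw m.
  have r1 : (1 < n %/ gcdn m n)%N.
    rewrite ltn_neqAle divn_gt0 ?gcdn_gt0 ?orbT// dvdn_leq ?dvdn_gcdr// andbT.
    apply: contra m0 => /eqP r1; apply/eqP/faithful.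
    by have := prim_expr_order pr; rewrite -r1 expr1.
  have := annz_low eD norm_e pr r1 lm.
  rewrite cardA => am; rewrite -(leq_pmul2r H0); apply: leq_trans am _; nia.
have main m k : (annz m <= 8 * h ^ 2)%N -> `|kloos e m k| <= K.
  move=> am; rewrite -(@ler_pXn2r _ 4)// ?nnegrE//.
  apply: le_trans (kloos_bound eD norm_e sum_e m k) _.
  rewrite cardA expr_div_n ler_pdivlMr ?exprn_gt0 ?ltr0n//.
  rewrite -!natrX -!natrM ler_nat.
  apply: (@leq_trans (n ^ 2 * (gain_const h * triple0 'Z_N.+2))).
    rewrite /gain_const; move: ((256 * h ^ 5) ^ 4)%N (triple0 _) => a b.
    have -> : (n ^ 2 * (8 * h ^ 2 * a * b) = 8 * h ^ 2 * n ^ 2 * b * a)%N by lia.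
    by rewrite !leq_mul.
  by rewrite -[4%N]/(2 + 2)%N expnD leq_mul2l small orbT.
have kl m k : low e H m -> low e H k -> (m != 0) || (k != 0) ->
    `|kloos e m (k * c)| <= K.
  move=> lm lk; have [m0 /=|m0 _] := eqVneq m 0; last by apply/main/ann.
  (* When m = 0 the roles of the two frequencies are exchanged; the unit [c] does not change the
     annihilator of [k]. *)
  move=> k0; rewrite kloosC; apply: main; apply: leq_trans (ann _ k0 lk).
  rewrite /annz [leqRHS](reindex_inj (mulrI cu))/=.
  by apply: leq_sum => t _; rewrite mulrA.
have := hyperbola_equidistribution eD norm_e sum_e H0 cu h0 _ (f1 L s) (f1 L' s')
  (fH L s) (fH L' s') K0 kl.
rewrite cardA => /(_ Hn).
have -> : \sum_(x : 'Z_N.+2 | x \is a GRing.unit) f L s x * f L' s' (c * x^-1) =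
   (hyperbola_card L L' s s' c)%:R.
  rewrite /hyperbola_card natr_sum; apply: eq_bigr => x _.
  by rewrite /f -natrM mulnb.
have sf L0 s0 : (L0 <= n)%N -> \sum_x f L0 s0 x = L0%:R.
  by move=> /(card_arc s0) E; rewrite -[in RHS]E natr_sum.
rewrite !sf// => /le_trans; apply.
rewrite [leRHS](_ : _ = 2 * (n%:R / h%:R) + n%:R / h%:R); last by ring.
rewrite lerD2l /K; apply: (@le_trans _ _ ((16 * h ^ 2)%:R ^+ 2 * (n%:R / (256 * h ^ 5)%:R))).
  by rewrite ler_wpM2r// lerXn2r ?nnegrE// ler_nat.
rewrite le_eqVlt; apply/orP; left; apply/eqP.
have hne : h%:R != 0 :> algC by rewrite pnatr_eq0 -lt0n.
rewrite (natrM _ 16 (h ^ 2)) (natrM _ 256 (h ^ 5)) !natrX.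
have -> : 256%:R = (16%:R ^+ 2 : algC) by rewrite -natrX.
by field; rewrite hne.
Qed.

End HyperbolaCount.

(** The estimate is obtained in [algC], where the characters live, and is needed over the reals.
    Clearing denominators gives an inequality between integers that does not depend on the field. *)
Lemma approx_natE (F : numFieldType) (T n P h : nat) : (0 < n)%N -> (0 < h)%N ->
  (`|T%:R - n%:R ^- 2 * P%:R| <= 3 * (n%:R / h%:R) :> F) =
  (`|(T * n ^ 2)%:Z - P%:Z| * h <= 3 * n ^ 3)%N.
Proof.
move=> n0 h0.
have n0' : 0 < n%:R :> F by rewrite ltr0n.
have h0' : 0 < h%:R :> F by rewrite ltr0n.
have -> : T%:R - n%:R ^- 2 * P%:R = n%:R ^- 2 * ((T * n ^ 2)%:Z - P%:Z)%:~R :> F.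
  rewrite rmorphB/= -!pmulrn mulrBr natrM natrX mulrCA mulVf ?mulr1//.
  by rewrite expf_neq0// gt_eqF.
rewrite normrM normfV normrX normr_nat -intr_norm.
rewrite ler_pdivrMl ?exprn_gt0// mulrA [X in _ <= X](_ : _ = (3 * n ^ 3)%:R / h%:R).
  rewrite ler_pdivlMr// -abszE -pmulrn -natrM ler_nat//.
by rewrite natrM natrX; ring.
Qed.

Lemma phiz_totient (N : nat) : phiz 'Z_N.+2 = totient N.+2.
Proof.
rewrite /phiz totient_count_coprime big_mkord big_mkcond/=.
apply: eq_bigr => x _.
by rewrite -[X in X \is a GRing.unit]natr_Zp unitZpE//; case: (coprime _ _).
Qed.

Lemma large_divisor_sumE (R : numFieldType) (D n : nat) : (0 < n)%N ->
  (large_divisor_sum D n)%:R =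
  n%:R * \sum_(1 <= d < n.+1 | (D < d)%N && (d %| n)%N) d%:R^-1 :> R.
Proof.
move=> n0; rewrite /large_divisor_sum natr_sum mulr_sumr.
rewrite -[LHS]big_filter -[RHS]big_filter.
rewrite (perm_big [seq d <- index_iota 1 n.+1 | (D < d)%N && (d %| n)%N])/=; last first.
  apply: uniq_perm; rewrite ?filter_uniq ?divisors_uniq ?iota_uniq// => d.
  rewrite !mem_filter mem_index_iota -dvdn_divisors//.
  case: (D < d)%N => //=; case: (boolP (d %| n)%N) => //= dn.
  by rewrite (dvdn_gt0 n0 dn) ltnS dvdn_leq.
rewrite !big_filter [LHS]big_nat_cond [RHS]big_nat_cond.
apply: eq_bigr => d /andP[/andP[d0 _] /andP[_ dn]].
apply: (mulIf (_ : d%:R != 0)); first by rewrite pnatr_eq0 -lt0n.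
by rewrite -natrM divnK// -mulrA mulVf ?mulr1// pnatr_eq0 -lt0n.
Qed.

Lemma sum_inv_sqr_tail (R : realFieldType) (D Q : nat) : (0 < D)%N ->
  \sum_(D.+1 <= d < Q.+1) (d%:R ^- 2 : R) <= D%:R^-1.
Proof.
move=> D0; have [QD|DQ] := leqP Q D.
  by rewrite big_geq ?invr_ge0// ltnS.
apply: (@le_trans _ _ (\sum_(D.+1 <= d < Q.+1) (- d%:R^-1 + d.-1%:R^-1))).
  rewrite big_nat [leRHS]big_nat; apply: ler_sum => d /andP[Dd _].
  have d1 : 0 < d.-1%:R :> R by rewrite ltr0n; lia.
  have dE : d%:R = d.-1%:R + 1 :> R by rewrite natr1 prednK//; lia.
  rewrite dE -subr_ge0.
  have -> : - (d.-1%:R + 1)^-1 + d.-1%:R^-1 - (d.-1%:R + 1) ^- 2 =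
    (d.-1%:R * (d.-1%:R + 1) ^+ 2)^-1 :> R.
    by field; rewrite !gt_eqF// addr_gt0.
  by rewrite invr_ge0 mulr_ge0 ?exprn_ge0 ?addr_ge0// ltW.
rewrite (eq_bigr (fun d => (- d.+1.-1%:R^-1) - (- d.-1%:R^-1))); last first.
  by move=> d _; rewrite opprK.
rewrite (telescope_sumr (fun d => - d.-1%:R^-1))//=; last by lia.
by rewrite opprK gerDr oppr_le0 invr_ge0.
Qed.

Lemma sum_dvdn (d Q : nat) : (0 < d)%N -> (\sum_(1 <= n < Q.+1) (d %| n) = Q %/ d)%N.
Proof.
move=> d0; elim: Q => [|Q IH]; first by rewrite big_geq// div0n.
by rewrite big_nat_recr//= IH divnS// addnC.
Qed.

(** Markov's inequality: exchanging the sums over n and over its divisors, the sum over n <= Q of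
    the sums of 1 / d with d > D is at most Q times the sum of 1 / d^2, hence at most Q / D. *)
Lemma card_large_divisor_sum (D G Q : nat) : (0 < D)%N ->
  ((\sum_(1 <= n < Q.+1) (n < G * large_divisor_sum D n)) * D <= G * Q)%N.
Proof.
move=> D0; have D0' : 0 < D%:R :> rat by rewrite ltr0n.
rewrite -(ler_nat rat) !natrM -ler_pdivlMr// natr_sum.
apply: (@le_trans _ _ (G%:R * \sum_(1 <= n < Q.+1)
    \sum_(1 <= d < n.+1 | (D < d)%N && (d %| n)%N) d%:R^-1)).
  rewrite mulr_sumr big_nat [leRHS]big_nat; apply: ler_sum => n /andP[n0 _].
  have n0' : 0 < n%:R :> rat by rewrite ltr0n.
  case: ltnP => [|_]; last by rewrite mulr_ge0// sumr_ge0// => d _; rewrite invr_ge0.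
  rewrite -(ltr_nat rat) natrM large_divisor_sumE// mulrCA.
  by rewrite -[X in X < _]mulr1 ltr_pM2l// => /ltW.
rewrite -mulrA ler_wpM2l//.
apply: (@le_trans _ _ (\sum_(1 <= n < Q.+1) \sum_(D.+1 <= d < Q.+1)
   ((d %| n)%:R * d%:R^-1))).
  rewrite big_nat [leRHS]big_nat; apply: ler_sum => n /andP[n0 nQ].
  rewrite (big_nat_widen _ _ Q.+1)// [leRHS](big_nat_widenl _ 1%N)//.
  rewrite [leLHS]big_mkcond [leRHS]big_mkcond /=; apply: ler_sum => d _.
  case: (D < d)%N; case: (d %| n)%N; case: (d < n.+1)%N;
    by rewrite /= ?mul1r ?mul0r ?invr_ge0.
rewrite exchange_big/=.
apply: (@le_trans _ _ (\sum_(D.+1 <= d < Q.+1) (Q%:R * d%:R ^- 2))).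
  rewrite big_nat [leRHS]big_nat; apply: ler_sum => d /andP[Dd dQ].
  rewrite -mulr_suml -natr_sum (sum_dvdn _ (leq_trans (ltn0Sn D) Dd)) expr2 invfM mulrA.
  rewrite ler_wpM2r ?invr_ge0// ler_pdivlMr ?ltr0n//; last by lia.
  by rewrite -natrM ler_nat leq_trunc_div.
by rewrite -mulr_sumr ler_wpM2l// sum_inv_sqr_tail.
Qed.

(** * Denominators of Farey neighbours *)

(* For 0 < n <= Q, the representative of -r modulo n in the window ]Q - n, Q]. *)
Definition top_repr (Q n r : nat) : nat := (Q - (Q + r) %% n)%N.

Lemma top_repr_window Q n r : (0 < n)%N -> (n <= Q)%N ->
  (Q < top_repr Q n r + n)%N && (top_repr Q n r <= Q)%N.
Proof.
by move=> n0 nQ; have := ltn_pmod (Q + r) n0; rewrite /top_repr; lia.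
Qed.

Lemma dvdn_top_repr Q n r : (0 < n)%N -> (n <= Q)%N -> (n %| top_repr Q n r + r)%N.
Proof.
move=> n0 nQ; have := ltn_pmod (Q + r) n0; have := divn_eq (Q + r) n.
rewrite /top_repr => E lt; apply/dvdnP; exists ((Q + r) %/ n)%N; lia.
Qed.

Definition minv (n a : nat) : nat := (egcdn a n).1.

Lemma minvP n a : (0 < a)%N -> coprime a n -> a * minv n a = 1 %[mod n].
Proof.
move=> a0 /eqP an; rewrite /minv; case: egcdnP => //= km kn E _.
by rewrite mulnC E an modnMDl.
Qed.

(* With [s = true] (resp. [false]), the denominator of the predecessor (resp.
   the successor) of a/n in the Farey sequence of order Q. *)
Definition neighbour_den (s : bool) (Q n a : nat) : nat :=
  top_repr Q n (if s then n.-1 * minv n a else minv n a).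

Lemma neighbour_den_window s Q n a : (0 < n)%N -> (n <= Q)%N ->
  (Q < neighbour_den s Q n a + n)%N && (neighbour_den s Q n a <= Q)%N.
Proof. exact: top_repr_window. Qed.

Lemma prev_denP Q n a : (0 < n)%N -> (n <= Q)%N -> (0 < a)%N -> coprime a n ->
  a * neighbour_den true Q n a = 1 %[mod n].
Proof.
move=> n0 nQ a0 an; rewrite -(minvP a0 an) -modnMmr -[in RHS]modnMmr.
congr ((a * _) %% n)%N; apply/eqP.
rewrite /neighbour_den -(eqn_modDr (n.-1 * minv n a)) -mulSn prednK//.
by rewrite modnMr; exact: dvdn_top_repr.
Qed.

Lemma next_denP Q n a : (0 < n)%N -> (n <= Q)%N -> (0 < a)%N -> coprime a n ->
  (n %| a * neighbour_den false Q n a + 1)%N.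
Proof.
move=> n0 nQ a0 an; rewrite /dvdn -modnDmr -(minvP a0 an) modnDmr -mulnDr.
by apply: dvdn_mull; exact: dvdn_top_repr.
Qed.

Definition neighbour_count (s : bool) (Q l n lo hi : nat) : nat :=
  \sum_(1 <= a < n.+1)
    [&& coprime a n, (l %| a)%N & (lo < neighbour_den s Q n a <= hi)%N].

Lemma sum_multiples (V : Type) (idx : V) (op : Monoid.law idx) (F : nat -> V) (l n : nat) :
  (0 < l)%N ->
  \big[op/idx]_(1 <= a < n.+1 | (l %| a)%N) F a =
  \big[op/idx]_(1 <= b < (n %/ l).+1) F (l * b)%N.
Proof.
move=> l0; elim: n => [|n IH]; first by rewrite div0n !big_geq.
rewrite big_mkcond big_nat_recr//= -big_mkcond/= IH divnS//.
case: (boolP (l %| n.+1)%N) => [ln|_]; last by rewrite Monoid.mulm1.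
rewrite add1n [in RHS]big_nat_recr//=; congr (op _ (F _)).
by have := divnK ln; rewrite divnS// ln add1n mulnC => ->.
Qed.

(** Reduction modulo n is injective on the window ]Q - n, Q], so an interval inside the window
    becomes an arc of the same length. *)
Lemma arc_window (N Q lo hi p : nat) : (Q <= lo + N.+2)%N -> (lo <= hi)%N ->
  (hi <= Q)%N -> (Q < p + N.+2)%N -> (p <= Q)%N ->
  @arc N (hi - lo) lo.+1%:R p%:R = (lo < p <= hi)%N.
Proof.
move=> Qlo lh hQ Qp pQ; rewrite /arc; have [lop|plo] := ltnP lo p.
  rewrite -natrB// val_Zp_nat// modn_small; lia.
have -> : p%:R - lo.+1%:R = (p + N.+2 - lo.+1)%:R :> 'Z_N.+2.
  by rewrite natrB ?natrD ?pchar_Zp ?addr0//; lia.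
by rewrite val_Zp_nat// modn_small; lia.
Qed.

(** For a = l b the variable is b, in the arc of length n / l starting at 1. The neighbour is b^-1
    times l^-1 or its opposite modulo n, which makes sense because l is invertible there. *)
Lemma neighbour_countE (s : bool) (N Q l lo hi : nat) (n := N.+2) :
  (n <= Q)%N -> coprime n l -> (0 < l)%N -> (Q <= lo + n)%N ->
  (lo <= hi)%N -> (hi <= Q)%N ->
  neighbour_count s Q l n lo hi =
  @hyperbola_card N (n %/ l) (hi - lo) 1 lo.+1%:R (if s then l%:R^-1 else - l%:R^-1).
Proof.
move=> nQ nl l0 Qlo lh hQ.
have lu : l%:R \is a @GRing.unit 'Z_n by rewrite unitZpE.
rewrite /neighbour_count.
transitivity (\sum_(1 <= a < n.+1 | (l %| a)%N)
   (coprime a n && (lo < neighbour_den s Q n a <= hi)%N))%N.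
  rewrite [RHS]big_mkcond; apply: eq_bigr => a _.
  by case: (coprime a n); case: (l %| a)%N.
rewrite sum_multiples// /hyperbola_card.
rewrite [RHS]big_mkcond (reindex_inj (@addIr _ 1))/=.
pose G (x : 'Z_n) : nat := if x \is a GRing.unit then
  nat_of_bool (arc (hi - lo) lo.+1%:R ((if s then l%:R^-1 else - l%:R^-1) * x^-1)%R)
  else 0%N.
transitivity (\sum_(x : 'Z_n) (if (x < n %/ l)%N then G (x + 1)%R else 0%N))%N; last first.
  apply: eq_bigr => x _; rewrite /G /arc addrK; case: ifP => //; case: ifP => //.
transitivity (\sum_(i < n) (if (i < n %/ l)%N then G (i%:R + 1)%R else 0%N))%N; last first.
  by apply: eq_bigr => x _; rewrite natr_Zp.
rewrite -(big_mkord predT (fun i => if (i < n %/ l)%N then G (i%:R + 1)%R else 0%N)).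
transitivity (\sum_(0 <= i < n %/ l) G (i%:R + 1)%R)%N; last first.
  by rewrite (big_nat_widen _ _ n) ?leq_div// big_mkcond.
rewrite big_add1/= big_nat [RHS]big_nat; apply: eq_bigr => b /andP[_ bL].
rewrite natr1 /G unitZpE// coprime_sym coprimeMr nl/= {G}.
case: ifP => //= nb.
have bu : b.+1%:R \is a @GRing.unit 'Z_n by rewrite unitZpE.
set a := (l * b.+1)%N.
have a0 : (0 < a)%N by rewrite muln_gt0 l0.
have an : coprime a n by rewrite coprime_sym coprimeMr nl.
have au : a%:R \is a @GRing.unit 'Z_n by rewrite unitZpE// coprime_sym.
have /andP[w1 w2] := neighbour_den_window s a (isT : (0 < n)%N) nQ.
rewrite -(arc_window Qlo lh hQ w1 w2); congr (nat_of_bool (arc _ _ _)).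
apply: (mulrI au).
have -> : a%:R * (neighbour_den s Q n a)%:R = (if s then 1 else -1) :> 'Z_n.
  rewrite -natrM; case: s {w1 w2}.
    by rewrite -Zp_nat_mod// prev_denP// Zp_nat_mod.
  apply/eqP; rewrite -addr_eq0 natr1 -[(a * _).+1%N]addn1 -Zp_nat_mod//.
  by have /eqP -> := next_denP (isT : (0 < n)%N) nQ a0 an.
have E : a%:R * (l%:R^-1 * b.+1%:R^-1) = 1 :> 'Z_n.
  by rewrite natrM mulrACA !mulrV// mulr1.
by case: s {w1 w2}; rewrite ?mulNr ?mulrN E.
Qed.

(** * Averaging over the moduli *)

Section AverageOverModuli.
Variable R : realType.

Definition neighbour_main (l n lo hi : nat) : R :=
  (totient n)%:R / n%:R * (hi - lo)%:R / l%:R.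

Lemma totient_le n : (totient n <= n)%N.
Proof.
rewrite totient_count_coprime -[leqRHS]subn0 -[leqRHS]muln1 -sum_nat_const_nat.
by apply: leq_sum => i _; exact: leq_b1.
Qed.

Lemma sum_bool_le (b : nat -> bool) n : (\sum_(1 <= i < n.+1) b i <= n)%N.
Proof.
rewrite -[leqRHS]muln1 -[X in (X * _)%N](subn1 n.+1) -sum_nat_const_nat.
by apply: leq_sum => i _; exact: leq_b1.
Qed.

(** Both quantities lie between 0 and n. This is all that is used for the exceptional moduli. *)
Lemma neighbour_error_trivial s Q l n lo hi : (0 < l)%N -> (0 < n)%N ->
  (Q <= lo + n)%N -> (hi <= Q)%N ->
  `|(neighbour_count s Q l n lo hi)%:R - neighbour_main l n lo hi| <= n%:R.
Proof.
move=> l0 n0 Qlo hQ.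
have c1 : (neighbour_count s Q l n lo hi)%:R <= n%:R :> R.
  by rewrite ler_nat; exact: sum_bool_le.
have [n0' l0'] : 0 < n%:R :> R /\ 1 <= l%:R :> R by rewrite ltr0n ler1n.
have m0 : 0 <= neighbour_main l n lo hi by rewrite !mulr_ge0 ?invr_ge0.
have m1 : neighbour_main l n lo hi <= n%:R.
  rewrite /neighbour_main ler_pdivrMr ?(lt_le_trans ltr01)//.
  rewrite [leRHS]mulrC.
  apply: (@le_trans _ _ (1 * n%:R)); last by rewrite ler_wpM2r//; lra.
  rewrite ler_pM ?divr_ge0//; last by rewrite ler_nat; lia.
  by rewrite ler_pdivrMr// mul1r ler_nat totient_le.
by rewrite ler_norml; apply/andP; split; have := ler0n R (neighbour_count s Q l n lo hi); lra.
Qed.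

(** The last two hypotheses bound [gain_const h * triple0] by n^2 through [triple0_le]. The extra 1
    pays for replacing the floor of n / l by n / l. *)
Lemma neighbour_error_good s Q l n lo hi h D : (0 < l)%N -> (0 < h)%N ->
  (n <= Q)%N -> coprime n l -> (Q <= lo + n)%N -> (lo <= hi)%N -> (hi <= Q)%N ->
  (D ^ 3 + 2 * h ^ 2 + 1 < n)%N -> (3 * gain_const h * large_divisor_sum D n <= n)%N ->
  `|(neighbour_count s Q l n lo hi)%:R - neighbour_main l n lo hi| <= 3 * Q%:R / h%:R + 1.
Proof.
move=> l0 h0; case: n => [|[|N]]; [lia|lia|] => nQ nl Qlo lh hQ big small.
set n := N.+2 in nQ nl Qlo big small *.
rewrite neighbour_countE//.
set c := (if s then _ else _).
have lu : l%:R \is a @GRing.unit 'Z_n by rewrite unitZpE.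
have cu : c \is a GRing.unit by rewrite /c; case: s {c} => //; rewrite ?unitrN unitrV.
have Ln : (n %/ l <= n)%N by exact: leq_div.
have hn : (hi - lo <= n)%N by lia.
have t0 : (gain_const h * triple0 'Z_N.+2 <= n ^ 2)%N.
  have : (D ^ 3 < n)%N by lia.
  move=> /triple0_le T; apply: leq_trans (leq_mul (leqnn (gain_const h)) T) _.
  have perm a b d : (a * (3 * b * d) = b * (3 * a * d))%N by ring.
  rewrite perm.
  by rewrite leq_mul2l small orbT.
have hn2 : (2 * h ^ 2 <= n)%N by lia.
have := hyperbola_card_approx 1 (lo.+1%:R) cu h0 hn2 Ln hn t0.
rewrite -mulrA -[X in `|_ - X|]mulrA -!natrM mulnA approx_natE// -(approx_natE R)//.
set T := hyperbola_card _ _ _ _ _; rewrite phiz_totient -/n => A.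
have [n0 l0'] : 0 < n%:R :> R /\ 0 < l%:R :> R by rewrite !ltr0n.
have B : `|n%:R ^- 2 * ((n %/ l) * (hi - lo) * totient n)%:R - neighbour_main l n lo hi| <= 1.
  have -> : n%:R ^- 2 * ((n %/ l) * (hi - lo) * totient n)%:R - neighbour_main l n lo hi =
    ((hi - lo)%:R / n%:R) * ((totient n)%:R / n%:R) * ((n %/ l)%:R - n%:R / l%:R).
    by rewrite /neighbour_main !natrM; field; rewrite !gt_eqF.
  have f1 (a : nat) : (a <= n)%N -> 0 <= (a%:R / n%:R : R) <= 1.
    by move=> an; rewrite divr_ge0//= ler_pdivrMr// mul1r ler_nat.
  have /andP[a0 a1] := f1 _ hn; have /andP[b0 b1] := f1 _ (totient_le n).
  rewrite normrM (ger0_norm (mulr_ge0 a0 b0)) -[leRHS]mulr1 -[X in _ <= X * _]mulr1.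
  rewrite ler_pM ?mulr_ge0// ?ler_pM//.
  have E : n%:R = (n %/ l)%:R * l%:R + (n %% l)%:R :> R by rewrite {1}(divn_eq n l) natrD natrM.
  have -> : (n %/ l)%:R - n%:R / l%:R = - ((n %% l)%:R / l%:R) :> R.
    by rewrite E; field; rewrite gt_eqF.
  rewrite normrN ger0_norm ?divr_ge0// ler_pdivrMr// mul1r ler_nat ltnW//.
  by rewrite ltn_mod.
rewrite -(subrKA (n%:R ^- 2 * ((n %/ l) * (hi - lo) * totient n)%:R)).
apply: le_trans (ler_normD _ _) _; rewrite lerD//.
by apply: le_trans A _; rewrite natrM -mulrA ler_wpM2l// ler_wpM2r ?invr_ge0// ler_nat.
Qed.

(** Good moduli contribute at most 3 Q / h + 1 each. Bad ones contribute at most Q each, and there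
    are at most M + Q / h of them. The threshold does not depend on the intervals, which may
    therefore vary with Q and n. *)
Lemma neighbour_count_average (s : bool) (l : nat) (e : R) : (0 < l)%N -> 0 < e ->
  exists Q0 : nat, forall (Q : nat) (lo hi : nat -> nat), (Q0 <= Q)%N ->
  (forall n, (0 < n <= Q)%N -> [/\ (Q <= lo n + n)%N, (lo n <= hi n)%N & (hi n <= Q)%N]) ->
  \sum_(1 <= n < Q.+1 | coprime n l)
     `|(neighbour_count s Q l n (lo n) (hi n))%:R - neighbour_main l n (lo n) (hi n)|
  <= e * Q%:R ^+ 2.
Proof.
move=> l0 e0.
pose h := (Num.truncn (8 / e)).+1.
have h0 : (0 < h)%N by [].
have he : 8 / e < h%:R by rewrite truncnS_gt.
have [G G0 GE] : exists2 G : nat, (0 < G)%N & G = (3 * gain_const h)%N.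
  by exists (3 * gain_const h)%N; rewrite // /gain_const !(muln_gt0, expn_gt0).
(* Chosen so that the Markov count G Q / D of moduli with too many large divisors is Q / h. *)
pose D := (G * h)%N.
have D0 : (0 < D)%N by rewrite muln_gt0 G0.
pose M := (D ^ 3 + 2 * h ^ 2 + 1)%N.
(* The terms in 1 / h use up half of e Q^2; the other half absorbs (M + 1) Q, from the moduli up to
   M and the additive 1 of each good modulus. *)
exists (Num.truncn (2 * (M.+1)%:R / e)).+1 => Q lo hi QQ0 lohi.
have QM : 2 * (M.+1)%:R < e * Q%:R.
  have := truncnS_gt (2 * M.+1%:R / e); rewrite ltr_pdivrMr// => /lt_le_trans; apply.
  by rewrite mulrC ler_wpM2l ?ler_nat// ltW.
pose bad n := (n <= M)%N || (n < G * large_divisor_sum D n)%N.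
have cbad : (\sum_(1 <= n < Q.+1) bad n)%N%:R <= M%:R + Q%:R / h%:R :> R.
  apply: (@le_trans _ _ ((\sum_(1 <= n < Q.+1)
      ((n <= M) + (n < G * large_divisor_sum D n)))%N%:R : R)).
    rewrite ler_nat; apply: leq_sum => n _; rewrite /bad.
    by case: (n <= M)%N; case: (n < _)%N.
  rewrite big_split/= natrD lerD//.
    rewrite ler_nat; have [QM'|MQ] := leqP Q M.
      exact: leq_trans (sum_bool_le _ _) QM'.
    rewrite (@big_cat_nat _ _ _ M.+1)//=; last by rewrite ltnS ltnW.
    rewrite [X in (_ + X)%N]big_nat [X in (_ + X)%N]big1 => [|i /andP[Mi _]].
      by rewrite addn0; exact: sum_bool_le.
    by rewrite leqNgt Mi.
  have := card_large_divisor_sum G Q D0.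
  rewrite -(ler_nat R) !natrM -ler_pdivlMr; last by rewrite -natrM ltr0n.
  move=> /le_trans; apply.
  rewrite le_eqVlt; apply/orP; left; apply/eqP.
  by field; rewrite !pnatr_eq0 -!lt0n G0.
apply: (@le_trans _ _ (\sum_(1 <= n < Q.+1) ((3 * Q%:R / h%:R + 1) + (bad n)%:R * Q%:R))).
  rewrite big_mkcond/= big_nat [leRHS]big_nat; apply: ler_sum => n /andP[n0 nQ].
  have nn : 0 <= 3 * Q%:R / h%:R + 1 :> R by rewrite addr_ge0// divr_ge0// mulr_ge0.
  case: ifP => nl; last by rewrite addr_ge0// mulr_ge0.
  have [|a1 a2 a3] := lohi n; first by rewrite n0 -ltnS.
  case: (boolP (bad n)) => [_|].
    rewrite mul1r; apply: (@le_trans _ _ n%:R); first exact: neighbour_error_trivial.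
    by rewrite -[leLHS]add0r lerD// ler_nat.
  rewrite negb_or -ltnNge -leqNgt mul0r addr0 => /andP[b1 b2].
  by apply: (@neighbour_error_good _ _ _ _ _ _ h D); rewrite // -GE.
rewrite big_split/= -mulr_suml -natr_sum sumr_const_nat subn1/=.
have Q0 : 0 <= Q%:R :> R by [].
have h0' : 0 < h%:R :> R by rewrite ltr0n.
have K1 : Q%:R / h%:R <= e * Q%:R / 8 :> R.
  rewrite ler_pdivrMr//.
  have : 8 <= h%:R * e by rewrite -ler_pdivrMr// ltW.
  by nra.
rewrite -[X in X + _]mulr_natl; apply: (@le_trans _ _
  (Q%:R * (3 * (e * Q%:R / 8) + 1) + (M%:R + e * Q%:R / 8) * Q%:R)).
  apply: lerD.
    by rewrite ler_wpM2l// lerD// -mulrA ler_wpM2l.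
  by rewrite ler_wpM2r//; apply: le_trans cbad _; rewrite lerD.
move: QM; rewrite -natr1; nra.
Qed.

End AverageOverModuli.

Local Open Scope classical_set_scope.
Local Open Scope ring_scope.

(** * Mean value of the totient *)

Section MeanValue.
Variable R : realType.

(** Coprimality to l, through an explicit list of primes so that one prime can be added at a
    time. *)
Definition sieve (ps : seq nat) (n : nat) : bool := all (fun p => ~~ (p %| n)%N) ps.

Lemma sieve_primes l n : (0 < l)%N -> (0 < n)%N -> sieve (primes l) n = coprime n l.
Proof.
move=> l0 n0; rewrite coprime_sym coprime_has_primes// -all_predC /sieve.
rewrite [RHS](_ : _ = all (fun p => ~~ (p \in primes n)) (primes l)); last first.
  apply/allP/allP => H p pp; apply/negP => pq.
    by have := H _ pq; rewrite /= pp.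
  by have := H _ pq; rewrite /= pp.
apply: eq_in_all => p; rewrite mem_primes => /and3P[pp _ _].
by rewrite mem_primes pp n0.
Qed.

Lemma sieveM ps d b : all prime ps -> sieve ps (d * b) = sieve ps d && sieve ps b.
Proof.
move=> /allP pps; rewrite -all_predI; apply: eq_in_all => p /pps pp /=.
by rewrite Euclid_dvdM// negb_or.
Qed.

Lemma sieve1 ps : all prime ps -> sieve ps 1.
Proof.
move=> /allP pps; apply/allP => p /pps pp; rewrite dvdn1.
by apply: contraTneq pp => ->.
Qed.

Lemma cvg_floor_ratio (p : nat) : (0 < p)%N ->
  (N %/ p)%:R / N%:R @[N --> \oo] --> (p%:R^-1 : R).
Proof.
move=> p0; have p0' : 0 < p%:R :> R by rewrite ltr0n.
apply/cvgrPdist_le => e e0.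
near=> N.
have N0 : 0 < N%:R :> R by rewrite ltr0n; near: N; exact: nbhs_infty_gt.
have Ne : e^-1 <= N%:R by near: N; exact: nbhs_infty_ger.
rewrite -(ler_pM2r N0) -[X in _ * X](ger0_norm (ltW N0)) -normrM mulrBl divfK ?gt_eqF//.
rewrite [X in X - _](_ : _ = (N %/ p)%:R + (N %% p)%:R / p%:R); last first.
  by rewrite {1}(divn_eq N p) natrD natrM; field; rewrite gt_eqF.
rewrite addrAC subrr add0r ger0_norm ?divr_ge0//.
apply: (@le_trans _ _ 1).
  by rewrite ler_pdivrMr// mul1r ler_nat ltnW// ltn_mod.
by rewrite -ler_pdivrMl// mulr1.
Unshelve. all: by end_near.
Qed.

Lemma cvg_divn (u : nat -> R) (L : R) (p : nat) : (0 < p)%N ->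
  u n @[n --> \oo] --> L -> u (n %/ p)%N @[n --> \oo] --> L.
Proof.
move=> p0 uL; apply: (cvg_comp (fun n => (n %/ p)%N) u _ uL).
move=> P [M _ MP]; exists (M * p)%N => // n /= Mn; apply: MP.
by rewrite /= leq_divRL.
Qed.

(** Inclusion-exclusion at a single prime: the multiples of p that survive [ps] are the p b with b
    surviving [ps], since p is not in the list. *)
Lemma sieve_cons_sum (g : nat -> R) (c : R) p ps N : prime p -> all prime ps ->
  p \notin ps -> (forall b, g (p * b)%N = c * g b) ->
  \sum_(1 <= n < N.+1 | sieve (p :: ps) n) g n =
  \sum_(1 <= n < N.+1 | sieve ps n) g n -
  c * \sum_(1 <= n < (N %/ p).+1 | sieve ps n) g n.
Proof.
move=> pp pps pn gp; apply/eqP; rewrite eq_sym subr_eq; apply/eqP.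
rewrite (bigID (fun n => p %| n)%N)/= addrC; congr (_ + _).
  by apply: eq_bigl => n; rewrite andbC.
transitivity (\sum_(1 <= a < N.+1 | (p %| a)%N) (if sieve ps a then g a else 0)).
  by rewrite -big_mkcondr/=; apply: eq_bigl => n; rewrite andbC.
rewrite sum_multiples ?prime_gt0// mulr_sumr [RHS]big_mkcond/=.
apply: eq_bigr => b _; rewrite sieveM// gp.
rewrite (_ : sieve ps p)//; apply/allP => q qps.
rewrite dvdn_prime2//; last exact: (allP pps).
by apply: contraNneq pn => <-.
Qed.

Definition sieve_count ps N : R := \sum_(1 <= n < N.+1 | sieve ps n) 1.

Lemma sieve_density ps : all prime ps -> uniq ps ->
  sieve_count ps N / N%:R @[N --> \oo] --> \prod_(p <- ps) (1 - p%:R^-1 : R).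
Proof.
elim: ps => [_ _|p ps IH /andP[pp pps] /andP[pn ups]].
  rewrite big_nil; apply: cvg_near_cst; near=> N.
  rewrite /sieve_count big_mkcond/= sumr_const_nat subn1/= divff// gt_eqF// ltr0n.
  by near: N; exact: nbhs_infty_gt.
rewrite big_cons mulrBl mul1r.
have -> : (fun N => sieve_count (p :: ps) N / N%:R) =
   (fun N => sieve_count ps N / N%:R - (N %/ p)%:R / N%:R *
      (sieve_count ps (N %/ p) / (N %/ p)%:R)).
  apply/funext => N; rewrite /sieve_count.
  rewrite (@sieve_cons_sum (fun=> 1) 1 p ps N)//; last by move=> b; rewrite mul1r.
  rewrite mul1r mulrBl; congr (_ - _).
  have [->|N0] := eqVneq (N %/ p)%N 0%N; first by rewrite big_geq// !mul0r.
  have N1 : N != 0%N by apply: contraNneq N0 => ->; rewrite div0n.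
  by field; rewrite !pnatr_eq0 N0 N1.
apply: cvgB; first exact: IH.
apply: cvgM; first exact/cvg_floor_ratio/prime_gt0.
exact: (cvg_divn (prime_gt0 pp) (IH pps ups)).
Unshelve. all: by end_near.
Qed.

Definition sieve_zeta2 ps N : R := \sum_(1 <= n < N.+1 | sieve ps n) n%:R ^- 2.

Lemma cvg_zeta2 : sieve_zeta2 [::] N @[N --> \oo] --> zeta R 2.
Proof.
have -> : sieve_zeta2 [::] = series (fun n : nat => (n.+1%:R ^+ 2)^-1 : R).
  by apply/funext => N; rewrite /sieve_zeta2 /series/= big_add1.
rewrite /zeta; apply: nondecreasing_is_cvgn.
  by apply: nondecreasing_series => n _ _; rewrite invr_ge0 exprn_ge0.
exists 2 => _ [N _ <-]; rewrite /series/=.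
have -> : \sum_(0 <= k < N) (k.+1%:R ^+ 2)^-1 = \sum_(1 <= k < N.+1) (k%:R ^- 2 : R).
  by rewrite big_add1.
case: N => [|N]; first by rewrite big_geq.
rewrite big_ltn// expr1n invr1 (_ : 2 = 1 + 1)// lerD2l.
by apply: le_trans (@sum_inv_sqr_tail R 1 N.+1 isT) _; rewrite invr1.
Qed.

Lemma zeta2_gt0 : 0 < zeta R 2.
Proof.
apply: (@lt_le_trans _ _ 1) => //.
have -> : zeta R 2 = limn (sieve_zeta2 [::]) by apply/esym/cvg_lim => //; exact: cvg_zeta2.
apply: limr_ge; first by apply/cvg_ex; exists (zeta R 2); exact: cvg_zeta2.
near=> N; have N0 : (0 < N)%N by near: N; exact: nbhs_infty_gt.
rewrite /sieve_zeta2 big_mkcond big_ltn//= expr1n invr1 lerDl.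
by apply: sumr_ge0 => i _; rewrite invr_ge0 exprn_ge0.
Unshelve. all: by end_near.
Qed.

Lemma cvg_sieve_zeta2 ps : all prime ps -> uniq ps ->
  sieve_zeta2 ps N @[N --> \oo] --> zeta R 2 * \prod_(p <- ps) (1 - p%:R ^- 2).
Proof.
elim: ps => [_ _|p ps IH /andP[pp pps] /andP[pn ups]].
  by rewrite big_nil mulr1; exact: cvg_zeta2.
rewrite big_cons mulrCA mulrBl mul1r.
have -> : sieve_zeta2 (p :: ps) = (fun N => sieve_zeta2 ps N -
    p%:R ^- 2 * sieve_zeta2 ps (N %/ p)%N).
  apply/funext => N; rewrite /sieve_zeta2.
  rewrite (@sieve_cons_sum (fun n => n%:R ^- 2) (p%:R ^- 2) p ps N)// => b.
  by rewrite natrM exprMn invfM.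
apply: cvgB; first exact: IH.
apply: cvgM; first exact: cvg_cst.
exact: (cvg_divn (prime_gt0 pp) (IH pps ups)).
Qed.

Definition totient_sum ps N : R :=
  \sum_(1 <= n < N.+1 | sieve ps n) (totient n)%:R / n%:R.

(** Grouping the pairs (b, d) by n = d b, each has weight phi(d) / n, and the sum of phi over the
    divisors of n is n. *)
Lemma totient_convolution ps N : all prime ps ->
  \sum_(1 <= b < N.+1 | sieve ps b) b%:R^-1 * totient_sum ps (N %/ b) =
  sieve_count ps N.
Proof.
move=> pps; rewrite /sieve_count.
pose w d : R := (totient d)%:R / d%:R.
transitivity (\sum_(1 <= b < N.+1) \sum_(1 <= d < N.+1)
   (if [&& sieve ps d, sieve ps b & (d * b <= N)%N] then w d * b%:R^-1 else 0)).
  rewrite big_mkcond; apply: eq_big_nat => b /andP[b0 bN].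
  case: ifP => sb; last by rewrite big1// => d _; rewrite andbF.
  rewrite /totient_sum mulr_sumr (big_nat_widen _ _ N.+1) ?ltnS ?leq_div//.
  rewrite big_mkcond/=; apply: eq_bigr => d _; rewrite ltnS leq_divRL//.
  by case: ifP => // _; rewrite mulrC.
rewrite exchange_big/=.
transitivity (\sum_(1 <= d < N.+1) \sum_(1 <= n < N.+1 | (d %| n)%N)
   (if sieve ps n then (totient d)%:R / n%:R else 0 : R)).
  apply: eq_big_nat => d /andP[d0 dN].
  rewrite sum_multiples// [RHS](big_nat_widen _ _ N.+1) ?ltnS ?leq_div//.
  rewrite [RHS]big_mkcond/=; apply: eq_bigr => b _.
  rewrite ltnS leq_divRL// [(b * d)%N]mulnC sieveM//; case: (_ <= _)%N; rewrite ?andbT ?andbF//.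
  by case: ifP => // _; rewrite natrM invfM mulrA.
rewrite (exchange_big_dep_nat predT)//= [RHS]big_mkcond.
apply: eq_big_nat => n /andP[n0 nN]; case: ifP => sn; last first.
  by rewrite big1.
rewrite -mulr_suml -natr_sum.
have -> : (\sum_(1 <= d < N.+1 | d %| n) totient d = n)%N.
  rewrite -[RHS]sum_totient_dvd -(big_mkord (fun d => d %| n)%N totient).
  rewrite [RHS]big_ltn_cond// dvd0n (gtn_eqF n0).
  rewrite [RHS](big_nat_widen _ _ N.+1)//.
  apply: eq_bigl => d; case: (boolP (d %| n)%N) => //= dn.
  by rewrite ltnS dvdn_leq.
by rewrite divff// pnatr_eq0 -lt0n.
Qed.

End MeanValue.

Section TotientMean.
Variable R : realType.
Variable ps : seq nat.
Hypotheses (pps : all prime ps) (ups : uniq ps).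

Let D : R := \prod_(p <- ps) (1 - p%:R^-1).
Let Z : R := zeta R 2 * \prod_(p <- ps) (1 - p%:R ^- 2).
(** The only possible mean value: if [totient_sum] is asymptotic to C N, the convolution identity
    divided by N tends to D = C Z. *)
Let C : R := D / Z.
Let delta N : R := totient_sum R ps N / N%:R - C.
Let B : R := 1 + `|C|.

Let Z_gt0 : 0 < Z.
Proof.
rewrite mulr_gt0 ?zeta2_gt0// big_seq prodr_gt0// => p /(allP pps) /prime_gt1 p1.
have p1' : 1 < p%:R :> R by rewrite ltr1n.
by rewrite subr_gt0 invf_lt1 ?exprn_gt0 ?(lt_trans ltr01)// exprn_egt1.
Qed.

Let totient_sumE N : totient_sum R ps N = N%:R * (C + delta N).
Proof.
have [->|N0] := eqVneq N 0%N; first by rewrite /totient_sum big_geq// mul0r.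
by rewrite /delta addrC subrK mulrC divfK// pnatr_eq0.
Qed.

Let delta_bound N : `|delta N| <= B.
Proof.
apply: le_trans (ler_normB _ _) _; rewrite lerD//.
have W0 : 0 <= totient_sum R ps N by apply: sumr_ge0 => n _; rewrite divr_ge0.
rewrite ger0_norm ?divr_ge0//.
have [->|N0] := eqVneq N 0%N; first by rewrite invr0 mulr0.
rewrite ler_pdivrMr ?ltr0n ?lt0n// mul1r.
rewrite /totient_sum big_mkcond/=.
apply: (@le_trans _ _ (\sum_(1 <= n < N.+1) 1)); last first.
  by rewrite sumr_const_nat subn1.
rewrite big_nat [leRHS]big_nat; apply: ler_sum => n /andP[n0 _].
case: ifP => // _; rewrite ler_pdivrMr ?ltr0n// mul1r ler_nat; exact: totient_le.
Qed.

Let floor_le (N b : nat) : (0 < b)%N -> (0 < N)%N ->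
  b%:R^-1 * (N %/ b)%:R / N%:R <= b%:R ^- 2 :> R.
Proof.
move=> b0 N0; have [b0' N0'] : 0 < b%:R :> R /\ 0 < N%:R :> R by rewrite !ltr0n.
rewrite ler_pdivrMr// expr2 invfM -mulrA ler_pM2l ?invr_gt0// mulrC ler_pdivlMr//.
by rewrite -natrM ler_nat leq_trunc_div.
Qed.

(** The defect of the convolution identity when [totient_sum] is replaced by its expected value C
    N. *)
Let remainder N : R := sieve_count R ps N / N%:R -
  C * \sum_(1 <= b < N.+1 | sieve ps b) b%:R^-1 * (N %/ b)%:R / N%:R.

Let cvg_remainder : remainder N @[N --> \oo] --> 0.
Proof.
have E0 : D - C * Z = 0 by rewrite /C divfK ?subrr// gt_eqF.
rewrite -E0; apply: cvgB; first exact: sieve_density.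
apply: cvgM; first exact: cvg_cst.
have S := @cvg_sieve_zeta2 R ps pps ups.
rewrite -/Z in S.
have -> : (fun N => \sum_(1 <= b < N.+1 | sieve ps b) b%:R^-1 * (N %/ b)%:R / N%:R : R) =
  (fun N => sieve_zeta2 R ps N - (sieve_zeta2 R ps N -
     \sum_(1 <= b < N.+1 | sieve ps b) b%:R^-1 * (N %/ b)%:R / N%:R)).
  by apply/funext => N; rewrite opprB addrCA subrr addr0.
rewrite -[Z]subr0; apply: cvgB => //.
apply/cvgr0Pnorm_le => e e0.
near=> N.
have N0 : (0 < N)%N by near: N; exact: nbhs_infty_gt.
have N0' : 0 < N%:R :> R by rewrite ltr0n.
have NE : e^-1 * 4 * e^-1 <= N%:R by near: N; exact: nbhs_infty_ger.
rewrite /sieve_zeta2 -sumrB ger0_norm; last first.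
  rewrite big_seq_cond; apply: sumr_ge0 => b; rewrite mem_index_iota => /andP[/andP[b0 _] _].
  by rewrite subr_ge0 floor_le.
(* Each floor costs at most 1 / (b N). The inequality 1 / b <= e / 2 + 1 / (2 e b^2) between
   arithmetic and geometric means avoids estimating the harmonic sum. *)
apply: (@le_trans _ _ (\sum_(1 <= b < N.+1) ((e / 2) + (2 * e)^-1 * b%:R ^- 2) / N%:R)).
  rewrite big_mkcond big_nat [leRHS]big_nat; apply: ler_sum => b /andP[b0 bN].
  have b0' : 0 < b%:R :> R by rewrite ltr0n.
  have rhs0 : b%:R^-1 / N%:R <= (e / 2 + (2 * e)^-1 * b%:R ^- 2) / N%:R.
    rewrite ler_pM2r ?invr_gt0// -subr_ge0 -exprVn.
    have -> : e / 2 + (2 * e)^-1 * b%:R^-1 ^+ 2 - b%:R^-1 = (2 * e)^-1 * (e - b%:R^-1) ^+ 2.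
      by field; rewrite !gt_eqF.
    by rewrite mulr_ge0 ?sqr_ge0// invr_ge0 mulr_ge0 ?ltW.
  case: ifP => _; last by apply: le_trans rhs0; rewrite mulr_ge0 ?invr_ge0.
  apply: le_trans rhs0; rewrite {1}expr2 invfM.
  have -> : b%:R^-1 * b%:R^-1 - b%:R^-1 * (N %/ b)%:R / N%:R =
     b%:R^-1 * (N%:R / b%:R - (N %/ b)%:R) / N%:R :> R.
    by field; rewrite !gt_eqF.
  rewrite ler_pM2r ?invr_gt0// ler_piMr ?invr_ge0//.
  rewrite {1}(divn_eq N b) natrD natrM mulrDl mulfK ?gt_eqF// addrAC subrr add0r.
  by rewrite ler_pdivrMr// mul1r ler_nat ltnW// ltn_mod.
rewrite -mulr_suml big_split/= sumr_const_nat subn1/= -mulr_sumr.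
have S2 : \sum_(1 <= b < N.+1) b%:R ^- 2 <= 2 :> R.
  rewrite big_ltn// expr1n invr1 (_ : 2 = 1 + 1)// lerD2l.
  by apply: le_trans (@sum_inv_sqr_tail R 1 N isT) _; rewrite invr1.
rewrite ler_pdivrMr//.
apply: (@le_trans _ _ (e / 2 * N%:R + (2 * e)^-1 * 2)).
  by rewrite mulr_natr lerD2l ler_wpM2l// invr_ge0 mulr_ge0// ltW.
have ie : e * e^-1 = 1 by rewrite divff// gt_eqF.
have ie0 : 0 < e^-1 by rewrite invr_gt0.
have : e^-1 * 4 <= e * N%:R.
  by rewrite -(ler_pM2r ie0) (mulrC e) mulfK ?gt_eqF.
by rewrite invfM; lra.
Unshelve. all: by end_near.
Qed.

(** The term b = 1 of the convolution is isolated; the others evaluate [delta] at N / b, at most N /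
    2. *)
Let delta_rec N : (0 < N)%N -> delta N = remainder N -
  \sum_(2 <= b < N.+1 | sieve ps b) b%:R^-1 * (N %/ b)%:R / N%:R * delta (N %/ b).
Proof.
move=> N0; have N0' : N%:R != 0 :> R by rewrite pnatr_eq0 -lt0n.
rewrite /remainder -(@totient_convolution R ps N pps).
have -> : (\sum_(1 <= b < N.+1 | sieve ps b) b%:R^-1 * totient_sum R ps (N %/ b)) / N%:R =
  C * (\sum_(1 <= b < N.+1 | sieve ps b) b%:R^-1 * (N %/ b)%:R / N%:R) +
  \sum_(1 <= b < N.+1 | sieve ps b) b%:R^-1 * (N %/ b)%:R / N%:R * delta (N %/ b).
  rewrite mulr_suml mulr_sumr -big_split/=; apply: eq_bigr => b _.
  by rewrite totient_sumE; ring.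
have aux (x y z : R) : x + y - x - z = y - z by ring.
rewrite aux [X in X - _]big_ltn_cond ?ltnS// sieve1// divn1 invr1 mul1r divff//.
by rewrite mul1r addrK.
Qed.

(** The remainder is eventually at most L / 16. For b up to N / (M0 + 1) the bound L applies, with
    total weight at most 1/4 + 1/2 = 3/4. For larger b the crude bound [B] is used, and the tail of
    the sum of 1 / b^2 makes it cost at most L / 16. Altogether 7/8. *)
Let contraction (L : R) (M0 : nat) : 0 < L ->
  (forall N, (M0 <= N)%N -> `|delta N| <= L) ->
  exists M1 : nat, forall N, (M1 <= N)%N -> `|delta N| <= 7 / 8 * L.
Proof.
move=> L0 HL.
have L16 : 0 < L / 16 by rewrite divr_gt0.
have [M2 _ HM2] := (cvgr0Pnorm_le _).1 cvg_remainder _ L16.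
pose K := (Num.truncn (16 * B / L)).+1.
exists (maxn (maxn M2 1) (K * M0.+1)) => N; rewrite !geq_max => /andP[/andP[N2 N1] NK].
have N0' : 0 < N%:R :> R by rewrite ltr0n.
have B0 : 0 <= B by rewrite addr_ge0.
rewrite delta_rec//; apply: le_trans (ler_normB _ _) _.
have r1 : `|remainder N| <= L / 16 by apply: HM2.
pose Dn := (N %/ M0.+1)%N.
have KD : (K <= Dn)%N by rewrite leq_divRL.
have D0 : (0 < Dn)%N by apply: leq_trans KD.
have BD : B / Dn%:R <= L / 16.
  rewrite ler_pdivrMr ?ltr0n//.
  have : 16 * B / L < Dn%:R.
    by apply: lt_le_trans (truncnS_gt _) _; rewrite ler_nat.
  by rewrite ltr_pdivrMr//; nra.
apply: (@le_trans _ _ (L / 16 + (3 / 4 * L + L / 16))); last by lra.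
rewrite lerD//; apply: le_trans (ler_norm_sum _ _ _) _.
apply: (@le_trans _ _ (\sum_(2 <= b < N.+1) (b%:R ^- 2 * L) +
    \sum_(2 <= b < N.+1 | (Dn < b)%N) (b%:R ^- 2 * B))).
  rewrite [X in _ <= _ + X]big_mkcond -big_split/= [leLHS]big_mkcond/=.
  rewrite big_nat [leRHS]big_nat; apply: ler_sum => b /andP[b2 bN].
  have b0 : (0 < b)%N by apply: leq_trans b2.
  have i0 : 0 <= b%:R ^- 2 :> R by rewrite invr_ge0 exprn_ge0.
  have i1 : 0 <= (if (Dn < b)%N then b%:R ^- 2 * B else 0 : R).
    by case: ifP => // _; rewrite mulr_ge0.
  case: ifP => _; last by rewrite addr_ge0// mulr_ge0// ltW.
  rewrite normrM ger0_norm; last by rewrite !mulr_ge0 ?invr_ge0.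
  apply: (@le_trans _ _ (b%:R ^- 2 * `|delta (N %/ b)|)).
    by rewrite ler_wpM2r// floor_le.
  case: ltnP => [Db|bD].
    rewrite -[leLHS]add0r lerD//; first by rewrite mulr_ge0// ltW.
    by rewrite ler_wpM2l.
  rewrite addr0 ler_wpM2l// HL// leq_divRL//.
  by apply: leq_trans (leq_trunc_div N M0.+1); rewrite mulnC leq_mul.
rewrite lerD//.
  rewrite -mulr_suml ler_wpM2r ?(ltW L0)//.
  have [N2'|N1'] := leqP 2 N; last by rewrite big_geq// divr_ge0.
  rewrite big_ltn//.
  apply: (@le_trans _ _ (2%:R ^- 2 + 2%:R^-1 : R)); last by rewrite -natrX; lra.
  by rewrite lerD2l// sum_inv_sqr_tail.
rewrite -mulr_suml; apply: le_trans BD; rewrite mulrC ler_wpM2l//.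
apply: le_trans (@sum_inv_sqr_tail R Dn N D0).
rewrite [leRHS](big_nat_widenl _ 1%N)// [leLHS](big_nat_widenl _ 1%N)//=.
rewrite [leLHS]big_mkcond [leRHS]big_mkcond/=; apply: ler_sum => b _.
have i0 : 0 <= b%:R ^- 2 :> R by rewrite invr_ge0 exprn_ge0.
by case: (Dn < b)%N => //=; case: (1 < b)%N.
Qed.

Lemma totient_sum_mean_sieve : totient_sum R ps N / N%:R @[N --> \oo] --> C.
Proof.
have B0 : 0 < B by rewrite ltr_pwDl.
have H k : exists M : nat, forall N, (M <= N)%N -> `|delta N| <= (7 / 8) ^+ k * B.
  elim: k => [|k [M HM]]; first by exists 0%N => N _; rewrite expr0 mul1r.
  have [|M1 HM1] := contraction _ HM; first by rewrite mulr_gt0 ?exprn_gt0.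
  by exists M1 => N NM; rewrite exprS -mulrA HM1.
have G : (7 / 8 : R) ^+ k * B @[k --> \oo] --> 0.
  rewrite -[X in _ --> X](mul0r B); apply: cvgM; last exact: cvg_cst.
  apply: cvg_expr; rewrite ger0_norm; lra.
apply/cvgrPdist_le => e e0.
have [k _ Hk] := (cvgr0Pnorm_le _).1 G _ e0.
have [M HM] := H k.
exists M => // N /= MN; rewrite distrC; apply: le_trans (HM N MN) _.
by apply: le_trans (Hk k _); rewrite /= ?ler_norm.
Qed.

End TotientMean.

Section TotientMeanCoprime.
Variable R : realType.

Definition totient_mean_sum l N : R :=
  \sum_(1 <= n < N.+1 | coprime n l) (totient n)%:R / n%:R.

Lemma totient_mean l : (0 < l)%N ->
  totient_mean_sum l N / N%:R @[N --> \oo] --> C_const R l.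
Proof.
move=> l0.
have pps : all prime (primes l).
  by apply/allP => p; rewrite mem_primes => /andP[].
have -> : C_const R l = (\prod_(p <- primes l) (1 - p%:R^-1)) /
  (zeta R 2 * \prod_(p <- primes l) (1 - p%:R ^- 2)).
  rewrite /C_const invfM mulrCA; congr (_ * _).
  rewrite -prodfV -big_split/= big_seq [RHS]big_seq; apply: eq_bigr => p.
  move=> /(allP pps) /prime_gt1 p1.
  have p1' : 1 < p%:R :> R by rewrite ltr1n.
  have p0 : 0 < p%:R :> R by apply: lt_trans p1'.
  (* At each p the factor (1 - 1/p) / (1 - 1/p^2) simplifies to 1 / (1 + 1/p). *)
  have -> : 1 - p%:R ^- 2 = (1 - p%:R^-1) * (1 + p%:R^-1) :> R.
    by rewrite -exprVn; ring.
  rewrite invfM mulrA divff ?mul1r// gt_eqF// subr_gt0 invf_lt1//.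
have -> : totient_mean_sum l = totient_sum R (primes l).
  apply/funext => N; rewrite /totient_mean_sum /totient_sum big_nat_cond [RHS]big_nat_cond.
  by apply: eq_bigl => n; case: (posnP n) => [->//|n0]; rewrite sieve_primes.
exact: (@totient_sum_mean_sieve R _ pps (primes_uniq l)).
Qed.

End TotientMeanCoprime.

(** * Equidistribution of neighbouring denominators *)

Definition pair_count (s : bool) (Q l : nat) (P : nat -> nat -> bool) : nat :=
  \sum_(1 <= n < Q.+1) \sum_(1 <= a < n.+1)
    [&& coprime a n, (l %| a)%N & P (neighbour_den s Q n a) n].

Section PairCountLimits.
Variable R : realType.

Lemma neighbour_count_coprime s Q l n lo hi : (0 < l)%N -> ~~ coprime n l ->
  neighbour_count s Q l n lo hi = 0%N.
Proof.
move=> l0 nl; rewrite /neighbour_count big1// => a _; apply/eqP; rewrite eqb0.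
apply: contra nl => /and3P[an la _].
by rewrite coprime_sym (coprime_dvdl la).
Qed.

(** The region enters only through its section at each n, an interval inside the window. Moduli not
    coprime to l contribute nothing, as l divides the numerator a. *)
Lemma pair_count_approx s l (lo hi : nat -> nat -> nat) (P : nat -> nat -> nat -> bool) :
  (0 < l)%N ->
  (forall Q n, (0 < n <= Q)%N ->
    [/\ (Q <= lo Q n + n)%N, (lo Q n <= hi Q n)%N & (hi Q n <= Q)%N]) ->
  (forall Q n p, (0 < n <= Q)%N -> (Q < p + n)%N -> (p <= Q)%N ->
    P Q p n = (lo Q n < p <= hi Q n)%N) ->
  ((pair_count s Q l (P Q))%:R / Q%:R ^+ 2 -
   (\sum_(1 <= n < Q.+1 | coprime n l) neighbour_main R l n (lo Q n) (hi Q n)) / Q%:R ^+ 2)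
   @[Q --> \oo] --> 0.
Proof.
move=> l0 lohi PE; apply/cvgr0Pnorm_le => e e0.
have [Q0 HQ] := neighbour_count_average s l0 e0.
near=> Q.
have QQ0 : (Q0 <= Q)%N by near: Q; exact: nbhs_infty_ge.
have Qpos : 0 < Q%:R :> R by rewrite ltr0n; near: Q; exact: nbhs_infty_gt.
rewrite -mulrBl normrM [X in _ * X]ger0_norm ?invr_ge0 ?exprn_ge0//.
rewrite ler_pdivrMr ?exprn_gt0//.
apply: le_trans (HQ Q (lo Q) (hi Q) QQ0 (lohi Q)).
have -> : pair_count s Q l (P Q) =
  (\sum_(1 <= n < Q.+1 | coprime n l) neighbour_count s Q l n (lo Q n) (hi Q n))%N.
  rewrite [RHS]big_mkcond /pair_count; apply: eq_big_nat => n /andP[n0 nQ].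
  have nQ' : (0 < n <= Q)%N by rewrite n0 -ltnS.
  transitivity (neighbour_count s Q l n (lo Q n) (hi Q n)).
    apply: eq_big_nat => a _.
    have /andP[w1 w2] := neighbour_den_window s a n0 (proj2 (andP nQ')).
    by rewrite PE.
  by case: ifP => // /negbT nl; rewrite neighbour_count_coprime.
rewrite natr_sum -sumrB; exact: ler_norm_sum.
Unshelve. all: by end_near.
Qed.

Lemma cvg_floor_mul (i m : nat) : (0 < m)%N ->
  ((i * Q) %/ m)%:R / Q%:R @[Q --> \oo] --> (i%:R / m%:R : R).
Proof.
move=> m0; have m0' : 0 < m%:R :> R by rewrite ltr0n.
apply/cvgrPdist_le => e e0.
near=> Q.
have Q0 : 0 < Q%:R :> R by rewrite ltr0n; near: Q; exact: nbhs_infty_gt.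
have Qe : e^-1 <= Q%:R by near: Q; exact: nbhs_infty_ger.
rewrite -(ler_pM2r Q0) -[X in _ * X](ger0_norm (ltW Q0)) -normrM mulrBl divfK ?gt_eqF//.
have -> : i%:R / m%:R * Q%:R - ((i * Q) %/ m)%:R = ((i * Q) %% m)%:R / m%:R :> R.
  rewrite mulrAC -natrM {1}(divn_eq (i * Q) m) natrD natrM; field.
  by rewrite gt_eqF.
rewrite ger0_norm ?divr_ge0//.
apply: (@le_trans _ _ 1).
  by rewrite ler_pdivrMr// mul1r ler_nat ltnW// ltn_mod.
by rewrite -ler_pdivrMl// mulr1.
Unshelve. all: by end_near.
Qed.

Lemma cvg_floor_mul_pinfty (i m : nat) : (0 < m)%N -> (0 < i)%N ->
  ((i * Q) %/ m)%N @[Q --> \oo] --> \oo.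
Proof.
move=> m0 i0 P [M _ MP]; exists (M * m)%N => // Q /= MQ; apply: MP.
by rewrite /= leq_divRL//; apply: leq_trans MQ _; rewrite leq_pmull.
Qed.

Lemma cvg_totient_floor l (i m : nat) : (0 < l)%N -> (0 < m)%N ->
  totient_mean_sum R l ((i * Q) %/ m) / Q%:R @[Q --> \oo] -->
  C_const R l * (i%:R / m%:R).
Proof.
move=> l0 m0; have [->|i0] := posnP i.
  rewrite mul0r mulr0; apply: cvg_near_cst; near=> Q.
  by rewrite mul0n div0n /totient_mean_sum big_geq// mul0r.
have -> : (fun Q => totient_mean_sum R l ((i * Q) %/ m) / Q%:R) =
  (fun Q => (totient_mean_sum R l ((i * Q) %/ m) / ((i * Q) %/ m)%:R) *
            (((i * Q) %/ m)%:R / Q%:R)).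
  apply/funext => Q; have [->|Q0] := eqVneq ((i * Q) %/ m)%N 0%N.
    by rewrite /totient_mean_sum big_geq// !mul0r.
  by rewrite mulrA divfK// pnatr_eq0.
apply: cvgM; last exact: cvg_floor_mul.
exact: (cvg_comp (fun Q => (i * Q) %/ m)%N (fun N => totient_mean_sum R l N / N%:R)
  (cvg_floor_mul_pinfty m0 i0) (@totient_mean R l l0)).
Unshelve. all: by end_near.
Qed.

Definition in_square (m i j Q p n : nat) : bool :=
  [&& (i * Q < p * m)%N, (p * m <= i.+1 * Q)%N, (j * Q < n * m)%N & (n * m <= j.+1 * Q)%N].

(** The condition m <= i + j puts the square in the triangle: for n in its strip, the interval for p
    then lies in ]Q - n, Q]. The main term is the interval length times a difference of two totient
    means, that is 1/m times C / m, divided by l. *)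
Lemma pair_count_square s l m i j : (0 < l)%N -> (0 < m)%N ->
  (i < m)%N -> (j < m)%N -> (m <= i + j)%N ->
  (pair_count s Q l (in_square m i j Q))%:R / Q%:R ^+ 2 @[Q --> \oo] -->
  C_const R l / l%:R / m%:R ^+ 2.
Proof.
move=> l0 m0 im jm mij.
pose rng Q n := (j * Q < n * m)%N && (n * m <= j.+1 * Q)%N.
(* Outside the strip, lo = hi = Q encodes an empty interval that still respects the window. *)
pose lo Q n := if rng Q n then ((i * Q) %/ m)%N else Q.
pose hi Q n := if rng Q n then ((i.+1 * Q) %/ m)%N else Q.
have lohi Q n : (0 < n <= Q)%N ->
    [/\ (Q <= lo Q n + n)%N, (lo Q n <= hi Q n)%N & (hi Q n <= Q)%N].
  move=> /andP[n0 nQ]; rewrite /lo /hi; case: ifP => [/andP[r1 r2]|_].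
    split.
    - rewrite addnC -leq_subLR leq_divRL//; nia.
    - by apply: leq_div2r; nia.
    - by rewrite -[leqRHS](mulKn Q m0); apply: leq_div2r; nia.
  by rewrite leq_addr !leqnn.
have PE Q n p : (0 < n <= Q)%N -> (Q < p + n)%N -> (p <= Q)%N ->
    in_square m i j Q p n = (lo Q n < p <= hi Q n)%N.
  move=> _ _ pQ; rewrite /in_square -/(rng Q n) /lo /hi; case: ifP => [r|r].
    by rewrite ltn_divLR// leq_divRL// andbT.
  by rewrite !andbF ltnNge pQ.
have A := pair_count_approx s l0 lohi PE.
have -> : (fun Q => (pair_count s Q l (in_square m i j Q))%:R / Q%:R ^+ 2 : R) =
  (fun Q => ((pair_count s Q l (in_square m i j Q))%:R / Q%:R ^+ 2 -
    (\sum_(1 <= n < Q.+1 | coprime n l) neighbour_main R l n (lo Q n) (hi Q n)) / Q%:R ^+ 2) +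
    (\sum_(1 <= n < Q.+1 | coprime n l) neighbour_main R l n (lo Q n) (hi Q n)) / Q%:R ^+ 2).
  by apply/funext => Q; rewrite subrK.
rewrite -[X in _ --> X]add0r; apply: cvgD => //.
have -> : (fun Q => (\sum_(1 <= n < Q.+1 | coprime n l)
    neighbour_main R l n (lo Q n) (hi Q n)) / Q%:R ^+ 2) =
  (fun Q => l%:R^-1 * (((i.+1 * Q) %/ m)%:R / Q%:R - ((i * Q) %/ m)%:R / Q%:R) *
    (totient_mean_sum R l ((j.+1 * Q) %/ m) / Q%:R - totient_mean_sum R l ((j * Q) %/ m) / Q%:R)).
  apply/funext => Q; rewrite -!mulrBl.
  have ijQ (k k' : nat) : (k <= k')%N -> ((k * Q) %/ m <= (k' * Q) %/ m)%N.
    by move=> kk; apply: leq_div2r; nia.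
  have kQ (k : nat) : (k <= m)%N -> ((k * Q) %/ m <= Q)%N.
    by move=> km; rewrite -[leqRHS](mulKn Q m0); apply: leq_div2r; nia.
  have -> : totient_mean_sum R l ((j.+1 * Q) %/ m) - totient_mean_sum R l ((j * Q) %/ m) =
    \sum_(1 <= n < Q.+1 | coprime n l && rng Q n) (totient n)%:R / n%:R.
    rewrite /totient_mean_sum (big_nat_widen _ _ Q.+1) ?ltnS ?kQ//.
    rewrite [X in _ - X](big_nat_widen _ _ Q.+1) ?ltnS ?kQ ?(ltnW jm)//.
    rewrite big_mkcond [X in _ - X]big_mkcond [RHS]big_mkcond/= -sumrB.
    apply: eq_bigr => n _; rewrite !ltnS !leq_divRL// /rng.
    case: (coprime n l) => /=; last by rewrite subr0.
    have [a|a] := leqP (n * m) (j * Q).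
      by rewrite (leq_trans a) ?subrr// leq_mul2r leqnSn orbT.
    by rewrite subr0.
  have -> : \sum_(1 <= n < Q.+1 | coprime n l) neighbour_main R l n (lo Q n) (hi Q n) =
    l%:R^-1 * (((i.+1 * Q) %/ m)%:R - ((i * Q) %/ m)%:R) *
    \sum_(1 <= n < Q.+1 | coprime n l && rng Q n) (totient n)%:R / n%:R.
    rewrite big_mkcondr mulr_sumr; apply: eq_bigr => n _.
    rewrite /neighbour_main /lo /hi; case: ifP => _; last first.
      by rewrite subnn mulr0 mul0r mulr0.
    by rewrite natrB ?ijQ//; ring.
  by rewrite expr2 invfM; ring.
have -> : C_const R l / l%:R / m%:R ^+ 2 =
  l%:R^-1 * (i.+1%:R / m%:R - i%:R / m%:R) *
    (C_const R l * (j.+1%:R / m%:R) - C_const R l * (j%:R / m%:R)).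
  by rewrite -!natr1; field; rewrite !pnatr_eq0 -!lt0n l0 m0.
apply: cvgM; last by apply: cvgB; exact: cvg_totient_floor.
apply: cvgM; first exact: cvg_cst.
by apply: cvgB; exact: cvg_floor_mul.
Qed.

Lemma cvg_partial_sums (u : nat -> R) (C : R) : u N / N%:R @[N --> \oo] --> C ->
  (\sum_(0 <= k < N) u k) / N%:R ^+ 2 @[N --> \oo] --> C / 2.
Proof.
move=> uC.
have T N : \sum_(0 <= k < N) k%:R = N%:R * (N%:R - 1) / 2 :> R.
  elim: N => [|N IH]; first by rewrite big_geq// !mul0r.
  by rewrite big_nat_recr//= IH -!natr1; field.
apply/cvgrPdist_le => e e0.
have e4 : 0 < e / 4 by rewrite divr_gt0.
have [K _ HK] := (cvgrPdist_le _ _).1 uC _ e4.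
pose M := \sum_(0 <= k < K.+1) `|u k - C * k%:R|.
have M0 : 0 <= M by apply: sumr_ge0.
near=> N.
have N0 : (0 < N)%N by near: N; exact: nbhs_infty_gt.
have N0' : 1 <= N%:R :> R by rewrite ler1n.
have NK : (K.+1 <= N)%N by near: N; exact: nbhs_infty_ge.
have NM : (M + `|C|) * (4 / e) <= N%:R by near: N; exact: nbhs_infty_ger.
have N2 : 0 < N%:R ^+ 2 :> R by rewrite exprn_gt0// (lt_le_trans ltr01).
have -> : C / 2 - (\sum_(0 <= k < N) u k) / N%:R ^+ 2 =
  (C * N%:R / 2 - \sum_(0 <= k < N) (u k - C * k%:R)) / N%:R ^+ 2.
  rewrite sumrB -mulr_sumr T; field.
  by rewrite gt_eqF// (lt_le_trans ltr01).
rewrite normrM [X in _ * X]ger0_norm; last by rewrite invr_ge0 ltW.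
rewrite ler_pdivrMr//.
apply: le_trans (ler_normB _ _) _.
have S1 : `|\sum_(0 <= k < N) (u k - C * k%:R)| <= M + e / 4 * N%:R ^+ 2.
  apply: le_trans (ler_norm_sum _ _ _) _.
  rewrite (@big_cat_nat _ _ _ K.+1)//= lerD//.
  apply: (@le_trans _ _ (\sum_(K.+1 <= k < N) (e / 4 * N%:R))).
    rewrite big_nat [leRHS]big_nat; apply: ler_sum => k /andP[Kk kN].
    have k0 : 0 < k%:R :> R by rewrite ltr0n (leq_trans _ Kk).
    have := HK k (ltnW Kk); rewrite /= distrC => H.
    have -> : u k - C * k%:R = (u k / k%:R - C) * k%:R by rewrite mulrBl divfK ?gt_eqF.
    rewrite normrM (ger0_norm (ltW k0)) ler_pM//.
    by rewrite ler_nat ltnW.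
  rewrite sumr_const_nat -[leLHS]mulr_natr expr2 mulrA ler_wpM2l//.
    by rewrite mulr_ge0// ltW.
  by rewrite ler_nat leq_subr.
have S2 : `|C * N%:R / 2| <= `|C| * N%:R.
  rewrite !normrM normr_nat [X in _ * X]ger0_norm ?invr_ge0// ler_piMr ?mulr_ge0//; lra.
apply: le_trans (lerD S2 S1) _.
have : (M + `|C|) * 4 <= e * N%:R.
  by move: NM; rewrite mulrA ler_pdivrMr// [N%:R * e]mulrC.
have C0 := normr_ge0 C.
move=> H; rewrite expr2; nra.
Unshelve. all: by end_near.
Qed.

(** The whole triangle, of area 1/2. Its exact density is what later turns lower bounds into upper
    bounds. *)
Lemma pair_count_total s l : (0 < l)%N ->
  (pair_count s Q l (fun _ _ => true))%:R / Q%:R ^+ 2 @[Q --> \oo] -->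
  C_const R l / l%:R / 2.
Proof.
move=> l0.
have lohi Q n : (0 < n <= Q)%N ->
    [/\ (Q <= (Q - n) + n)%N, (Q - n <= Q)%N & (Q <= Q)%N].
  by move=> /andP[n0 nQ]; rewrite subnK// leq_subr leqnn.
have PE Q n p : (0 < n <= Q)%N -> (Q < p + n)%N -> (p <= Q)%N ->
    true = (Q - n < p <= Q)%N.
  by move=> /andP[_ nQ] Qp pQ; lia.
have A := @pair_count_approx s l (fun Q n => Q - n)%N (fun Q _ => Q) (fun _ _ _ => true) l0 lohi PE.
have -> : (fun Q => (pair_count s Q l (fun _ _ => true))%:R / Q%:R ^+ 2 : R) =
  (fun Q => ((pair_count s Q l (fun _ _ => true))%:R / Q%:R ^+ 2 -
    (\sum_(1 <= n < Q.+1 | coprime n l) neighbour_main R l n (Q - n) Q) / Q%:R ^+ 2) +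
    (\sum_(1 <= n < Q.+1 | coprime n l) neighbour_main R l n (Q - n) Q) / Q%:R ^+ 2).
  by apply/funext => Q; rewrite subrK.
rewrite -[X in _ --> X]add0r; apply: cvgD => //.
pose W := totient_mean_sum R l.
(* Summation by parts absorbs the length n of the window; the limit is C - C / 2. *)
have abel Q : \sum_(1 <= n < Q.+1 | coprime n l) (totient n)%:R / n%:R * n%:R =
    Q%:R * W Q - \sum_(0 <= k < Q) W k.
  elim: Q => [|Q IH]; first by rewrite !big_geq// mul0r subrr.
  have WS : W Q.+1 = W Q + (if coprime Q.+1 l then (totient Q.+1)%:R / Q.+1%:R else 0).
    by rewrite /W /totient_mean_sum big_mkcond big_nat_recr//= -big_mkcond.
  rewrite big_mkcond big_nat_recr//= -big_mkcond/= IH big_nat_recr//= WS.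
  by case: ifP => _; rewrite -?natr1; ring.
have -> : (fun Q => (\sum_(1 <= n < Q.+1 | coprime n l) neighbour_main R l n (Q - n) Q) / Q%:R ^+ 2) =
  (fun Q => l%:R^-1 * (W Q / Q%:R - (\sum_(0 <= k < Q) W k) / Q%:R ^+ 2)).
  apply/funext => Q; have [->|Q0] := posnP Q.
    by rewrite !big_geq// !mul0r /W /totient_mean_sum big_geq// mul0r subrr mulr0.
  transitivity ((l%:R : R)^-1 * (\sum_(1 <= n < Q.+1 | coprime n l) (totient n)%:R / n%:R * n%:R) / Q%:R ^+ 2).
    congr (_ / _); rewrite mulr_sumr big_nat_cond [RHS]big_nat_cond.
    apply: eq_bigr => n /andP[/andP[_ nQ] _]; rewrite /neighbour_main subKn//.
    by rewrite mulrC.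
  by rewrite abel; field; rewrite !pnatr_eq0 -!lt0n l0 Q0.
have -> : C_const R l / l%:R / 2 = l%:R^-1 * (C_const R l - C_const R l / 2).
  by field; rewrite pnatr_eq0 -lt0n.
apply: cvgM; first exact: cvg_cst.
apply: cvgB; first exact: totient_mean.
by apply: cvg_partial_sums; exact: totient_mean.
Qed.

End PairCountLimits.

(** * Filling open sets with grid squares *)

Section Portmanteau.
Variable R : realType.
Notation mu2 := (@lebesgue_measure R \x @lebesgue_measure R)%E.

Definition square (m i j : nat) : set (R * R) :=
  `]i%:R / m%:R, i.+1%:R / m%:R] `*` `]j%:R / m%:R, j.+1%:R / m%:R].

Lemma measurable_square m i j : measurable (square m i j).
Proof. by apply: measurableX. Qed.

Lemma mu2_square m i j : (0 < m)%N -> mu2 (square m i j) = (m%:R ^- 2)%:E.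
Proof.
move=> m0; have m0' : 0 < m%:R :> R by rewrite ltr0n.
have L k : lebesgue_measure (`]k%:R / m%:R, k.+1%:R / m%:R] : set R) = (m%:R^-1)%:E.
  rewrite lebesgue_measure_itv/= lte_fin ltr_pM2r ?invr_gt0// ltr_nat ltnSn.
  by rewrite -EFinB -mulrBl -natr1 [_ + 1]addrC addrK mul1r.
rewrite /square product_measure1E; [|exact: measurable_itv..].
transitivity ((m%:R^-1)%:E * (m%:R^-1)%:E : \bar R)%E; first by congr (_ * _)%E; exact: L.
by rewrite -EFinM -invfM expr2.
Qed.

(* The squares of side 1/m inside U are indexed by t = i * m + j. *)
Definition inner_square (U : set (R * R)) (m t : nat) : set (R * R) :=
  if `[< square m (t %/ m) (t %% m) `<=` U >] then square m (t %/ m) (t %% m) else set0.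

Definition inner_squares (U : set (R * R)) (m : nat) : set (R * R) :=
  \bigcup_(t < (m * m)%N) inner_square U m t.

Definition inner_number (U : set (R * R)) (m : nat) : nat :=
  \sum_(t < m * m) `[< square m (t %/ m) (t %% m) `<=` U >].

Lemma measurable_inner_square U m t : measurable (inner_square U m t).
Proof. rewrite /inner_square; case: ifP => _ //; exact: measurable_square. Qed.

Lemma measurable_inner_squares U m : measurable (inner_squares U m).
Proof.
rewrite /inner_squares bigcup_mkord; apply: bigsetU_measurable => t _.
exact: measurable_inner_square.
Qed.

Lemma inner_squares_sub U m : inner_squares U m `<=` U.
Proof.
by move=> z [t _]; rewrite /inner_square; case: asboolP => // tU /tU.
Qed.

Lemma mu2_inner_squares U m : (0 < m)%N ->
  (mu2 (inner_squares U m) <= ((inner_number U m)%:R / m%:R ^+ 2)%:E)%E.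
Proof.
move=> m0; rewrite /inner_squares bigcup_mkord.
apply: le_trans (@le_mu_bigsetU _ _ _ mu2 (inner_square U m) (m * m)%N
  (fun t _ => measurable_inner_square U m t)) _.
rewrite /inner_number natr_sum mulr_suml -sumEFin; apply: lee_sum => t _.
rewrite /inner_square; case: ifP => _; last by rewrite measure0 mul0r.
by rewrite mul1r -(mu2_square (t %/ m) (t %% m) m0) lexx.
Qed.

Lemma grid_index (x : R) (m : nat) : (0 < m)%N -> 0 < x <= 1 ->
  exists2 i : nat, (i < m)%N & (i%:R / m%:R < x <= i.+1%:R / m%:R).
Proof.
move=> m0 /andP[x0 x1]; have m0' : 0 < m%:R :> R by rewrite ltr0n.
have xm0 : 0 < x * m%:R by rewrite mulr_gt0.
have xm1 : x * m%:R <= m%:R by rewrite ler_piMl.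
have /andP[t1 t2] := truncn_itv (ltW xm0).
have [E|NE] := eqVneq ((Num.truncn (x * m%:R))%:R) (x * m%:R).
  move: E t1 t2; case: (Num.truncn (x * m%:R)) => [|i] E _ _.
    by rewrite -E ltxx in xm0.
  exists i; first by rewrite -(ler_nat R) E.
  by rewrite ltr_pdivrMr// ler_pdivlMr// -E ltr_nat ltnSn lexx.
exists (Num.truncn (x * m%:R)).
  by rewrite -(ltr_nat R); apply: lt_le_trans xm1; rewrite lt_neqAle NE.
by rewrite ltr_pdivrMr// ler_pdivlMr// lt_neqAle NE t1 ltW.
Qed.

(** Once 1/m is smaller than the radius of a ball around z inside U, the grid square containing z
    lies in U. So U is the lower limit of its inner squares, which gives both its measurability and
    the approximation of its area. *)
Lemma inner_squares_exhaust (U : set (R * R)) : open U ->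
  (forall z, U z -> 0 < z.1 <= 1 /\ 0 < z.2 <= 1) ->
  U = \bigcup_K \bigcap_(m in [set m | (K < m)%N]) inner_squares U m.
Proof.
move=> oU U01; apply/seteqP; split => [z Uz|z [K _ /(_ K.+1)]]; last first.
  by move=> H; apply: (@inner_squares_sub U K.+1); apply: H => /=.
have /nbhs_ballP[e /= e0 zeU] : nbhs z U by exact: open_nbhs_nbhs.
exists (Num.truncn e^-1).+1 => // m /= Km.
have m0 : (0 < m)%N by apply: leq_trans Km.
have m0' : 0 < m%:R :> R by rewrite ltr0n.
have me : m%:R^-1 < e.
  rewrite invf_plt ?posrE//; apply: lt_le_trans (truncnS_gt _) _.
  by rewrite ler_nat ltnW.
have [/(grid_index m0)[i im /andP[i1 i2]] /(grid_index m0)[j jm /andP[j1 j2]]] := U01 z Uz.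
have zs : square m i j z by split; rewrite /= in_itv/= ?i1 ?i2 ?j1 ?j2.
have sU : square m i j `<=` U.
  move=> y [/=]; rewrite !in_itv/= => /andP[y1 y2] /andP[y3 y4]; apply: zeU.
  have S k : k.+1%:R / m%:R = k%:R / m%:R + m%:R^-1 :> R.
    by rewrite -natr1 mulrDl mul1r.
  rewrite S in i2 j2 y2 y4.
  by split; rewrite /ball/= ltr_norml; apply/andP; split; lra.
exists (i * m + j)%N => /=; first by nia.
rewrite /inner_square divnMDl// divn_small// addn0 modnMDl modn_small//.
by rewrite asboolT.
Qed.

Lemma measurable_open_in_square (U : set (R * R)) : open U ->
  (forall z, U z -> 0 < z.1 <= 1 /\ 0 < z.2 <= 1) -> measurable U.
Proof.
move=> oU U01; rewrite (inner_squares_exhaust oU U01).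
apply: bigcupT_measurable => K; apply: bigcap_measurable; last first.
  by move=> m _; exact: measurable_inner_squares.
by exists K.+1 => /=.
Qed.

(** Continuity of the measure from below, applied to the intersections over all m > K, which
    increase to U with K. *)
Lemma inner_squares_approx (U : set (R * R)) (e : R) : open U ->
  (forall z, U z -> 0 < z.1 <= 1 /\ 0 < z.2 <= 1) -> 0 < e ->
  exists2 m, (0 < m)%N & (mu2 U <= ((inner_number U m)%:R / m%:R ^+ 2 + e)%:E)%E.
Proof.
move=> oU U01 e0.
pose V K := \bigcap_(m in [set m | (K < m)%N]) inner_squares U m.
have mV K : measurable (V K).
  apply: bigcap_measurable; first by exists K.+1 => /=.
  by move=> m _; exact: measurable_inner_squares.
have UV : U = \bigcup_K V K := inner_squares_exhaust oU U01.
have mU := measurable_open_in_square oU U01.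
have cV : (mu2 \o V) K @[K --> \oo] --> mu2 (\bigcup_K V K).
  apply: nondecreasing_cvg_mu => //; first by rewrite -UV.
  move=> K K' KK'; apply/subsetPset => z Vz m /= K'm; apply: Vz.
  exact: leq_ltn_trans KK' K'm.
rewrite -UV in cV.
have U1 : (mu2 U <= 1)%E.
  have -> : (1%:E = mu2 (square 1 0 0) :> \bar R)%E.
    by rewrite mu2_square// expr1n invr1.
  apply: le_measure; rewrite ?inE//; first exact: measurable_square.
  by move=> z /U01[a b]; split; rewrite /= in_itv/= mul0r divr1.
have Ufin : mu2 U \is a fin_num.
  by rewrite ge0_fin_numE// (le_lt_trans U1)// ltry.
have cV' : (mu2 \o V) K @[K --> \oo] --> (fine (mu2 U))%:E by rewrite fineK.
have [K /= HK] : exists K, (mu2 U - e%:E <= mu2 (V K))%E.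
  have [K _ HK] := (cvgrPdist_le _ _).1 (fine_cvg cV') e e0.
  exists K; have := HK K (leqnn K) => /=.
  have Vfin : mu2 (V K) \is a fin_num.
    rewrite ge0_fin_numE// (le_lt_trans _ (le_lt_trans U1 (ltry _)))//.
    apply: le_measure; [rewrite inE; exact: mV|rewrite inE; exact: mU|].
    by move=> z Vz; rewrite UV; exists K.
  move=> H; rewrite -(fineK Ufin) -(fineK Vfin) -EFinB lee_fin.
  by have := le_trans (ler_norm _) H; lra.
exists K.+1 => //.
rewrite EFinD -leeBlDr//; apply: (le_trans HK).
apply: (@le_trans _ _ (mu2 (inner_squares U K.+1))).
  apply: le_measure; [rewrite inE; exact: mV|rewrite inE; exact: measurable_inner_squares|].
  by move=> z; apply => /=.
exact: mu2_inner_squares.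
Qed.

End Portmanteau.

Section PairDensity.
Variable R : realType.
Notation mu2 := (@lebesgue_measure R \x @lebesgue_measure R)%E.

Definition pair_number s (Q l : nat) (S : set (R * R)) : nat :=
  pair_count s Q l (fun p n => `[< S (p%:R / Q%:R, n%:R / Q%:R) >]).

Definition pair_density s (Q l : nat) (S : set (R * R)) : R :=
  (pair_number s Q l S)%:R / Q%:R ^+ 2.

Lemma in_squareE m i j Q p n : (0 < Q)%N -> (0 < m)%N ->
  in_square m i j Q p n = `[< square m i j (p%:R / Q%:R, n%:R / Q%:R : R) >].
Proof.
move=> Q0 m0; have [Q0' m0'] : 0 < Q%:R :> R /\ 0 < m%:R :> R by rewrite !ltr0n.
have A (a b : nat) : (a%:R / m%:R < b%:R / Q%:R :> R) = (a * Q < b * m)%N.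
  by rewrite ltr_pdivrMr// mulrAC ltr_pdivlMr// -!natrM ltr_nat.
have B (a b : nat) : (b%:R / Q%:R <= a%:R / m%:R :> R) = (b * m <= a * Q)%N.
  by rewrite ler_pdivrMr// mulrAC ler_pdivlMr// -!natrM ler_nat.
apply/idP/asboolP => [/and4P[h1 h2 h3 h4]|[]].
  by split; rewrite /= in_itv/= A B ?h1 ?h2 ?h3 ?h4.
by rewrite /= !in_itv/= !A !B => /andP[h1 h2] /andP[h3 h4]; apply/and4P.
Qed.

Lemma in_square_uniq m i j i' j' Q p n : in_square m i j Q p n ->
  in_square m i' j' Q p n -> i = i' /\ j = j'.
Proof.
rewrite /in_square => /and4P[a1 a2 a3 a4] /and4P[b1 b2 b3 b4].
split; apply/eqP; rewrite eqn_leq; apply/andP; split; rewrite leqNgt; apply/negP => H; nia.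
Qed.

Lemma pair_number_squares s Q l (U : set (R * R)) m : (0 < Q)%N -> (0 < m)%N ->
  (\sum_(t < m * m | `[< square m (t %/ m) (t %% m) `<=` U >])
     pair_count s Q l (in_square m (t %/ m) (t %% m) Q) <= pair_number s Q l U)%N.
Proof.
move=> Q0 m0; rewrite /pair_number /pair_count.
rewrite exchange_big/=; apply: leq_sum => n _.
rewrite exchange_big/=; apply: leq_sum => a _.
case: (coprime a n); last by rewrite big1.
case: (l %| a)%N; last by rewrite big1.
rewrite /=; set p := neighbour_den _ _ _ _.
have [[t0 /andP[/asboolP good sq]]|none] := pselect (exists t : 'I_(m * m),
    `[< square m (t %/ m) (t %% m) `<=` U >] && in_square m (t %/ m) (t %% m) Q p n).
  rewrite (bigD1 t0)/=; last exact/asboolP.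
  rewrite sq big1 => [|t /andP[_ tt0]].
    by rewrite addn0 asboolT//; apply/good/asboolP; rewrite -in_squareE.
  apply/eqP; rewrite eqb0; apply: contra tt0 => sq'.
  have [E1 E2] := in_square_uniq sq' sq.
  by apply/eqP/val_inj; rewrite /= (divn_eq t m) E1 E2 -divn_eq.
rewrite big1// => t tg; apply/eqP; rewrite eqb0; apply/negP => sq.
by apply: none; exists t; rewrite tg.
Qed.

Definition in_triangle (U : set (R * R)) :=
  forall z, U z -> [/\ 0 < z.1 <= 1, 0 < z.2 <= 1 & 1 < z.1 + z.2].

(** The centre of the square has coordinate sum (i + j + 1) / m, which must exceed 1. *)
Lemma square_in_triangle m i j (U : set (R * R)) : (0 < m)%N -> in_triangle U ->
  square m i j `<=` U -> (m <= i + j)%N.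
Proof.
move=> m0 tU sU; rewrite leqNgt; apply/negP => ijm.
have m0' : 0 < m%:R :> R by rewrite ltr0n.
have mid k : k%:R / m%:R < ((k%:R + 2^-1) / m%:R : R) <= k.+1%:R / m%:R.
  rewrite ltr_pM2r ?invr_gt0// ler_pM2r ?invr_gt0// ltrDl invr_gt0 ltr0n/=.
  rewrite -[k.+1]addn1 natrD lerD2l; lra.
have /tU[_ _] : U ((i%:R + 2^-1) / m%:R, (j%:R + 2^-1) / m%:R).
  by apply: sU; split; rewrite /= in_itv/= mid.
rewrite /= -mulrDl ltNge ler_pdivrMr// mul1r.
suff -> : i%:R + 2^-1 + (j%:R + 2^-1) = (i + j).+1%:R :> R by rewrite ler_nat ijm.
by rewrite -[(i + j).+1%N]addn1 !natrD; field.
Qed.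

Lemma C_const_ge0 l : 0 <= C_const R l.
Proof.
rewrite /C_const mulr_ge0 ?invr_ge0 ?(ltW (zeta2_gt0 R))//.
by apply: prodr_ge0 => p _; rewrite invr_ge0 addr_ge0.
Qed.

(** Finitely many disjoint squares nearly fill U, and the limit is known for each of them. Only a
    lower bound can be reached in this way. *)
Lemma pair_density_open s l (U : set (R * R)) (e : R) : (0 < l)%N -> open U ->
  in_triangle U -> 0 < e ->
  \forall Q \near \oo,
    C_const R l / l%:R * fine (mu2 U) - e <= pair_density s Q l U.
Proof.
move=> l0 oU tU e0; set k := C_const R l / l%:R.
have k0 : 0 <= k by rewrite divr_ge0// C_const_ge0.
have e1 : 0 < e / (2 * (k + 1)) by rewrite divr_gt0// mulr_gt0// ltr_wpDl.
have U01 z : U z -> 0 < z.1 <= 1 /\ 0 < z.2 <= 1 by move=> /tU[].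
have [m m0 muU] := inner_squares_approx oU U01 e1.
have muU' : fine (mu2 U) <= (inner_number U m)%:R / m%:R ^+ 2 + e / (2 * (k + 1)).
  rewrite -lee_fin fineK// ge0_fin_numE//; exact: le_lt_trans muU (ltry _).
have lim : \sum_(t < m * m | `[< square m (t %/ m) (t %% m) `<=` U >])
     ((pair_count s Q l (in_square m (t %/ m) (t %% m) Q))%:R / Q%:R ^+ 2 : R)
     @[Q --> \oo] --> \sum_(t < m * m | `[< square m (t %/ m) (t %% m) `<=` U >]) (k / m%:R ^+ 2).
  apply: cvg_big => [|t /asboolP tgood]; first exact: add_continuous.
  apply: pair_count_square => //.
  - by rewrite ltn_divLR.
  - by rewrite ltn_mod.
  - exact: square_in_triangle tgood.
have limE : \sum_(t < m * m | `[< square m (t %/ m) (t %% m) `<=` U >]) (k / m%:R ^+ 2) =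
    k * ((inner_number U m)%:R / m%:R ^+ 2).
  rewrite big_mkcond /inner_number natr_sum mulr_suml mulr_sumr; apply: eq_bigr => t _.
  by case: ifP => _; rewrite ?mul1r// mul0r mulr0.
rewrite limE in lim.
have e2 : 0 < e / 2 by rewrite divr_gt0.
have near1 := (cvgrPdist_le _ _).1 lim _ e2.
near=> Q.
have Q0 : (0 < Q)%N by near: Q; exact: nbhs_infty_gt.
apply: (@le_trans _ _ (\sum_(t < m * m | `[< square m (t %/ m) (t %% m) `<=` U >])
     ((pair_count s Q l (in_square m (t %/ m) (t %% m) Q))%:R / Q%:R ^+ 2 : R))); last first.
  rewrite -mulr_suml ler_wpM2r ?invr_ge0 ?exprn_ge0//.
  by rewrite -natr_sum ler_nat pair_number_squares.
have H : `|k * ((inner_number U m)%:R / m%:R ^+ 2) -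
   \sum_(t < m * m | `[< square m (t %/ m) (t %% m) `<=` U >])
     ((pair_count s Q l (in_square m (t %/ m) (t %% m) Q))%:R / Q%:R ^+ 2 : R)| <= e / 2.
  by near: Q; exact: near1.
have {}H := le_trans (ler_norm _) H.
have : k * fine (mu2 U) <= k * ((inner_number U m)%:R / m%:R ^+ 2) + e / 2.
  apply: le_trans (ler_wpM2l k0 muU') _; rewrite mulrDr lerD2l.
  rewrite mulrA ler_pdivrMr ?mulr_gt0 ?ltr_wpDl//.
  by rewrite mulrA divfK//; nra.
by lra.
Unshelve. all: by end_near.
Qed.

Lemma pair_number_le s Q l (S S' : set (R * R)) : S `<=` S' ->
  (pair_number s Q l S <= pair_number s Q l S')%N.
Proof.
move=> SS'; rewrite /pair_number /pair_count.
apply: leq_sum => n _; apply: leq_sum => a _.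
case: (coprime _ _) => //; case: (_ %| _)%N => //=.
by case: asboolP => // /SS' h; rewrite asboolT.
Qed.

Lemma pair_density_le s Q l (S S' : set (R * R)) : S `<=` S' ->
  pair_density s Q l S <= pair_density s Q l S'.
Proof.
by move=> SS'; rewrite ler_wpM2r ?invr_ge0 ?exprn_ge0// ler_nat pair_number_le.
Qed.

Lemma pair_density_disjoint s Q l (S S' : set (R * R)) : S `<=` ~` S' ->
  pair_density s Q l S + pair_density s Q l S' <= pair_density s Q l setT.
Proof.
move=> SS'; rewrite -mulrDl ler_wpM2r ?invr_ge0 ?exprn_ge0// -natrD ler_nat.
rewrite /pair_number /pair_count -big_split/=.
apply: leq_sum => n _; rewrite -big_split/=; apply: leq_sum => a _.
case: (coprime _ _) => //; case: (_ %| _)%N => //=.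
rewrite [X in (_ <= nat_of_bool X)%N]asboolT//.
case: asboolP => [h|_]; last by case: asboolP.
by rewrite asboolF//; exact: SS'.
Qed.

(** The lower bound for U1 bounds the density of S from below; the lower bound for U2, subtracted
    from the total density, bounds it from above. The two agree because the areas add up to that of
    the triangle. *)
Lemma pair_density_cvg s l (S U1 U2 : set (R * R)) : (0 < l)%N ->
  open U1 -> open U2 -> in_triangle U1 -> in_triangle U2 ->
  U1 `<=` S -> U2 `<=` ~` S -> fine (mu2 U1) + fine (mu2 U2) = 2^-1 ->
  pair_density s Q l S @[Q --> \oo] --> C_const R l / l%:R * fine (mu2 U1).
Proof.
move=> l0 o1 o2 t1 t2 s1 s2 half.
apply/cvgrPdist_le => e e0.
have e2 : 0 < e / 2 by rewrite divr_gt0.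
have tot := (cvgrPdist_le _ _).1 (@pair_count_total R s l l0) _ e2.
have n1 := pair_density_open s l0 o1 t1 e2.
have n2 := pair_density_open s l0 o2 t2 e2.
near=> Q.
have H1 : C_const R l / l%:R * fine (mu2 U1) - e / 2 <= pair_density s Q l U1 by near: Q.
have H2 : C_const R l / l%:R * fine (mu2 U2) - e / 2 <= pair_density s Q l U2 by near: Q.
have H3 : `|C_const R l / l%:R / 2 - pair_density s Q l setT| <= e / 2.
  rewrite /pair_density /pair_number (_ : (fun p n => _) = (fun _ _ => true)).
    by near: Q; exact: tot.
  by apply/funext => p; apply/funext => n; rewrite asboolT.
have H4 := pair_density_le s Q l s1.
have H5 := pair_density_disjoint s Q l s2.
have E : C_const R l / l%:R / 2 = C_const R l / l%:R * fine (mu2 U1) +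
  C_const R l / l%:R * fine (mu2 U2) by rewrite -mulrDr half.
have := ler_norm (pair_density s Q l setT - C_const R l / l%:R / 2).
rewrite distrC => H6.
have {}H6 := le_trans H6 H3.
rewrite ler_norml; apply/andP; split; lra.
Unshelve. all: by end_near.
Qed.

End PairDensity.

(** * Gaps between consecutive fractions *)

(* A fraction a/n in lowest terms is represented by the pair (a, n). *)
Definition frac (u : nat * nat) : rat := u.1%:R / u.2%:R.

Definition farey_pair (Q : nat) (u : nat * nat) : bool :=
  [&& (0 < u.1)%N, (u.1 <= u.2)%N, (u.2 <= Q)%N & coprime u.1 u.2].

(** The numerator b comes from a p - b n = 1. At 1/Q the value is (0, 1), the fraction 0, which is
    outside the sequence. *)
Definition farey_pred (Q : nat) (u : nat * nat) : nat * nat :=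
  let p := neighbour_den true Q u.2 u.1 in ((u.1 * p - 1) %/ u.2, p)%N.

Definition farey_succ (Q : nat) (u : nat * nat) : nat * nat :=
  let s := neighbour_den false Q u.2 u.1 in ((u.1 * s + 1) %/ u.2, s)%N.

Lemma window_uniq (Q n p p' : nat) : (n %| p - p')%N -> (p' <= p)%N -> (Q < p' + n)%N -> (p <= Q)%N ->
  p = p'.
Proof.
move=> d p'p w1 w2; have [E|pos] := posnP (p - p'); first by lia.
by have := dvdn_leq pos d; lia.
Qed.

Section FareyNeighbours.
Variables (Q : nat).

Lemma farey_predP u : farey_pair Q u ->
  [/\ (u.1 * (farey_pred Q u).2 = (farey_pred Q u).1 * u.2 + 1)%N,
      (Q < (farey_pred Q u).2 + u.2)%N & ((farey_pred Q u).2 <= Q)%N].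
Proof.
case: u => a n /and4P[/= a0 an nQ c]; have n0 : (0 < n)%N by lia.
have /andP[w1 w2] := neighbour_den_window true a n0 nQ.
split => //; rewrite /farey_pred/=; set p := neighbour_den _ _ _ _ in w1 w2 *.
have ap : (0 < a * p)%N by rewrite muln_gt0 a0/=; lia.
have := prev_denP n0 nQ a0 c; rewrite -/p => /eqP; rewrite eqn_mod_dvd// => d.
by rewrite divnK// subnK.
Qed.

Lemma farey_succP u : farey_pair Q u ->
  [/\ ((farey_succ Q u).1 * u.2 = u.1 * (farey_succ Q u).2 + 1)%N,
      (Q < (farey_succ Q u).2 + u.2)%N & ((farey_succ Q u).2 <= Q)%N].
Proof.
case: u => a n /and4P[/= a0 an nQ c]; have n0 : (0 < n)%N by lia.
have /andP[w1 w2] := neighbour_den_window false a n0 nQ.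
split => //; rewrite /farey_succ/= divnK//.
exact: next_denP.
Qed.

(** The determinant equation fixes the denominator modulo n because a is invertible, and the window
    selects one representative. *)
Lemma farey_pred_eq u v : farey_pair Q u -> (u.1 * v.2 = v.1 * u.2 + 1)%N ->
  (Q < v.2 + u.2)%N -> (v.2 <= Q)%N -> farey_pred Q u = v.
Proof.
move=> uF; have [] := farey_predP uF; case: (farey_pred Q u) => b p.
case: u uF => a n /and4P[/= a0 an nQ c]; case: v => b' p' /= E w1 w2 E' w1' w2'.
have pp' : p = p'.
  have D x y x' y' : (a * x = y * n + 1)%N -> (a * x' = y' * n + 1)%N -> (x' <= x)%N ->
      (n %| x - x')%N.
    move=> Ex Ex' xx'; rewrite -(@Gauss_dvdr n a); last by rewrite coprime_sym.
    by rewrite mulnBr Ex Ex' subnDr -mulnBl dvdn_mull.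
  have [le|lt] := leqP p' p; first exact: (window_uniq (D _ _ _ _ E E' le) le w1' w2).
  by apply/esym; exact: (window_uniq (D _ _ _ _ E' E (ltnW lt)) (ltnW lt) w1 w2').
subst p'; congr pair; have : (b * n == b' * n)%N by apply/eqP; lia.
by rewrite eqn_pmul2r; [move/eqP|lia].
Qed.

Lemma farey_succ_eq u v : farey_pair Q u -> (v.1 * u.2 = u.1 * v.2 + 1)%N ->
  (Q < v.2 + u.2)%N -> (v.2 <= Q)%N -> farey_succ Q u = v.
Proof.
move=> uF; have [] := farey_succP uF; case: (farey_succ Q u) => b p.
case: u uF => a n /and4P[/= a0 an nQ c]; case: v => b' p' /= E w1 w2 E' w1' w2'.
have pp' : p = p'.
  have D x y x' y' : (y * n = a * x + 1)%N -> (y' * n = a * x' + 1)%N -> (x' <= x)%N ->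
      (n %| x - x')%N.
    move=> Ex Ex' xx'; rewrite -(@Gauss_dvdr n a); last by rewrite coprime_sym.
    by rewrite mulnBr -(subnDr 1) -Ex -Ex' -mulnBl dvdn_mull.
  have [le|lt] := leqP p' p; first exact: (window_uniq (D _ _ _ _ E E' le) le w1' w2).
  by apply/esym; exact: (window_uniq (D _ _ _ _ E' E (ltnW lt)) (ltnW lt) w1 w2').
subst p'; congr pair; have : (b * n == b' * n)%N by apply/eqP; lia.
by rewrite eqn_pmul2r; [move/eqP|lia].
Qed.

Lemma coprime_of_bezout a b c d : (a * d = b * c + 1)%N -> coprime b d && coprime a b.
Proof.
move=> E; apply/andP; split; rewrite /coprime -dvdn1.
  have : (gcdn b d %| b * c + 1)%N by rewrite -E dvdn_mull// dvdn_gcdr.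
  by rewrite dvdn_addr// dvdn_mulr// dvdn_gcdl.
have : (gcdn a b %| b * c + 1)%N by rewrite -E dvdn_mulr// dvdn_gcdl.
by rewrite dvdn_addr// dvdn_mulr// dvdn_gcdr.
Qed.

Lemma farey_pred_lt u : farey_pair Q u -> ((farey_pred Q u).1 < (farey_pred Q u).2)%N.
Proof.
move=> uF; have [] := farey_predP uF; case: (farey_pred Q u) => b p.
case: u uF => a n /and4P[/= a0 an nQ c] E w1 w2.
by nia.
Qed.

(** A zero numerator forces a p = 1, hence a = p = 1, and the window then gives n = Q. *)
Lemma farey_pair_pred u : farey_pair Q u -> u != (1, Q)%N ->
  farey_pair Q (farey_pred Q u).
Proof.
move=> uF u1; have := farey_pred_lt uF; have [] := farey_predP uF.
case: (farey_pred Q u) => b p /= E w1 w2 bp.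
have /andP[cbp _] := coprime_of_bezout E.
apply/and4P; split => //=; last exact: ltnW.
rewrite lt0n; apply: contraNneq u1 => b0; move: E; rewrite b0 mul0n add0n => /eqP.
rewrite muln_eq1 => /andP[/eqP E1 /eqP E2].
case/and4P: uF => _ _ nQ _; case: u nQ w1 E1 => a n /= nQ w1 ->.
by rewrite E2 in w1; apply/eqP; congr pair; lia.
Qed.

Lemma farey_pair_succ u : farey_pair Q u -> (u.1 < u.2)%N ->
  farey_pair Q (farey_succ Q u).
Proof.
move=> uF u1; have [] := farey_succP uF; case/and4P: (uF) => a0 an nQ c.
case: (farey_succ Q u) => e s /= E w1 w2.
have E' : (u.2 * e = s * u.1 + 1)%N by rewrite mulnC E mulnC.
have E'' : (e * u.2 = u.1 * s + 1)%N by [].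
have c' : coprime e s.
  rewrite /coprime -dvdn1.
  have : (gcdn e s %| u.1 * s + 1)%N by rewrite -E dvdn_mulr// dvdn_gcdl.
  by rewrite dvdn_addr// dvdn_mull// dvdn_gcdr.
by apply/and4P; split => //=; nia.
Qed.

Lemma farey_predK u : farey_pair Q u -> u != (1, Q)%N ->
  farey_succ Q (farey_pred Q u) = u.
Proof.
move=> uF u1; have [E w1 w2] := farey_predP uF.
apply: farey_succ_eq => //; first exact: farey_pair_pred.
  by rewrite addnC.
by case/and4P: uF.
Qed.

Lemma farey_succK u : farey_pair Q u -> (u.1 < u.2)%N ->
  farey_pred Q (farey_succ Q u) = u.
Proof.
move=> uF u1; have [E w1 w2] := farey_succP uF.
apply: farey_pred_eq => //; first exact: farey_pair_succ.
  by rewrite addnC.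
by case/and4P: uF.
Qed.

Lemma frac_sub_pred u : farey_pair Q u ->
  frac u - frac (farey_pred Q u) = ((farey_pred Q u).2%:R * u.2%:R)^-1.
Proof.
move=> uF; have [E w1 w2] := farey_predP uF; case/and4P: uF => a0 an nQ c.
have n0 : u.2%:R != 0 :> rat by rewrite pnatr_eq0; lia.
have p0 : (farey_pred Q u).2%:R != 0 :> rat by rewrite pnatr_eq0; lia.
apply: (mulfI p0); apply: (mulfI n0); rewrite /frac.
have := congr1 (fun k => k%:R : rat) E; rewrite natrD !natrM => E'.
transitivity (u.1%:R * (farey_pred Q u).2%:R - (farey_pred Q u).1%:R * u.2%:R : rat).
  by field; rewrite n0 p0.
by rewrite E'; field; rewrite n0 p0.
Qed.

Lemma frac_lt (u v : nat * nat) : (0 < u.2)%N -> (0 < v.2)%N ->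
  (frac u < frac v) = (u.1 * v.2 < v.1 * u.2)%N.
Proof.
move=> u0 v0; rewrite /frac ltr_pdivrMr ?ltr0n// mulrAC ltr_pdivlMr ?ltr0n//.
by rewrite -!natrM ltr_nat.
Qed.

Lemma farey_no_between u w : farey_pair Q u -> farey_pair Q w ->
  frac (farey_pred Q u) < frac w -> frac w < frac u -> False.
Proof.
move=> uF /and4P[c0 cd dQ _]; have [E w1 w2] := farey_predP uF.
case/and4P: uF => a0 an nQ c.
rewrite !frac_lt//; [|lia..].
case: (farey_pred Q u) E w1 w2 => b p /=; case: u a0 an nQ c => a n /=.
case: w c0 cd dQ => c d /= c0 cd dQ a0 an nQ _ E w1 w2 h1 h2.
(* Since a p - b n = 1, d = p (a d - c n) + n (c p - b d). Both brackets are positive integers, so d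
   >= p + n > Q. *)
have F : (d + p * (c * n) + n * (b * d) = p * (a * d) + n * (c * p))%N.
  by transitivity (d * (a * p) + n * (c * p))%N; [rewrite E; ring|ring].
have : (p + n <= d)%N by nia.
lia.
Qed.

Lemma frac_inj u v : (0 < u.2)%N -> (0 < v.2)%N -> coprime u.1 u.2 -> coprime v.1 v.2 ->
  frac u = frac v -> u = v.
Proof.
move=> u0 v0 cu cv /eqP; rewrite /frac eqr_div ?pnatr_eq0 -?lt0n//.
rewrite -!natrM eqr_nat => /eqP; case: u u0 cu => a n /= n0 cu; case: v v0 cv => c d /= d0 cv E.
have dn : (d %| n)%N by rewrite -(@Gauss_dvdr d c) 1?coprime_sym// -E dvdn_mull.
have nd : (n %| d)%N by rewrite -(@Gauss_dvdr n a) 1?coprime_sym// E dvdn_mull.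
have Ed : n = d by apply/eqP; rewrite eqn_dvd nd dn.
by subst d; congr pair; apply/eqP; rewrite -(eqn_pmul2r n0) E.
Qed.

End FareyNeighbours.

Definition farey_pairs (Q : nat) : seq (nat * nat) :=
  [seq (a, q) | q <- iota 1 Q, a <- [seq a <- iota 1 q | coprime a q]].

Lemma mem_farey_pairs Q u : (u \in farey_pairs Q) = farey_pair Q u.
Proof.
case: u => a n; apply/allpairsPdep/and4P => [[q [b []]]|[/= a0 an nQ c]].
  rewrite mem_iota mem_filter mem_iota !add1n !ltnS.
  by move=> /andP[q0 qQ] /and3P[cop b0 bq] [-> ->].
exists n, a; split => //; last by rewrite mem_filter c mem_iota a0 add1n ltnS.
by rewrite mem_iota add1n ltnS nQ andbT; lia.
Qed.

Lemma uniq_farey_pairs Q : uniq (farey_pairs Q).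
Proof.
apply: allpairs_uniq_dep => [|q _|]; rewrite ?filter_uniq ?iota_uniq//.
by move=> [q a] [q' a'] /= _ _ [-> ->].
Qed.

Lemma farey_pair_gt0 Q u : farey_pair Q u -> (0 < u.2)%N /\ (u.2 <= Q)%N.
Proof. by move=> /and4P[a0 an nQ _]; split=> //; lia. Qed.

Lemma frac_inj_in Q u v : farey_pair Q u -> farey_pair Q v -> frac u = frac v -> u = v.
Proof.
move=> uF vF; have [u0 _] := farey_pair_gt0 uF; have [v0 _] := farey_pair_gt0 vF.
by case/and4P: uF => _ _ _ cu; case/and4P: vF => _ _ _ cv; exact: frac_inj.
Qed.

Lemma perm_farey Q : perm_eq (farey Q) (map frac (farey_pairs Q)).
Proof.
rewrite (_ : farey Q = undup (map frac (farey_pairs Q))); last first.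
  by rewrite /farey /farey_pairs map_allpairs.
rewrite undup_id//; rewrite map_inj_in_uniq ?uniq_farey_pairs// => u v.
by rewrite !mem_farey_pairs; exact: frac_inj_in.
Qed.

Lemma frac_numq Q u : farey_pair Q u -> `|numq (frac u)|%N = u.1.
Proof.
move=> uF; have [u0 _] := farey_pair_gt0 uF; case/and4P: uF => _ _ _ c.
rewrite /frac (_ : u.1%:R / u.2%:R = (u.1%:Z)%:~R / (u.2%:Z)%:~R)//.
by rewrite coprimeq_num// gtr0_sg ?mul1r// ltz_nat.
Qed.

Lemma frac_denq Q u : farey_pair Q u -> `|denq (frac u)|%N = u.2.
Proof.
move=> uF; have [u0 _] := farey_pair_gt0 uF; case/and4P: uF => _ _ _ c.
rewrite /frac (_ : u.1%:R / u.2%:R = (u.1%:Z)%:~R / (u.2%:Z)%:~R)//.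
by rewrite coprimeq_den//; case: eqVneq => [|_] //; lia.
Qed.

(** * The sequence after deletion *)

Section NotDivisible.
Variables (l Q : nat).
Hypothesis l2 : (1 < l)%N.
Hypothesis Q0 : (0 < Q)%N.

Definition ndvd_pairs : seq (nat * nat) := [seq u <- farey_pairs Q | ~~ (l %| u.1)%N].

Lemma mem_ndvd_pairs u : (u \in ndvd_pairs) = ~~ (l %| u.1)%N && farey_pair Q u.
Proof. by rewrite mem_filter mem_farey_pairs. Qed.

Lemma perm_farey_ndvd : perm_eq (farey_ndvd l Q) (map frac ndvd_pairs).
Proof.
have /permPl E := perm_filter (fun x : rat => ~~ (l %| `|numq x|)%N) (perm_farey Q).
apply: (perm_trans (y := [seq x <- map frac (farey_pairs Q) | ~~ (l %| `|numq x|)%N])).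
  by rewrite /farey_ndvd E.
rewrite filter_map /ndvd_pairs /=.
rewrite (@eq_in_filter _ _ (fun u => ~~ (l %| u.1)%N)) ?perm_refl// => u.
by rewrite mem_farey_pairs => uF /=; rewrite (frac_numq uF).
Qed.

Notation L := (sort <=%O (farey_ndvd l Q)).

Lemma mem_sorted_ndvd x : reflect (exists2 u, u \in ndvd_pairs & x = frac u) (x \in L).
Proof.
rewrite mem_sort (perm_mem perm_farey_ndvd); exact: mapP.
Qed.

Lemma uniq_sorted_ndvd : uniq L.
Proof.
rewrite sort_uniq (perm_uniq perm_farey_ndvd) map_inj_in_uniq; last first.
  move=> u v; rewrite !mem_ndvd_pairs => /andP[_ uF] /andP[_ vF].
  exact: frac_inj_in uF vF.
by rewrite filter_uniq// uniq_farey_pairs.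
Qed.

Lemma nth_sorted_ndvd_le i j : (i <= j)%N -> (j < size L)%N -> L`_i <= L`_j.
Proof.
move=> ij js; apply: (sorted_leq_nth le_trans le_refl) => //; last by rewrite inE (leq_ltn_trans ij).
exact: (sort_le_sorted (farey_ndvd l Q)).
Qed.

Lemma farey_pair_min : farey_pair Q (1, Q)%N.
Proof. by apply/and4P; split => //=; rewrite coprime1n. Qed.

Lemma min_in_ndvd : (1, Q)%N \in ndvd_pairs.
Proof. by rewrite mem_ndvd_pairs farey_pair_min andbT/= dvdn1; lia. Qed.

Lemma frac_min_le u : farey_pair Q u -> frac (1, Q)%N <= frac u.
Proof.
move=> uF; have [u0 uQ] := farey_pair_gt0 uF; rewrite leNgt frac_lt//= mul1n -leqNgt.
by case/and4P: uF => a0 _ _ _; apply: leq_trans uQ _; rewrite leq_pmull.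
Qed.

Lemma head_sorted_ndvd : L`_0 = frac (1, Q)%N.
Proof.
have /mem_sorted_ndvd : exists2 u, u \in ndvd_pairs & frac (1, Q)%N = frac u.
  by exists (1, Q)%N => //; exact: min_in_ndvd.
move=> /(nthP 0)[i iL E]; apply/eqP; rewrite eq_le; apply/andP; split.
  by rewrite -E nth_sorted_ndvd_le.
have L0 : (0 < size L)%N by apply: leq_ltn_trans iL.
have /mem_sorted_ndvd[u uS ->] : L`_0 \in L by exact: mem_nth.
by apply: frac_min_le; move: uS; rewrite mem_ndvd_pairs => /andP[].
Qed.

(** One extra step suffices: a p - b n = 1 makes the numerators of neighbours coprime, so l > 1
    cannot divide both. *)
Definition ndvd_pred (u : nat * nat) : nat * nat :=
  let v := farey_pred Q u in if (l %| v.1)%N then farey_pred Q v else v.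

Lemma frac_pred_lt u : farey_pair Q u -> frac (farey_pred Q u) < frac u.
Proof.
move=> uF; rewrite -subr_gt0 frac_sub_pred// invr_gt0 mulr_gt0// ltr0n.
  by have := farey_pred_lt uF; lia.
by case: (farey_pair_gt0 uF).
Qed.

Lemma ndvd_predP u : farey_pair Q u -> u != (1, Q)%N ->
  [/\ ndvd_pred u \in ndvd_pairs, frac (ndvd_pred u) < frac u &
      forall w, w \in ndvd_pairs -> ~ (frac (ndvd_pred u) < frac w < frac u)].
Proof.
move=> uF u1; rewrite /ndvd_pred; set v := farey_pred Q u.
have vF : farey_pair Q v by exact: farey_pair_pred.
case: ifPn => [lv|lv].
  have v1 : v != (1, Q)%N.
    by apply: contraTneq lv => ->; rewrite /= dvdn1; lia.
  have vvF := farey_pair_pred vF v1.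
  have lvv : ~~ (l %| (farey_pred Q v).1)%N.
    have [E _ _] := farey_predP vF; have /andP[_ c] := coprime_of_bezout E.
    apply: contraL lv => lvv; apply: contraL c => lv'.
    rewrite /coprime; apply/eqP => g1.
    have : (l %| gcdn v.1 (farey_pred Q v).1)%N by rewrite dvdn_gcd lv' lvv.
    by rewrite g1 dvdn1; lia.
  split; first by rewrite mem_ndvd_pairs lvv.
    by apply: lt_trans (frac_pred_lt vF) (frac_pred_lt uF).
  move=> w; rewrite mem_ndvd_pairs => /andP[lw wF] /andP[w1 w2].
  have [wv|vw|wv] := ltgtP (frac w) (frac v).
  - exact: (farey_no_between vF wF w1 wv).
  - exact: (farey_no_between uF wF vw w2).
  - by move: lw; rewrite (frac_inj_in wF vF wv) lv.
split; [by rewrite mem_ndvd_pairs lv|exact: frac_pred_lt|].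
move=> w; rewrite mem_ndvd_pairs => /andP[lw wF] /andP[w1 w2].
exact: (farey_no_between uF wF w1 w2).
Qed.

Lemma nth_pred_ndvd j u : (j.+1 < size L)%N -> L`_j.+1 = frac u -> u \in ndvd_pairs ->
  L`_j = frac (ndvd_pred u) /\ u != (1, Q)%N.
Proof.
move=> jL E uS; have uF : farey_pair Q u by move: uS; rewrite mem_ndvd_pairs => /andP[].
have u1 : u != (1, Q)%N.
  apply/eqP => u1; move: E; rewrite u1 -head_sorted_ndvd => /eqP.
  by rewrite nth_uniq ?uniq_sorted_ndvd// (leq_ltn_trans _ jL).
split => //; have [pS plt pbet] := ndvd_predP uF u1.
have /mem_sorted_ndvd/(nthP 0)[i iL Ei] : exists2 v, v \in ndvd_pairs &
  frac (ndvd_pred u) = frac v by exists (ndvd_pred u).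
have ij : (i <= j)%N.
  rewrite leqNgt; apply/negP => ji.
  by have := nth_sorted_ndvd_le ji iL; rewrite Ei E leNgt plt.
have jL' := ltnW jL.
have /mem_sorted_ndvd[w wS Ew] : L`_j \in L by exact: mem_nth.
have := nth_sorted_ndvd_le ij jL'; rewrite Ei le_eqVlt => /orP[/eqP ->//|lt].
exfalso; apply: (pbet w wS); rewrite -Ew lt -E lt_neqAle nth_sorted_ndvd_le// andbT.
by rewrite nth_uniq ?uniq_sorted_ndvd// neq_ltn ltnSn.
Qed.

Lemma perm_behead_ndvd :
  perm_eq (behead L) (map frac [seq u <- ndvd_pairs | u != (1, Q)%N]).
Proof.
have -> : behead L = [seq x <- L | x != frac (1, Q)%N].
  have := uniq_sorted_ndvd; have := head_sorted_ndvd.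
  case: L => [|h t] /= E; first by [].
  rewrite E => /andP[ht _]; rewrite eqxx/=; apply/esym/all_filterP/allP => x xt.
  by apply: contraNneq ht => <-.
apply: (perm_trans (y := [seq x <- map frac ndvd_pairs | x != frac (1, Q)%N])).
  by apply: perm_filter; rewrite perm_sort perm_farey_ndvd.
rewrite filter_map /=.
rewrite (@eq_in_filter _ _ (fun u => u != (1, Q)%N)) ?perm_refl// => u.
rewrite mem_ndvd_pairs => /andP[_ uF] /=; congr (~~ _); apply/eqP/eqP => [|->//].
by apply: frac_inj_in uF farey_pair_min.
Qed.

(** Gaps are indexed by their right endpoint; the least element 1/Q is the right endpoint of
    none. *)
Lemma count_consecutive (phi : rat -> rat -> bool) :
  (\sum_(j < (size L).-1) phi (L`_j)%R (L`_j.+1)%R)%N =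
  count (fun u => (u != (1, Q)%N) && phi (frac (ndvd_pred u)) (frac u)) ndvd_pairs.
Proof.
pose D x := frac (ndvd_pred (`|numq x|%N, `|denq x|%N)).
have DE u : farey_pair Q u -> D (frac u) = frac (ndvd_pred u).
  by move=> uF; rewrite /D (frac_numq uF) (frac_denq uF); case: u uF.
transitivity (count (fun y => phi (D y) y) (behead L)).
  rewrite -sum1_count [RHS]big_mkcond [RHS](big_nth 0) size_behead [RHS]big_mkord.
  apply: eq_bigr => j _; rewrite nth_behead.
  have jL : (j.+1 < size L)%N by have := ltn_ord j; lia.
  have /mem_sorted_ndvd[u uS Eu] : L`_j.+1 \in L by exact: mem_nth.
  have [-> _] := nth_pred_ndvd jL Eu uS.
  move: uS; rewrite mem_ndvd_pairs Eu => /andP[_ uF]; rewrite DE//.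
rewrite (permP perm_behead_ndvd) count_map count_filter.
apply: eq_in_count => u; rewrite mem_ndvd_pairs => /andP[_ uF] /=.
by rewrite andbC DE.
Qed.

End NotDivisible.

Section GapIdentity.
Variables (l Q : nat).
Hypothesis l2 : (1 < l)%N.
Hypothesis Q0 : (0 < Q)%N.

(** The fraction 1/1 is never deleted, so every deleted fraction has a successor in the sequence. *)
Lemma dvd_farey_pair_lt u : farey_pair Q u -> (l %| u.1)%N -> (u.1 < u.2)%N.
Proof.
case: u => a n /and4P[/= a0 an nQ c] la; rewrite ltn_neqAle an andbT.
apply: contraTneq c => an'; rewrite /coprime an' gcdnn.
by apply: contraTneq la => n1; rewrite an' n1 dvdn1; lia.
Qed.

Lemma perm_farey_succ :
  perm_eq [seq u <- farey_pairs Q | (u != (1, Q)%N) && (l %| (farey_pred Q u).1)%N]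
          (map (farey_succ Q) [seq z <- farey_pairs Q | (l %| z.1)%N]).
Proof.
apply: uniq_perm; first by rewrite filter_uniq// uniq_farey_pairs.
  rewrite map_inj_in_uniq ?filter_uniq ?uniq_farey_pairs// => z z'.
  rewrite !mem_filter !mem_farey_pairs => /andP[lz zF] /andP[lz' zF'] E.
  rewrite -(farey_succK zF); last exact: dvd_farey_pair_lt.
  by rewrite E farey_succK//; exact: dvd_farey_pair_lt.
move=> u; rewrite mem_filter mem_farey_pairs; apply/andP/mapP.
  move=> [/andP[u1 lu] uF]; exists (farey_pred Q u); last by rewrite farey_predK.
  by rewrite mem_filter lu mem_farey_pairs farey_pair_pred.
move=> [z]; rewrite mem_filter mem_farey_pairs => /andP[lz zF] ->.
have zlt := dvd_farey_pair_lt zF lz.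
rewrite farey_succK// lz andbT; split; last exact: farey_pair_succ.
have [E _ _] := farey_succP zF; apply/eqP => E1; move: E; rewrite E1/=.
by case/and4P: zF => a0 an nQ _; nia.
Qed.

Lemma count_farey_succ (chi : nat * nat -> bool) :
  count (fun u => [&& u != (1, Q)%N, (l %| (farey_pred Q u).1)%N & chi u]) (farey_pairs Q) =
  count (fun z => (l %| z.1)%N && chi (farey_succ Q z)) (farey_pairs Q).
Proof.
have := permP perm_farey_succ chi; rewrite count_map !count_filter => E.
rewrite -[RHS](@eq_count _ (fun z => chi (farey_succ Q z) && (l %| z.1)%N)); last first.
  by move=> z /=; rewrite andbC.
by rewrite -E; apply: eq_count => u /=; rewrite [RHS]andbC andbA.
Qed.

Variable T : rat -> bool.

Definition pred_gap u := frac u - frac (farey_pred Q u).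
Definition succ_gap u := frac (farey_succ Q u) - frac u.

Lemma pred_gap_succ u : farey_pair Q u -> (u.1 < u.2)%N ->
  pred_gap (farey_succ Q u) = succ_gap u.
Proof. by move=> uF u1; rewrite /pred_gap farey_succK. Qed.

(** After reindexing by right endpoints all counts run over the same u, and the identity holds
    pointwise: u deleted, its predecessor deleted, or neither. The fraction 1/Q needs its own term,
    since its gap to 0 is counted among the Farey gaps but is not a gap of the list. *)
Lemma gap_identity :
  (count (fun u => (u != (1, Q)%N) && T (frac u - frac (ndvd_pred l Q u))) (ndvd_pairs l Q) +
   count (fun u => (l %| u.1)%N && T (pred_gap u)) (farey_pairs Q) +
   count (fun u => (l %| u.1)%N && T (succ_gap u)) (farey_pairs Q) + T (pred_gap (1, Q)%N) =
   count (fun u => T (pred_gap u)) (farey_pairs Q) +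
   count (fun u => (l %| u.1)%N && T (pred_gap u + succ_gap u)) (farey_pairs Q))%N.
Proof.
pose F := farey_pairs Q; pose M := (1, Q)%N.
(* Counts attached to a deleted fraction are moved to its successor, a bijection onto the fractions
   whose predecessor is deleted. *)
have E3 : count (fun u => (l %| u.1)%N && T (succ_gap u)) F =
    count (fun u => [&& u != M, (l %| (farey_pred Q u).1)%N & T (pred_gap u)]) F.
  rewrite (count_farey_succ (fun u => T (pred_gap u))).
  apply: eq_in_count => u; rewrite mem_farey_pairs => uF /=.
  case: (boolP (l %| u.1)%N) => //= lu.
  by rewrite pred_gap_succ// dvd_farey_pair_lt.
have E4 : count (fun u => (l %| u.1)%N && T (pred_gap u + succ_gap u)) F =
    count (fun u => [&& u != M, (l %| (farey_pred Q u).1)%N &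
      T (frac u - frac (farey_pred Q (farey_pred Q u)))]) F.
  rewrite (count_farey_succ (fun u => T (frac u - frac (farey_pred Q (farey_pred Q u))))).
  apply: eq_in_count => u; rewrite mem_farey_pairs => uF /=.
  case: (boolP (l %| u.1)%N) => //= lu.
  rewrite farey_succK ?dvd_farey_pair_lt//; congr T.
  by rewrite /pred_gap /succ_gap addrC subrKA.
have EM : T (pred_gap M) = count (fun u => (u == M) && T (pred_gap u)) F :> nat.
  rewrite (@eq_count _ _ (fun u => (u == M) && T (pred_gap M))); last first.
    by move=> u; case: eqP => // ->.
  case: (T (pred_gap M)); last first.
    by rewrite (@eq_count _ _ pred0) ?count_pred0// => u; rewrite andbF.
  rewrite (@eq_count _ _ (pred1 M)); last by move=> u; rewrite andbT.
  by rewrite count_uniq_mem ?uniq_farey_pairs// mem_farey_pairs farey_pair_min.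
rewrite E3 E4 EM count_filter -!sum1_count.
rewrite !(big_mkcond (fun _ => _ && _)) (big_mkcond (fun u => T (pred_gap u)))/=.
rewrite -!big_split/= big_seq [RHS]big_seq; apply: eq_bigr => u.
rewrite mem_farey_pairs => uF; rewrite /ndvd_pred.
have [->|u1] := eqVneq u M.
  by rewrite dvdn1 (gtn_eqF l2)/=; case: (T _).
have [E _ _] := farey_predP uF.
have excl : ~~ ((l %| u.1) && (l %| (farey_pred Q u).1))%N.
  apply/andP => -[lu lp]; have : (l %| u.1 * (farey_pred Q u).2)%N by rewrite dvdn_mulr.
  by rewrite E dvdn_addr ?dvdn_mulr// dvdn1; lia.
move: excl; case: (l %| u.1)%N; case: (l %| (farey_pred Q u).1)%N => //= _.
- by rewrite /pred_gap; case: (T _).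
- by rewrite /pred_gap; case: (T _); case: (T _).
- by rewrite /pred_gap; case: (T _).
Qed.

End GapIdentity.

Section PairNumbers.
Variables (R : realType) (Q l : nat).
Hypothesis Q0 : (0 < Q)%N.

Lemma count_pair_number s (P : nat -> nat -> bool) :
  count (fun u => (l %| u.1)%N && P (neighbour_den s Q u.2 u.1) u.2) (farey_pairs Q) =
  pair_count s Q l P.
Proof.
rewrite -sum1_count /farey_pairs big_mkcond big_allpairs_dep/= /pair_count.
rewrite /index_iota subn1/=; apply: eq_bigr => n _.
rewrite subn1/= big_filter big_mkcond/=; apply: eq_bigr => a _.
by case: (coprime a n) => //=; case: (_ && _).
Qed.

Definition gap1_set (tau : R) : set (R * R) := [set z | (z.1 * z.2)^-1 <= tau].

(** At (p/Q, n/Q) this is the integer (p + s) / n, where s is the denominator of the successor. *)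
Definition triangle_index (z : R * R) : R := (Num.floor ((1 + z.1) / z.2))%:~R.

Definition gap2_set (tau : R) : set (R * R) :=
  [set z | triangle_index z / (z.1 * (triangle_index z * z.2 - z.1)) <= tau].

Lemma succ_gapE u : farey_pair Q u -> (u.1 < u.2)%N ->
  succ_gap Q u = (u.2%:R * (farey_succ Q u).2%:R)^-1.
Proof.
move=> uF u1; rewrite -(pred_gap_succ uF u1) /pred_gap frac_sub_pred.
  by rewrite farey_succK.
exact: farey_pair_succ.
Qed.

Lemma scale_gap (p n : nat) (t : R) : (0 < p)%N -> (0 < n)%N ->
  (ratr ((p%:R * n%:R)^-1 : rat) <= t) =
  `[< gap1_set (t * Q%:R ^+ 2) (p%:R / Q%:R, n%:R / Q%:R) >].
Proof.
move=> p0 n0; have [p0' n0'] : 0 < p%:R :> R /\ 0 < n%:R :> R by rewrite !ltr0n.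
have q0 : 0 < Q%:R :> R by rewrite ltr0n.
rewrite fmorphV rmorphM/= !ratr_nat.
have -> : `[< gap1_set (t * Q%:R ^+ 2) (p%:R / Q%:R, n%:R / Q%:R) >] =
  ((p%:R / Q%:R * (n%:R / Q%:R))^-1 <= t * Q%:R ^+ 2).
  by apply/asboolP/idP.
have -> : (p%:R / Q%:R * (n%:R / Q%:R))^-1 = (p%:R * n%:R)^-1 * Q%:R ^+ 2 :> R.
  by field; rewrite !gt_eqF.
by rewrite ler_pM2r// exprn_gt0.
Qed.

(** Modulo n, a (p + s) = 1 - 1 = 0, so p + s = K n; the window for s reads K n <= Q + p < (K + 1)
    n, which makes K the floor. The gaps 1/(x y) and 1/(y (K y - x)) add up to K / (x (K y - x)). *)
Lemma scale_gap2 (u : nat * nat) (t : R) : farey_pair Q u -> (u.1 < u.2)%N ->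
  (ratr (pred_gap Q u + succ_gap Q u) <= t) =
  `[< gap2_set (t * Q%:R ^+ 2)
        ((neighbour_den true Q u.2 u.1)%:R / Q%:R, u.2%:R / Q%:R) >].
Proof.
move=> uF u1; rewrite succ_gapE// /pred_gap frac_sub_pred//.
have [E1 w1 w2] := farey_predP uF; have [E2 w3 w4] := farey_succP uF.
have plt := farey_pred_lt uF.
move: E1 w1 w2 plt E2 w3 w4; rewrite /farey_pred /farey_succ/=.
move: (neighbour_den true Q u.2 u.1) (neighbour_den false Q u.2 u.1) => p s.
move: ((u.1 * p - 1) %/ u.2)%N ((u.1 * s + 1) %/ u.2)%N => b e.
case: u uF u1 => a n uF /= an E1 w1 w2 plt E2 w3 w4.
have /and4P[/= a0 _ nQ c] := uF.
have p0 : (0 < p)%N by apply: leq_ltn_trans plt.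
have s0 : (0 < s)%N by lia.
have n0 : (0 < n)%N by lia.
have /dvdnP[K KE] : (n %| p + s)%N.
  rewrite -(@Gauss_dvdr n a) 1?coprime_sym// mulnDr E1 -addnA [(1 + _)%N]addnC -E2.
  by rewrite dvdn_add// dvdn_mull.
have [[p0' n0'] [s0' q0]] : (0 < p%:R :> R /\ 0 < n%:R :> R) /\ (0 < s%:R :> R /\ 0 < Q%:R :> R).
  by rewrite !ltr0n.
have KR : K%:R * n%:R = p%:R + s%:R :> R by rewrite -natrM -natrD KE.
have flK : triangle_index (p%:R / Q%:R, n%:R / Q%:R) = K%:R :> R.
  rewrite /triangle_index/=.
  have -> : (1 + p%:R / Q%:R) / (n%:R / Q%:R) = (Q + p)%:R / n%:R :> R.
    by rewrite natrD; field; rewrite !gt_eqF.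
  rewrite (@Num.Theory.floor_def _ _ K%:Z)//; apply/andP; split.
    by rewrite -pmulrn ler_pdivlMr// -natrM ler_nat -KE; lia.
  rewrite (_ : (K%:Z + 1)%:~R = K.+1%:R :> R); last by rewrite -[K.+1]addn1 natrD intrD.
  by rewrite ltr_pdivrMr// -natrM ltr_nat mulSn -KE; lia.
rewrite rmorphD/= !fmorphV !rmorphM/= !ratr_nat.
have -> : `[< gap2_set (t * Q%:R ^+ 2) (p%:R / Q%:R, n%:R / Q%:R) >] =
  (K%:R / (p%:R / Q%:R * (K%:R * (n%:R / Q%:R) - p%:R / Q%:R)) <= t * Q%:R ^+ 2).
  by apply/asboolP/idP; rewrite /gap2_set/= flK.
have -> : K%:R / (p%:R / Q%:R * (K%:R * (n%:R / Q%:R) - p%:R / Q%:R)) =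
   ((p%:R * n%:R)^-1 + (n%:R * s%:R)^-1) * Q%:R ^+ 2 :> R.
  rewrite mulrA KR (_ : K%:R = (p%:R + s%:R) / n%:R); last by rewrite -KR mulfK ?gt_eqF.
  by field; rewrite !gt_eqF//= [_ + _ - _]addrC addKr gt_eqF.
by rewrite ler_pM2r// exprn_gt0.
Qed.

End PairNumbers.

Section GapNumbers.
Variables (R : realType) (l Q : nat) (t : R).
Hypothesis l2 : (1 < l)%N.
Hypothesis Q0 : (0 < Q)%N.
Notation L := (sort <=%O (farey_ndvd l Q)).

(* A deleted fraction removes its two gaps (left: s = true, right: s = false) and
   adds their sum; b stands for the gap from 0 to 1/Q, which is not in the list. *)
Lemma gap_number_identity :
  exists b : bool,
  (\sum_(j < (size L).-1) (ratr (L`_j.+1 - L`_j)%R <= t)%R +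
   pair_number true Q l (gap1_set (t * Q%:R ^+ 2)) +
   pair_number false Q l (gap1_set (t * Q%:R ^+ 2)) + b =
   pair_number true Q 1 (gap1_set (t * Q%:R ^+ 2)) +
   pair_number true Q l (gap2_set (t * Q%:R ^+ 2)))%N.
Proof.
exists (ratr (pred_gap Q (1, Q)%N) <= t).
rewrite (count_consecutive l2 Q0 (fun x y => ratr (y - x) <= t)).
have gt0 u : farey_pair Q u -> (0 < (farey_pred Q u).2)%N /\ (0 < u.2)%N.
  by move=> uF; have := farey_pred_lt uF; have [] := farey_pair_gt0 uF; lia.
rewrite /pair_number -!count_pair_number.
have := gap_identity l2 Q0 (fun d => ratr d <= t).
congr (_ + _ + _ + _ = _ + _)%N.
- apply: eq_in_count => u; rewrite mem_farey_pairs => uF; have [p0 n0] := gt0 _ uF.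
  by rewrite /pred_gap frac_sub_pred// (scale_gap Q0).
- apply: eq_in_count => u; rewrite mem_farey_pairs => uF.
  case: (boolP (l %| u.1)%N) => //= lu; have ult := dvd_farey_pair_lt l2 Q0 uF lu.
  have [_ w _] := farey_succP uF; have [u0 uQ] := farey_pair_gt0 uF.
  rewrite succ_gapE// mulrC (scale_gap Q0)//; lia.
- apply: eq_in_count => u; rewrite mem_farey_pairs => uF; have [p0 n0] := gt0 _ uF.
  by rewrite /pred_gap frac_sub_pred// (scale_gap Q0) ?dvd1n.
- apply: eq_in_count => u; rewrite mem_farey_pairs => uF.
  case: (boolP (l %| u.1)%N) => //= lu; have ult := dvd_farey_pair_lt l2 Q0 uF lu.
  by rewrite (scale_gap2 Q0).
Qed.

Lemma size_farey_ndvd :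
  (size L + pair_number true Q l [set: R * R] = pair_number true Q 1 [set: R * R])%N.
Proof.
rewrite size_sort (perm_size (perm_farey_ndvd l Q)) size_map size_filter.
rewrite /pair_number -!count_pair_number.
rewrite (@eq_count _ (fun u => (l %| u.1)%N && _) (fun u => (l %| u.1)%N)); last first.
  by move=> u; rewrite asboolT// andbT.
rewrite (@eq_count _ (fun u => (1 %| u.1)%N && _) predT); last first.
  by move=> u; rewrite asboolT// dvd1n.
by rewrite addnC count_predT -(count_predC (fun u => l %| u.1)%N).
Qed.

Lemma last_sorted_ndvd : L`_(size L).-1 = 1.
Proof.
have F1 : farey_pair Q (1, 1)%N by apply/and4P; split.
have m1 : (1, 1)%N \in ndvd_pairs l Q by rewrite mem_ndvd_pairs F1 andbT/= dvdn1; lia.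
have f1 : frac (1, 1)%N = 1 by rewrite /frac divr1.
have /mem_sorted_ndvd/(nthP 0)[i iL E] : exists2 u, u \in ndvd_pairs l Q & 1 = frac u.
  by exists (1, 1)%N.
have s0 : (0 < size L)%N := leq_ltn_trans (leq0n i) iL.
apply/eqP; rewrite eq_le; apply/andP; split; last first.
  by rewrite -E nth_sorted_ndvd_le ?prednK// -ltnS prednK.
have /mem_sorted_ndvd[u + ->] : L`_(size L).-1 \in L by apply: mem_nth; rewrite prednK.
rewrite mem_ndvd_pairs => /andP[_ /and4P[a0 an _ _]].
by rewrite /frac ler_pdivrMr ?mul1r ?ler_nat// ltr0n; lia.
Qed.

End GapNumbers.

(** * Areas of planar regions *)

Section PlaneSets.
Variable R : realType.
Notation mu2 := (@lebesgue_measure R \x @lebesgue_measure R)%E.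
Implicit Types (f g : R * R -> R).

Lemma open_lt_fun f g : continuous f -> continuous g -> open [set z | f z < g z].
Proof.
move=> cf cg; rewrite (_ : [set z | _] = (fun z => g z - f z) @^-1` [set x | 0 < x]).
  apply: open_comp; last exact: open_gt.
  by move=> z _; apply: continuousB; [exact: cg|exact: cf].
by apply/seteqP; split => z /=; rewrite subr_gt0.
Qed.

Lemma fst_cont : continuous (fun z : R * R => z.1).
Proof. by move=> z; exact: cvg_fst. Qed.

Lemma snd_cont : continuous (fun z : R * R => z.2).
Proof. by move=> z; exact: cvg_snd. Qed.

Lemma cst_cont (c : R) : continuous (fun _ : R * R => c).
Proof. by move=> z; exact: cvg_cst. Qed.

Lemma add_cont f g : continuous f -> continuous g -> continuous (fun z => f z + g z).
Proof. by move=> cf cg z; apply: continuousD; [exact: cf|exact: cg]. Qed.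

Lemma mul_cont f g : continuous f -> continuous g -> continuous (fun z => f z * g z).
Proof. by move=> cf cg z; apply: continuousM; [exact: cf|exact: cg]. Qed.

Lemma sub_cont f g : continuous f -> continuous g -> continuous (fun z => f z - g z).
Proof. by move=> cf cg z; apply: continuousB; [exact: cf|exact: cg]. Qed.

Lemma measurable_le_set f g : measurable_fun setT f -> measurable_fun setT g ->
  measurable [set z | f z <= g z].
Proof. by move=> mf mg; rewrite -[X in measurable X]setTI; exact: measurable_fun_le. Qed.

Lemma measurable_lt_set f g : measurable_fun setT f -> measurable_fun setT g ->
  measurable [set z | f z < g z].
Proof.
move=> mf mg; rewrite (_ : [set z | _] = ~` [set z | g z <= f z]).
  by apply: measurableC; exact: measurable_le_set.
by apply/seteqP; split => z /=; [move=> h; apply/negP; rewrite -ltNge|move=> /negP; rewrite -ltNge].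
Qed.

Lemma null_of_countable_sections (D : set (R * R)) :
  (forall x, countable (xsection D x)) -> mu2 D = 0%E.
Proof.
move=> cD; apply: integral0_eq => x _ /=.
exact: countable_lebesgue_measure0.
Qed.

Lemma null_vertical_line (c : R) : mu2 ([set c] `*` setT) = 0%E.
Proof.
rewrite product_measure1E//.
transitivity (0 * lebesgue_measure [set: R])%E; last by rewrite mul0e.
by congr (_ * _)%E; exact: lebesgue_measure_set1.
Qed.

(** Sets with boundary may contain a segment of the side x = 1; that one vertical line is null and
    is removed beforehand. *)
Lemma null_of_countable_sections_off1 (D : set (R * R)) : measurable D ->
  (forall x, x != 1 -> countable (xsection D x)) -> mu2 D = 0%E.
Proof.
move=> mD cD.
have mL : measurable ([set (1 : R)] `*` [set: R]) by apply: measurableX.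
have mDL : measurable (D `\` ([set (1 : R)] `*` [set: R])) by exact: measurableD.
have null1 : mu2 (D `\` ([set (1 : R)] `*` [set: R])) = 0%E.
  apply: null_of_countable_sections => x; have [->|x1] := eqVneq x 1.
    rewrite (_ : xsection _ _ = set0); first exact: countable0.
    by apply/seteqP; split => // y; rewrite /xsection/= inE => -[_]; apply.
  apply: sub_countable (cD x x1); apply: subset_card_le => y.
  by rewrite /xsection/= !inE => -[].
apply/eqP; rewrite eq_le measure_ge0 andbT.
apply: (@le_trans _ _ (mu2 ((D `\` ([set (1 : R)] `*` [set: R])) `|` ([set (1 : R)] `*` [set: R])))).
  apply: le_measure; [by rewrite inE|rewrite inE; exact: measurableU|].
  by move=> z Dz; have [h|h] := pselect (([set (1 : R)] `*` [set: R]) z); [right|left].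
apply: le_trans (measureU2 _ _ _) _ => //.
have E := null_vertical_line 1.
by rewrite [X in (X + _)%E]null1 add0e [X in (X <= _)%E]E.
Qed.

Definition open_triangle : set (R * R) :=
  [set z | [/\ 0 < z.1 < 1, 0 < z.2 < 1 & 1 < z.1 + z.2]].

Lemma open_open_triangle : open open_triangle.
Proof.
rewrite (_ : open_triangle = [set z | 0 < z.1] `&` [set z | z.1 < 1] `&`
  ([set z | 0 < z.2] `&` [set z | z.2 < 1]) `&` [set z | 1 < z.1 + z.2]); last first.
  apply/seteqP; split => z /=.
    by move=> [/andP[a b] /andP[c d] e].
  by move=> [[[a b] [c d]] e]; split => //; apply/andP.
do 3?apply: openI; try (apply: openI); apply: open_lt_fun;
  do ?[exact: fst_cont|exact: snd_cont|exact: cst_cont|exact: add_cont fst_cont snd_cont].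
Qed.

Lemma in_triangle_open_triangle : in_triangle open_triangle.
Proof. by move=> z [/andP[a b] /andP[c d] e]; rewrite a c (ltW b) (ltW d). Qed.

Lemma mu2_open_triangle : mu2 open_triangle = (2^-1)%:E.
Proof.
transitivity (\int[@lebesgue_measure R]_(x in `]0%R, 1%R[) x%:E)%E.
  rewrite [RHS]integral_mkcond; apply: eq_integral => x _ /=.
  rewrite patchE; case: ifPn; rewrite ?inE ?notin_setE /= in_itv/=.
    move=> x01; have -> : xsection open_triangle x = [set` `](1 - x)%R, 1%R[ ].
      apply/seteqP; split => y; rewrite /xsection/= inE /open_triangle/= in_itv/=.
        by move=> [_ /andP[_ y1] xy]; apply/andP; split => //; lra.
      by move=> /andP[y0 y1]; split => //; [apply/andP; split => //|]; move: x01 => /andP[]; lra.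
    move: x01 => /andP[x0 x1].
    rewrite lebesgue_measure_itv/= lte_fin ltrBlDr ltrDl x0.
    by rewrite -EFinB opprB addrC subrK.
  move=> x01; rewrite (_ : xsection _ _ = set0) ?measure0//.
  by apply/seteqP; split => // y; rewrite /xsection/= inE /open_triangle/= => -[].
pose F (x : R) : R := 2^-1 * x ^+ 2.
have dF (x : R) : is_derive x 1 F x.
  rewrite /F; apply: is_derive_eq.
  by rewrite /GRing.scale/=; field.
rewrite integral_itv_obnd_cbnd; last by exact: EFin_measurable.
rewrite integral_itv_bndo_bndc; last by exact: EFin_measurable.
rewrite (@continuous_FTC2 R (fun x => x) F 0 1)//.
- by rewrite /F expr1n expr0n/= mulr0 mulr1 sube0.
- by apply: continuous_subspaceT => x; exact: cvg_id.
- have cF : continuous F.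
    by move=> x; apply: differentiable_continuous; apply/derivable1_diffP; case: (dF x).
  split; first by move=> x _; case: (dF x).
    by apply: cvg_at_right_filter; exact: cF.
  by apply: cvg_at_left_filter; exact: cF.
- by move=> x _; rewrite derive1E; apply: derive_val.
Qed.

Lemma measurable_open_triangle : measurable open_triangle.
Proof.
apply: measurable_open_in_square; first exact: open_open_triangle.
by move=> z /in_triangle_open_triangle[].
Qed.

End PlaneSets.

(** * Gap functions and their sublevel areas *)

Section GapFunctions.
Variable R : realType.
Notation mu2 := (@lebesgue_measure R \x @lebesgue_measure R)%E.

(* A function g given on an open set O of full measure in the triangle, continuous
   there in the weak sense of gap_lt and gap_gt, and with negligible level sets. *)
Record gap_function (O : set (R * R)) (g : R * R -> R) : Prop := GapFunction {
  gap_open : open O;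
  gap_triangle : O `<=` @open_triangle R;
  gap_full : mu2 O = (2^-1)%:E;
  gap_pos : forall z, O z -> 0 < g z;
  gap_lt : forall a, open (O `&` [set z | g z < a]);
  gap_gt : forall a, open (O `&` [set z | a < g z]);
  gap_level : forall a, mu2 (O `&` [set z | g z = a]) = 0%E }.

(** The strict inequality gives an open set; as level sets are null, the large inequality defines
    the same area. *)
Definition gap_area (O : set (R * R)) (g : R * R -> R) (a : R) : R :=
  fine (mu2 (O `&` [set z | g z < a])).

Section Theory.
Variables (O : set (R * R)) (g : R * R -> R).
Hypothesis gO : gap_function O g.

Lemma gap_in_square (U : set (R * R)) : U `<=` O ->
  forall z, U z -> 0 < z.1 <= 1 /\ 0 < z.2 <= 1.
Proof.
by move=> UO z /UO/(gap_triangle gO)/in_triangle_open_triangle[].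
Qed.

Lemma measurable_gap_dom : measurable O.
Proof. exact: measurable_open_in_square (gap_open gO) (gap_in_square _). Qed.

Lemma measurable_gap_lt a : measurable (O `&` [set z | g z < a]).
Proof.
apply: (measurable_open_in_square (@gap_lt _ _ gO a)); apply: gap_in_square.
by move=> z [].
Qed.

Lemma measurable_gap_gt a : measurable (O `&` [set z | a < g z]).
Proof.
apply: (measurable_open_in_square (@gap_gt _ _ gO a)); apply: gap_in_square.
by move=> z [].
Qed.

Lemma gap_le_decomp a : O `&` [set z | g z <= a] =
  O `\` (O `&` [set z | a < g z]).
Proof.
apply/seteqP; split => z /= [Oz h]; split => //.
  by move=> [_]; rewrite ltNge h.
by rewrite leNgt; apply/negP => h'; apply: h.
Qed.

Lemma measurable_gap_le a : measurable (O `&` [set z | g z <= a]).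
Proof.
by rewrite gap_le_decomp; apply: measurableD; [exact: measurable_gap_dom|exact: measurable_gap_gt].
Qed.

Lemma measurable_gap_eq a : measurable (O `&` [set z | g z = a]).
Proof.
rewrite (_ : _ `&` _ = (O `&` [set z | g z <= a]) `\` (O `&` [set z | g z < a])).
  by apply: measurableD; [exact: measurable_gap_le|exact: measurable_gap_lt].
apply/seteqP; split => z /=.
  by move=> [Oz ->]; split; [split|move=> [_]; rewrite ltxx].
move=> [[Oz h] h']; split => //; apply/eqP; rewrite eq_le h/= leNgt.
by apply/negP => h2; apply: h'.
Qed.

Lemma mu2_gap_le a : mu2 (O `&` [set z | g z <= a]) = mu2 (O `&` [set z | g z < a]).
Proof.
have -> : O `&` [set z | g z <= a] = (O `&` [set z | g z < a]) `|` (O `&` [set z | g z = a]).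
  apply/seteqP; split => z /=.
    by move=> [Oz]; rewrite le_eqVlt => /orP[/eqP|]; [right|left].
  by move=> [[Oz /ltW]|[Oz ->]].
rewrite measureU.
- by rewrite [X in (_ + X)%E](gap_level gO a) adde0.
- exact: measurable_gap_lt.
- exact: measurable_gap_eq.
- by apply/seteqP; split => // z /= [[_ h] [_ h']]; rewrite h' ltxx in h.
Qed.

Lemma mu2_gap_fin (U : set (R * R)) : measurable U -> U `<=` O -> mu2 U \is a fin_num.
Proof.
move=> mU UO; rewrite ge0_fin_numE//; apply: (@le_lt_trans _ _ (2^-1)%:E); last by rewrite ltry.
rewrite -(gap_full gO); apply: le_measure; rewrite ?inE//; exact: measurable_gap_dom.
Qed.

Lemma gap_areaE a : mu2 (O `&` [set z | g z <= a]) = (gap_area O g a)%:E.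
Proof.
rewrite /gap_area fineK ?mu2_gap_le//.
by apply: mu2_gap_fin; [exact: measurable_gap_lt|move=> z []].
Qed.

Lemma gap_area_split a :
  gap_area O g a + fine (mu2 (O `&` [set z | a < g z])) = 2^-1.
Proof.
have f1 : mu2 (O `&` [set z | a < g z]) \is a fin_num.
  by apply: mu2_gap_fin; [exact: measurable_gap_gt|move=> z []].
apply: EFin_inj; rewrite EFinD -gap_areaE fineK// -(gap_full gO).
have E : O = (O `&` [set z | g z <= a]) `|` (O `&` [set z | a < g z]).
  apply/seteqP; split => z /=; last by move=> [[]|[]].
  by move=> Oz; case: (leP (g z) a); [left|right].
rewrite [in RHS]E measureU//; [exact: measurable_gap_le|exact: measurable_gap_gt|].
by apply/seteqP; split => // z /= [[_ h] [_]]; rewrite ltNge h.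
Qed.

(** The open sets g < a and g > a serve as inner approximations of S and of its complement; what
    lies between them is a null level set. *)
Lemma pair_density_gap s l (S : set (R * R)) a : (0 < l)%N ->
  (forall z, O z -> S z <-> g z <= a) ->
  pair_density s Q l S @[Q --> \oo] --> C_const R l / l%:R * gap_area O g a.
Proof.
move=> l0 SE.
have tri (U : set (R * R)) : U `<=` O -> in_triangle U.
  by move=> UO z /UO/(gap_triangle gO)/in_triangle_open_triangle.
apply: (pair_density_cvg s l0 (@gap_lt _ _ gO a) (@gap_gt _ _ gO a)).
- by apply: tri => z [].
- by apply: tri => z [].
- by move=> z [Oz /= h]; apply/SE => //; exact: ltW.
- by move=> z [Oz /= h] /SE; rewrite leNgt h => /(_ Oz).
- exact: gap_area_split.
Qed.

Lemma gap_area_le a b : a <= b -> gap_area O g a <= gap_area O g b.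
Proof.
move=> ab; rewrite -lee_fin -!gap_areaE; apply: le_measure; rewrite ?inE.
- exact: measurable_gap_le.
- exact: measurable_gap_le.
- by move=> z [Oz h]; split => //=; exact: le_trans h ab.
Qed.

Lemma gap_area_le0 a : a <= 0 -> gap_area O g a = 0.
Proof.
move=> a0; rewrite /gap_area (_ : _ `&` _ = set0) ?measure0//.
by apply/seteqP; split => // z [/(gap_pos gO) h /=]; rewrite ltNge (le_trans a0 (ltW h)).
Qed.

(** Continuity from above gives the area of g <= a; the null level set identifies it with that of g
    < a. *)
Lemma cvg_gap_area_right a : gap_area O g (a + n.+1%:R^-1) @[n --> \oo] --> gap_area O g a.
Proof.
have E : O `&` [set z | g z <= a] = \bigcap_n (O `&` [set z | g z <= a + n.+1%:R^-1]).
  apply/seteqP; split => z /=.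
    by move=> [Oz h] n _; split => //=; rewrite (le_trans h)// lerDl invr_ge0.
  move=> h; have [Oz _] := h 0%N I; split => //=.
  apply/ler_addgt0Pl => e e0; have [_ /= hn] := h (Num.truncn e^-1) I.
  rewrite (le_trans hn)// addrC lerD2r ltW// invf_plt ?posrE//; exact: truncnS_gt.
have : (mu2 \o (fun n : nat => O `&` [set z | g z <= a + n.+1%:R^-1])) n @[n --> \oo] -->
    mu2 (\bigcap_n (O `&` [set z | g z <= a + n.+1%:R^-1])).
  apply: nonincreasing_cvg_mu.
  - rewrite [X in (X < _)%E]gap_areaE ltry//.
  - by move=> n; exact: measurable_gap_le.
  - by rewrite -E; exact: measurable_gap_le.
  - move=> m n mn; apply/subsetPset => z /= [Oz h]; split => //=.
    by rewrite (le_trans h)// lerD2l lef_pV2 ?posrE// ler_nat.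
rewrite -E gap_areaE => /fine_cvg/=.
by under eq_fun do rewrite /= gap_areaE.
Qed.

Lemma cvg_gap_area_left a : gap_area O g (a - n.+1%:R^-1) @[n --> \oo] --> gap_area O g a.
Proof.
have E : O `&` [set z | g z < a] = \bigcup_n (O `&` [set z | g z <= a - n.+1%:R^-1]).
  apply/seteqP; split => z /=.
    move=> [Oz h]; have d0 : 0 < a - g z by rewrite subr_gt0.
    exists (Num.truncn (a - g z)^-1) => //; split => //=.
    rewrite lerBrDr -lerBrDl ltW// invf_plt ?posrE//; exact: truncnS_gt.
  move=> [n _ [Oz /= h]]; split => //=; apply: le_lt_trans h _.
  by rewrite ltrBlDr ltrDl invr_gt0.
have : (mu2 \o (fun n : nat => O `&` [set z | g z <= a - n.+1%:R^-1])) n @[n --> \oo] -->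
    mu2 (\bigcup_n (O `&` [set z | g z <= a - n.+1%:R^-1])).
  apply: nondecreasing_cvg_mu.
  - by move=> n; exact: measurable_gap_le.
  - by rewrite -E; exact: measurable_gap_lt.
  - move=> m n mn; apply/subsetPset => z /= [Oz h]; split => //=.
    by rewrite (le_trans h)// lerD2l lerN2 lef_pV2 ?posrE// ler_nat.
rewrite -E -mu2_gap_le gap_areaE => /fine_cvg/=.
by under eq_fun do rewrite /= gap_areaE.
Qed.

Lemma cvg_gap_area_infty : gap_area O g n%:R @[n --> \oo] --> (2^-1 : R).
Proof.
have E : O = \bigcup_n (O `&` [set z | g z <= n%:R]).
  apply/seteqP; split => z; last by move=> [n _ []].
  move=> Oz; exists (Num.truncn (g z)).+1 => //; split => //=.
  by rewrite ltW// truncnS_gt.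
have : (mu2 \o (fun n : nat => O `&` [set z | g z <= n%:R])) n @[n --> \oo] -->
    mu2 (\bigcup_n (O `&` [set z | g z <= n%:R])).
  apply: nondecreasing_cvg_mu.
  - by move=> n; exact: measurable_gap_le.
  - by rewrite -E; exact: measurable_gap_dom.
  - move=> m n mn; apply/subsetPset => z /= [Oz h]; split => //=.
    by rewrite (le_trans h)// ler_nat.
rewrite -E (gap_full gO) => /fine_cvg/=.
by under eq_fun do rewrite /= gap_areaE.
Qed.

End Theory.

End GapFunctions.

Section Instances.
Variable R : realType.
Notation mu2 := (@lebesgue_measure R \x @lebesgue_measure R)%E.

Definition gap1 (z : R * R) : R := (z.1 * z.2)^-1.

Definition gap2 (z : R * R) : R :=
  triangle_index z / (z.1 * (triangle_index z * z.2 - z.1)).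

Local Notation otri := (@open_triangle R).

Lemma xsectionP (D : set (R * R)) x y : xsection D x y <-> D (x, y).
Proof. by rewrite /xsection/=; split; rewrite inE. Qed.

Lemma countable_sub_range (D : set R) (h : nat -> R) :
  (forall y, D y -> exists K, y = h K) -> countable D.
Proof.
move=> Dh; have c : countable (\bigcup_K [set h K]).
  by apply: bigcup_countable => // K _; exact: countable1.
apply: sub_countable c; apply: subset_card_le => y /Dh[K ->].
by exists K.
Qed.

Lemma prod_cont : continuous (fun z : R * R => z.1 * z.2).
Proof. exact: mul_cont (@fst_cont R) (@snd_cont R). Qed.

Lemma gap_function1 : gap_function otri gap1.
Proof.
have pos z : otri z -> 0 < z.1 * z.2.
  by move=> [/andP[a _] /andP[b _] _]; rewrite mulr_gt0.
split => //.
- exact: open_open_triangle.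
- exact: mu2_open_triangle.
- by move=> z /pos h; rewrite invr_gt0.
- move=> a; rewrite (_ : _ `&` _ = otri `&` [set z | 1 < a * (z.1 * z.2)]).
    apply: openI; first exact: open_open_triangle.
    by apply: open_lt_fun; [exact: cst_cont|apply: mul_cont; [exact: cst_cont|exact: prod_cont]].
  apply/seteqP; split => z [Oz /= h]; split => //=; move: h; rewrite /gap1.
    by rewrite -[X in X < _]mul1r ltr_pdivrMr ?pos.
  by rewrite -[X in _ -> X < _]mul1r ltr_pdivrMr ?pos.
- move=> a; rewrite (_ : _ `&` _ = otri `&` [set z | a * (z.1 * z.2) < 1]).
    apply: openI; first exact: open_open_triangle.
    by apply: open_lt_fun; [apply: mul_cont; [exact: cst_cont|exact: prod_cont]|exact: cst_cont].
  apply/seteqP; split => z [Oz /= h]; split => //=; move: h; rewrite /gap1.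
    by rewrite -[X in _ < X]mul1r ltr_pdivlMr ?pos.
  by rewrite -[X in _ -> _ < X]mul1r ltr_pdivlMr ?pos.
- move=> a; apply: null_of_countable_sections => x.
  apply: (@countable_sub_range _ (fun=> (a * x)^-1)) => y /xsectionP[Oz /= <-]; exists 0%N.
  case: Oz => /= /andP[x0 _] /andP[y0 _] _.
  by rewrite /gap1/=; field; rewrite !gt_eqF.
Qed.

(** The interior part of the region where the floor equals K, cut out by strict inequalities so as
    to be open. *)
Definition cell (K : nat) : set (R * R) :=
  otri `&` [set z | K%:R * z.2 < 1 + z.1] `&` [set z | 1 + z.1 < K.+1%:R * z.2].

Definition cells : set (R * R) := \bigcup_K cell K.

Lemma cell_index K z : cell K z -> triangle_index z = K%:R.
Proof.
move=> [[[_ /andP[z0 _] _] /= h1] /= h2]; rewrite /triangle_index.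
rewrite (@Num.Theory.floor_def _ _ K%:Z)//; apply/andP; split.
  by rewrite -pmulrn ler_pdivlMr// ltW.
rewrite (_ : (K%:Z + 1)%:~R = K.+1%:R :> R); last by rewrite -[K.+1]addn1 natrD intrD.
by rewrite ltr_pdivrMr.
Qed.

Lemma cell_pos K z : cell K z -> (0 < K)%N /\ 0 < z.1 * (K%:R * z.2 - z.1).
Proof.
move=> [[[/andP[x0 x1] /andP[y0 y1] _] /= h1] /= h2].
have h : 0 < K%:R * z.2 - z.1 by move: h2; rewrite -natr1; lra.
split; last by rewrite mulr_gt0.
by rewrite lt0n; apply: contraTneq h => ->; rewrite mul0r sub0r oppr_gt0 -leNgt ltW.
Qed.

Lemma open_cell K : open (cell K).
Proof.
rewrite /cell; apply: openI; first apply: openI; first exact: open_open_triangle.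
  apply: open_lt_fun; first by apply: mul_cont; [exact: cst_cont|exact: snd_cont].
  by apply: add_cont; [exact: cst_cont|exact: fst_cont].
apply: open_lt_fun; last by apply: mul_cont; [exact: cst_cont|exact: snd_cont].
by apply: add_cont; [exact: cst_cont|exact: fst_cont].
Qed.

Lemma cell_gap2 K z a : cell K z ->
  (gap2 z < a) = (K%:R < a * (z.1 * (K%:R * z.2 - z.1))) /\
  (a < gap2 z) = (a * (z.1 * (K%:R * z.2 - z.1)) < K%:R) /\
  (gap2 z <= a) = (K%:R <= a * (z.1 * (K%:R * z.2 - z.1))).
Proof.
move=> cz; have [_ p] := cell_pos cz; rewrite /gap2 (cell_index cz).
by rewrite ltr_pdivrMr// ltr_pdivlMr// ler_pdivrMr.
Qed.

Lemma cells_sub : cells `<=` otri.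
Proof. by move=> z [K _ [[]]]. Qed.

Lemma open_cells : open cells.
Proof. by apply: bigcup_open => K _; exact: open_cell. Qed.

(** The rest of the open triangle lies on the lines K y = 1 + x, which meet each vertical line in
    countably many points. *)
Lemma mu2_cells : mu2 cells = (2^-1)%:E.
Proof.
have mc : measurable cells.
  apply: measurable_open_in_square open_cells _.
  by move=> z /cells_sub/in_triangle_open_triangle[].
have mD : measurable (otri `\` cells).
  by apply: measurableD => //; exact: measurable_open_triangle.
rewrite -mu2_open_triangle.
have E : otri = cells `|` (otri `\` cells).
  by rewrite setDUK//; exact: cells_sub.
rewrite [in RHS]E measureU//; last by rewrite setDIK.
rewrite [X in (_ + X)%E](_ : _ = 0%E) ?adde0//.
apply: null_of_countable_sections => x.
apply: (@countable_sub_range _ (fun K => (1 + x) / K%:R)) => y /xsectionP[Oz nc].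
case: (Oz) => /= /andP[x0 x1] /andP[y0 y1] _.
have q0 : 0 <= (1 + x) / y by rewrite divr_ge0 ?(ltW y0)// addr_ge0// ltW.
have /andP[t1 t2] := truncn_itv q0; set K := Num.truncn _ in t1 t2.
exists K; move: t1; rewrite ler_pdivlMr// le_eqVlt => /orP[/eqP E1|lt].
  have K0 : K%:R != 0 :> R.
    by apply: contra_eq_neq E1 => ->; rewrite mul0r lt_eqF// addr_gt0.
  by rewrite -E1 mulrC mulKf.
exfalso; apply: nc; exists K => //; split; first by split.
by move: t2; rewrite ltr_pdivrMr.
Qed.

Lemma cell_poly_cont K (a : R) : continuous (fun z : R * R => a * (z.1 * (K%:R * z.2 - z.1))).
Proof.
apply: mul_cont; first exact: cst_cont.
apply: mul_cont; first exact: fst_cont.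
apply: sub_cont; last exact: fst_cont.
by apply: mul_cont; [exact: cst_cont|exact: snd_cont].
Qed.

Lemma gap_function2 : gap_function cells gap2.
Proof.
split.
- exact: open_cells.
- exact: cells_sub.
- exact: mu2_cells.
- move=> z [K _ cz]; have [K0 p] := cell_pos cz.
  by rewrite /gap2 (cell_index cz) divr_gt0// ltr0n.
- move=> a; rewrite (_ : _ `&` _ = \bigcup_K (cell K `&`
      [set z | K%:R < a * (z.1 * (K%:R * z.2 - z.1))])).
    apply: bigcup_open => K _; apply: openI; first exact: open_cell.
    by apply: open_lt_fun; [exact: cst_cont|exact: cell_poly_cont].
  apply/seteqP; split => z /=.
    by move=> [[K _ cz] h]; exists K => //; split => //=; rewrite -(cell_gap2 a cz).1.
  by move=> [K _ [cz /= h]]; split; [exists K|rewrite (cell_gap2 a cz).1].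
- move=> a; rewrite (_ : _ `&` _ = \bigcup_K (cell K `&`
      [set z | a * (z.1 * (K%:R * z.2 - z.1)) < K%:R])).
    apply: bigcup_open => K _; apply: openI; first exact: open_cell.
    by apply: open_lt_fun; [exact: cell_poly_cont|exact: cst_cont].
  apply/seteqP; split => z /=.
    by move=> [[K _ cz] h]; exists K => //; split => //=; rewrite -(cell_gap2 a cz).2.1.
  by move=> [K _ [cz /= h]]; split; [exists K|rewrite (cell_gap2 a cz).2.1].
- move=> a; apply: null_of_countable_sections => x.
  (* For fixed x and K, the equation K / (x (K y - x)) = a has this single solution y. *)
  apply: (@countable_sub_range _ (fun K => (K%:R / (a * x) + x) / K%:R)) => y /xsectionP[[K _ cz] /= E].
  exists K; have [K0 p] := cell_pos cz; move: E; rewrite /gap2 (cell_index cz) /= => <-.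
  case: cz => [[[/= /andP[x0 x1] _ _] _] _]; rewrite /= in p.
  have K0' : 0 < K%:R :> R by rewrite ltr0n.
  have q0 : 0 < K%:R * y - x by move: p; rewrite pmulr_rgt0.
  by field; rewrite !gt_eqF.
Qed.

End Instances.

Section Areas.
Variable R : realType.
Notation mu2 := (@lebesgue_measure R \x @lebesgue_measure R)%E.
Local Notation otri := (@open_triangle R).

Let m1 : measurable_fun [set: R * R] (fun z : R * R => z.1) := measurable_fst.
Let m2 : measurable_fun [set: R * R] (fun z : R * R => z.2) := measurable_snd.
Let mc (c : R) : measurable_fun [set: R * R] (fun z : R * R => c) := measurable_cst c.

Lemma measurable_triangle : measurable (@triangle R).
Proof.
rewrite (_ : @triangle R = [set z | 0 < z.1] `&` [set z | z.1 <= 1] `&`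
  ([set z | 0 < z.2] `&` [set z | z.2 <= 1]) `&` [set z | 1 < z.1 + z.2]); last first.
  apply/seteqP; split => z /=.
    by move=> [/andP[a b] /andP[c d] e].
  by move=> [[[a b] [c d]] e]; split => //; apply/andP.
apply: measurableI; last by apply: measurable_lt_set => //; exact: measurable_funD.
apply: measurableI; (apply: measurableI;
  [exact: measurable_lt_set|exact: measurable_le_set]).
Qed.

Lemma mu2_eq_of_countable_sections (A B : set (R * R)) : measurable A -> measurable B ->
  B `<=` A -> (forall x, x != 1 -> countable (xsection (A `\` B) x)) -> mu2 A = mu2 B.
Proof.
move=> mA mB BA cD.
have mD : measurable (A `\` B) by exact: measurableD.
have E : A = B `|` (A `\` B) by rewrite setDUK.
rewrite [in LHS]E measureU//; last by rewrite setDIK.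
by rewrite [X in (_ + X)%E](null_of_countable_sections_off1 mD cD) adde0.
Qed.

Lemma area_hypE (xi : R) : 0 < xi -> area_hyp xi = gap_area otri (@gap1 R) xi.
Proof.
move=> xi0; rewrite /area_hyp /area /gap_area; congr fine.
rewrite -(mu2_gap_le (gap_function1 R)).
apply: mu2_eq_of_countable_sections.
- apply: measurableI; first exact: measurable_triangle.
  by apply: measurable_le_set => //; exact: measurable_funM.
- exact: measurable_gap_le (gap_function1 R) _.
- move=> z [[/andP[x0 x1] /andP[y0 y1] xy] /= h]; split; first by rewrite /triangle/= x0 y0 !ltW.
  have p : 0 < z.1 * z.2 by rewrite mulr_gt0.
  by rewrite -(invrK (z.1 * z.2)) lef_pV2 ?posrE ?invr_gt0.
- move=> x x1; apply: (@countable_sub_range _ _ (fun=> 1)) => y /xsectionP[[/= [/= X Y XY] h] nB].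
  exists 0%N; apply/eqP; apply: contraT => y1; exfalso; apply: nB.
  have /andP[x0 xle] := X; have /andP[y0 yle] := Y.
  split; first by split => //=; rewrite ?x0 ?y0 lt_neqAle ?x1 ?y1.
  have p : 0 < x * y by rewrite mulr_gt0.
  by rewrite /gap1/= -(invrK xi) lef_pV2 ?posrE ?invr_gt0.
Qed.

(** After multiplication by K xi x the inequality becomes K <= xi x (K y - x), that is
    [gap2 z <= xi]. The two sets differ only on the sides x = 1 and y = 1 and on the line K y = 1 +
    x. *)
Lemma area_KE (K : nat) (xi : R) : (0 < K)%N -> 0 < xi ->
  mu2 [set z | triangle_floor K z /\ z.1 / K%:R + (xi * z.1)^-1 <= z.2] =
  mu2 (cell K `&` [set z | @gap2 R z <= xi]).
Proof.
move=> K0 xi0; have K0' : 0 < K%:R :> R by rewrite ltr0n.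
have tfE z : triangle_floor K z <->
    triangle z /\ (K%:R * z.2 <= 1 + z.1 :> R) /\ (1 + z.1 < K.+1%:R * z.2).
  rewrite /triangle_floor/=; split.
    move=> [tz fl]; split => //; case: tz => _ /andP[y0 _] _.
    have := floor_itv ((1 + z.1) / z.2); rewrite fl.
    rewrite (_ : (K%:Z + 1)%:~R = K.+1%:R :> R); last by rewrite -[K.+1]addn1 natrD intrD.
    by rewrite -pmulrn ler_pdivlMr// ltr_pdivrMr// => /andP[].
  move=> [tz [h1 h2]]; split => //; case: tz => _ /andP[y0 _] _.
  apply: (@Num.Theory.floor_def _ _ K%:Z); apply/andP; split.
    by rewrite -pmulrn ler_pdivlMr.
  rewrite (_ : (K%:Z + 1)%:~R = K.+1%:R :> R); last by rewrite -[K.+1]addn1 natrD intrD.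
  by rewrite ltr_pdivrMr.
have condE (z : R * R) : 0 < z.1 -> (z.1 / K%:R + (xi * z.1)^-1 <= z.2) =
    (K%:R <= xi * (z.1 * (K%:R * z.2 - z.1))).
  move=> x0; have p : 0 < K%:R * xi * z.1 by rewrite !mulr_gt0.
  rewrite -(ler_pM2l p) -subr_ge0 -[RHS]subr_ge0; congr (0 <= _).
  by field; rewrite !gt_eqF.
apply: mu2_eq_of_countable_sections.
- rewrite (_ : [set z | _] = @triangle R `&` ([set z | K%:R * z.2 <= 1 + z.1] `&`
     [set z | 1 + z.1 < K.+1%:R * z.2]) `&` [set z | K%:R <= xi * (z.1 * (K%:R * z.2 - z.1))]).
    apply: measurableI; last first.
      apply: measurable_le_set => //; apply: measurable_funM => //; apply: measurable_funM => //.
      by apply: measurable_funB => //; exact: measurable_funM.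
    apply: measurableI; first exact: measurable_triangle.
    apply: measurableI.
      by apply: measurable_le_set; [exact: measurable_funM|exact: measurable_funD].
    by apply: measurable_lt_set; [exact: measurable_funD|exact: measurable_funM].
  apply/seteqP; split => z /=.
    by move=> [/tfE[tz [h1 h2]] h]; case: (tz) => /andP[x0 _] _ _; rewrite condE// in h.
  move=> [[tz [h1 h2]] h]; case: (tz) => /andP[x0 _] _ _.
  by split; [apply/tfE|rewrite condE].
- rewrite (_ : _ `&` _ = cell K `&` (@cells R `&` [set z | gap2 z <= xi])).
    apply: measurableI; last exact: measurable_gap_le (gap_function2 R) _.
    apply: measurable_open_in_square; first exact: open_cell.
    by move=> z [[/in_triangle_open_triangle[]]].
  by apply/seteqP; split => z [cz] => [h|[_ h]]; split => //; split => //; exists K.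
- move=> z [cz /= h]; have := h; rewrite (cell_gap2 xi cz).2.2 => h'.
  case: cz => [[[/andP[x0 x1] /andP[y0 y1] xy] /= h1] /= h2].
  split; last by rewrite condE.
  by apply/tfE; split; [rewrite /triangle/= x0 y0 !ltW|rewrite ltW].
- move=> x x1.
  apply: (@countable_sub_range _ _ (fun n => if n is 0%N then 1 else (1 + x) / K%:R)).
  move=> y /xsectionP[[/tfE[[/= X Y XY] [/= h1 h2]] h] nB].
  have /andP[x0 xle] := X; have /andP[y0 yle] := Y.
  have [y1|y1] := eqVneq y 1; first by exists 0%N.
  exists 1%N; move: h1; rewrite le_eqVlt => /orP[/eqP <-|h1].
    by rewrite mulrAC divff ?mul1r ?gt_eqF.
  exfalso; apply: nB.
  have cz : cell K (x, y).
    by split => //; split => //; split => //=; rewrite ?x0 ?y0 lt_neqAle ?x1 ?y1.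
  by split => //=; rewrite (cell_gap2 xi cz).2.2 -condE.
Qed.

Lemma cell_disjoint K K' z : cell K z -> @cell R K' z -> K = K'.
Proof.
move=> /cell_index E /cell_index E'; apply/eqP; rewrite -(eqr_nat R).
by rewrite -E -E'.
Qed.

(** On [cell K] both x and K y - x are less than 1, so [gap2] is at least K; hence only the K <= xi
    contribute. *)
Lemma sum_area_KE (xi : R) : 0 < xi ->
  \sum_(1 <= K < (Num.truncn xi).+1) area_K K xi = gap_area (@cells R) (@gap2 R) xi.
Proof.
move=> xi0; pose B K := cell K `&` [set z | @gap2 R z <= xi].
have mB K : measurable (B K).
  rewrite (_ : B K = cell K `&` (@cells R `&` [set z | gap2 z <= xi])).
    apply: measurableI; last exact: measurable_gap_le (gap_function2 R) _.
    apply: measurable_open_in_square; first exact: open_cell.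
    by move=> z [[/in_triangle_open_triangle[]]].
  by apply/seteqP; split => z [cz] => [h|[_ h]]; split => //; split => //; exists K.
have Bcells K : B K `<=` @cells R by move=> z [cz _]; exists K.
have Bfin K : mu2 (B K) \is a fin_num by apply: (mu2_gap_fin (gap_function2 R)).
pose n := (Num.truncn xi).+1.
have E : @cells R `&` [set z | gap2 z <= xi] = \big[setU/set0]_(K < n) B K.
  rewrite -bigcup_mkord; apply/seteqP; split => z /=.
    move=> [[K _ cz] h]; exists K => //=; rewrite /n ltnS -(ler_nat R).
    have /andP[_ t2] := truncn_itv (ltW xi0).
    have [K0 p] := cell_pos cz; have := h; rewrite (cell_gap2 xi cz).2.2 => h'.
    have Kxi : K%:R <= xi.
      apply: (le_trans h'); rewrite ler_piMr ?(ltW xi0)//.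
      case: (cz) => [[[/andP[x0 x1] /andP[y0 y1] xy] /= h1] /= h2].
      by rewrite mulr_ile1 ?(ltW x0) ?(ltW x1)//; [move: p; rewrite pmulr_rgt0// => /ltW|lra].
    rewrite ler_nat -ltnS -(ltr_nat R); exact: le_lt_trans Kxi t2.
  by move=> [K _ [cz h]]; split => //; exists K.
have tB : trivIset `I_n B.
  by move=> i j _ _ [z [[ci _] [cj _]]]; exact: cell_disjoint ci cj.
have M : mu2 (\big[setU/set0]_(K < n) B K) = (\sum_(K < n) mu2 (B K))%E.
  apply: measure_semi_additive_ord_I => [K _|//|]; first exact: mB.
  by apply: bigsetU_measurable => K _; exact: mB.
have F : (\sum_(K < n) mu2 (B K))%E = (\sum_(K < n) fine (mu2 (B K)))%:E.
  by rewrite -sumEFin; apply: eq_bigr => K _; rewrite fineK.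
have : (gap_area (@cells R) (@gap2 R) xi)%:E = (\sum_(K < n) fine (mu2 (B K)))%:E.
  by rewrite -(gap_areaE (gap_function2 R)) E M F.
move=> [->].
rewrite -(big_mkord predT (fun K => fine (mu2 (B K)))) [RHS]big_ltn//.
rewrite [X in X + _](_ : _ = 0) ?add0r.
  apply: eq_big_nat => K /andP[K0 _]; rewrite /area_K /area; congr fine.
  exact: area_KE.
rewrite (_ : B 0%N = set0) ?measure0//.
by apply/seteqP; split => // z [/cell_pos[]].
Qed.

End Areas.

(** * Convergence of distribution functions and weak convergence *)

Section WeakConvergence.
Variable R : realType.
Local Notation half_line := (`[0, +oo[%classic : set (measurableTypeR R)).

Let cdf (mu : {measure set (measurableTypeR R) -> \bar R}) (a : R) : R :=
  fine (mu `[0, a]%classic).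
Let int (mu : {measure set (measurableTypeR R) -> \bar R}) (f : R -> R) (a : R) : R :=
  (\int[mu]_(x in `[0, a]) f x)%R.

Section OneMeasure.
Variable mu : {measure set (measurableTypeR R) -> \bar R}.
Hypothesis mu1 : mu half_line = 1%E.
Variable f : R -> R.
Hypothesis fc : {within `[0, +oo[, continuous f}.
Hypothesis fb : [bounded f x | x in `[0, +oo[].

Lemma half_line_finite (S : set (measurableTypeR R)) : measurable S -> S `<=` half_line ->
  mu S \is a fin_num.
Proof.
move=> mS SX; rewrite fin_num_abs gee0_abs//.
have h : (mu S <= mu half_line)%E.
  by apply: le_measure => //; rewrite inE.
by apply: le_lt_trans h _; rewrite mu1 ltry.
Qed.

Lemma half_line_integrable (S : set (measurableTypeR R)) : measurable S -> S `<=` half_line ->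
  mu.-integrable S (EFin \o f).
Proof.
move=> mS SX; apply: (@integrableS _ _ _ _ half_line) => //.
apply: measurable_bounded_integrable => //.
- by rewrite [ltLHS]mu1 ltry.
- by apply: subspace_continuous_measurable_fun => //.
Qed.

Lemma Rintegral_near_constant (S : set (measurableTypeR R)) (c e : R) : measurable S -> S `<=` half_line ->
  (forall x, S x -> `|f x - c| <= e) ->
  `|(\int[mu]_(x in S) f x)%R - c * fine (mu S)| <= e * fine (mu S).
Proof.
move=> mS SX fe; have fS := half_line_integrable mS SX.
have cI r : mu.-integrable S (EFin \o (fun=> r : R)).
  apply: measurable_bounded_integrable => //.
    by rewrite ltey_eq half_line_finite.
  by exists `|r|; split => // M rM x _; exact: ltW.
have h r : \int[mu]_(x in S) r = r * fine (mu S).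
  exact: Rintegral_cst.
rewrite -!h -RintegralB//.
have dI : mu.-integrable S (EFin \o (fun x => f x - c)).
  exact: (integrableB mS fS (cI c)).
apply: le_trans (le_normr_Rintegral mS dI) _.
apply: le_Rintegral => //.
exact: (integrable_norm dI).
Qed.

Lemma half_line_split (a : R) (b : itv_bound R) : 0 <= a ->
  (BRight a <= b)%O ->
  [/\ (\int[mu]_(x in [set` Interval (BLeft 0) b]) f x =
        int mu f a + \int[mu]_(x in [set` Interval (BRight a) b]) f x)%R,
      fine (mu [set` Interval (BLeft 0) b]) =
        cdf mu a + fine (mu [set` Interval (BRight a) b]) &
      [set` Interval (BRight a) b] `<=` half_line].
Proof.
move=> a0 ab.
have sub : [set` Interval (BRight a) b] `<=` half_line.
  move=> x /=; rewrite !itv_boundlr => /andP[h _]; apply/andP; split => //=.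
  by apply: le_trans h; rewrite bnd_simp.
have sub0 : [set` Interval (BLeft 0) b] `<=` half_line.
  by move=> x /=; rewrite !itv_boundlr => /andP[-> _].
have E : [set` Interval (BLeft 0) b] = `[0, a]%classic `|` [set` Interval (BRight a) b] :> set R.
  by apply: itv_bndbnd_setU; rewrite // bnd_simp.
have dis : `[0, a]%classic `&` [set` Interval (BRight a) b] = set0.
  rewrite -subset0 => x [] /=; rewrite in_itv/= => /andP[_ xa].
  rewrite itv_boundlr => /andP[h _]; move: h; rewrite bnd_simp ltNge xa//.
have sa : `[0, a]%classic `<=` half_line.
by move=> x /=; rewrite !in_itv/= andbT => /andP[].
split => //.
- rewrite /int E Rintegral_setU//.
  + by rewrite -E; apply: half_line_integrable.
  + by apply/disj_setPS; rewrite dis.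
- rewrite /cdf E measureU//; apply: fineD; apply: half_line_finite => //;
  exact: measurable_itv.
Qed.

Lemma Rintegral_extend a b c e : 0 <= a <= b ->
  (forall x, a < x <= b -> `|f x - c| <= e) ->
  `|int mu f b - int mu f a - c * (cdf mu b - cdf mu a)| <= e * (cdf mu b - cdf mu a).
Proof.
move=> /andP[a0 ab] fe.
have [] := @half_line_split a (BRight b) a0 _; first by rewrite bnd_simp.
move=> hi hc sub.
have -> : int mu f b = int mu f a + \int[mu]_(x in `]a, b]) f x by exact: hi.
have -> : cdf mu b = cdf mu a + fine (mu `]a, b]%classic) by exact: hc.
rewrite ![int mu f a + _]addrC ![cdf mu a + _]addrC !addrK.
by apply: Rintegral_near_constant => // x /=; rewrite in_itv/=; exact: fe.
Qed.

Lemma Rintegral_start b c e : 0 <= b -> (forall x, 0 <= x <= b -> `|f x - c| <= e) ->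
  `|int mu f b - c * cdf mu b| <= e * cdf mu b.
Proof.
move=> b0 fe; apply: Rintegral_near_constant => //.
by move=> x /=; rewrite !in_itv/= andbT => /andP[].
Qed.

Lemma Rintegral_tail a B : 0 <= a -> (forall x, 0 <= x -> `|f x| <= B) ->
  `|(\int[mu]_(x in `[0%R, +oo[) f x)%R - int mu f a| <= B * (1 - cdf mu a).
Proof.
move=> a0 fB; have [//|hi hc sub] := @half_line_split a (BInfty _ false) a0.
have -> : 1 = fine (mu half_line) by rewrite mu1.
rewrite hi hc [int mu f a + _]addrC [cdf mu a + _]addrC !addrK -[X in `|X|]subr0.
have := @Rintegral_near_constant _ 0 B _ sub; rewrite mul0r; apply => //.
by move=> x /sub/=; rewrite in_itv/= andbT subr0; exact: fB.
Qed.

End OneMeasure.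
Lemma bounded_on_half_line (f : R -> R) : [bounded f x | x in `[0, +oo[] ->
  exists2 B, 0 < B & forall x, 0 <= x -> `|f x| <= B.
Proof.
move=> [M [_ hM]]; exists (Num.max 1 (M + 1)); first by rewrite lt_max ltr01.
by move=> x x0; apply: hM => /=; rewrite ?lt_max ?ltrDl ?ltr01 ?orbT// in_itv/= x0.
Qed.

Section Convergence.
Variables (mu_ : nat -> {measure set (measurableTypeR R) -> \bar R}).
Variable nu : {measure set (measurableTypeR R) -> \bar R}.
Hypothesis mu1 : \forall n \near \oo, mu_ n half_line = 1%E.
Hypothesis nu1 : nu half_line = 1%E.
Hypothesis cdf_cvg : forall a, 0 < a ->
  mu_ n `[0, a]%classic @[n --> \oo] --> nu `[0, a]%classic.

Lemma segment_half_line (a : R) : `[0, a]%classic `<=` half_line.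
Proof. by move=> x /=; rewrite !in_itv/= andbT => /andP[]. Qed.

Let fine_cdf_cvg a : 0 < a -> cdf (mu_ n) a @[n --> \oo] --> cdf nu a.
Proof.
move=> a0; apply: fine_cvg; rewrite /cdf fineK; first exact: cdf_cvg.
by apply: half_line_finite => //; exact: segment_half_line.
Qed.

Lemma cdf_gt1B e : 0 < e -> exists2 M, 0 < M & 1 - e < cdf nu M.
Proof.
move=> e0.
have F : nu `[0, n.+1%:R]%classic @[n --> \oo] --> nu (\bigcup_n `[0, n.+1%:R]%classic).
  apply: nondecreasing_cvg_mu => //.
    by apply: bigcup_measurable => n _; exact: measurable_itv.
  move=> m n mn; apply/subsetPset => x /=; rewrite !in_itv/= => /andP[-> h].
  by apply: le_trans h _; rewrite ler_nat ltnS.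
have E : \bigcup_n `[0, n.+1%:R]%classic = half_line.
  apply/seteqP; split => x.
    by move=> [n _]; exact: segment_half_line.
  rewrite /= in_itv/= andbT => x0; exists (Num.truncn x) => //=.
  rewrite in_itv/= x0 /=; apply: ltW; exact: truncnS_gt.
have G : cdf nu n.+1%:R @[n --> \oo] --> (1 : R).
  by apply: fine_cvg; rewrite -nu1 -E.
have [N _ hN] := (cvgrPdist_lt _ _).1 G e e0.
exists N.+1%:R => //; have := hN N (leqnn N); rewrite /= ltr_norml => /andP[_]; lra.
Qed.

Variable f : R -> R.
Hypothesis fc : {within `[0, +oo[, continuous f}.
Hypothesis fb : [bounded f x | x in `[0, +oo[].

(** The error allowed on [0, a] is e per unit of mass, which is additive under concatenation of
    intervals, plus an arbitrarily small t for the convergence at the endpoints. *)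
Let close e a := forall t, 0 < t -> \forall n \near \oo,
  `|int (mu_ n) f a - int nu f a| <= e * (cdf (mu_ n) a + cdf nu a) + t.

Let close_start b c e : 0 < b -> (forall x, 0 <= x <= b -> `|f x - c| <= e) -> close e b.
Proof.
move=> b0 fe t t0.
have c0 : 0 < `|c| + 1 by rewrite ltr_wpDl.
have tc0 : 0 < t / (`|c| + 1) by rewrite divr_gt0.
near=> n.
have m1 : mu_ n half_line = 1%E by near: n.
have h1 := Rintegral_start m1 fc fb (ltW b0) fe.
have h2 := Rintegral_start nu1 fc fb (ltW b0) fe.
have h3 : `|cdf nu b - cdf (mu_ n) b| <= t / (`|c| + 1).
  by near: n; apply: (cvgrPdist_le _ _).1 (fine_cdf_cvg b0) _ tc0.
have h4 : `|c * (cdf nu b - cdf (mu_ n) b)| <= t.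
  rewrite normrM (le_trans (ler_wpM2l (normr_ge0 _) h3))// mulrA ler_pdivrMr//.
  by rewrite [leLHS]mulrC ler_pM2l// lerDl.
move: h1 h2 h4; rewrite /cdf /int !ler_norml => /andP[h1 h1'] /andP[h2 h2'] /andP[h4 h4'].
apply/andP; split; lra.
Unshelve. all: by end_near. Qed.

Let close_extend a b c e : 0 < a <= b -> close e a ->
  (forall x, a < x <= b -> `|f x - c| <= e) -> close e b.
Proof.
move=> /andP[a0 ab] ca fe t t0.
have ab' : 0 <= a <= b by rewrite ltW.
have b0 : 0 < b by exact: lt_le_trans ab.
(* The half of [t] not spent on [0, a] is shared between the endpoints a and b, each costing |c|
   times the error of a distribution function. *)
have c0 : 0 < 4 * (`|c| + 1) by rewrite mulr_gt0// ltr_wpDl.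
have tc0 : 0 < t / (4 * (`|c| + 1)) by rewrite divr_gt0.
have t2 : 0 < t / 2 by rewrite divr_gt0.
near=> n.
have m1 : mu_ n half_line = 1%E by near: n.
have h0 : `|int (mu_ n) f a - int nu f a| <= e * (cdf (mu_ n) a + cdf nu a) + t / 2.
  by near: n; exact: ca.
have h1 := Rintegral_extend m1 fc fb ab' fe.
have h2 := Rintegral_extend nu1 fc fb ab' fe.
have h3 x : 0 < x -> `|cdf nu x - cdf (mu_ n) x| <= t / (4 * (`|c| + 1)) ->
    `|c * (cdf nu x - cdf (mu_ n) x)| <= t / 4.
  move=> x0 h3.
  rewrite normrM (le_trans (ler_wpM2l (normr_ge0 _) h3))// mulrA ler_pdivrMr//.
  have -> : t / 4 * (4 * (`|c| + 1)) = t * (`|c| + 1) by field.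
  by rewrite [leLHS]mulrC ler_pM2l// lerDl.
have h4 : `|cdf nu a - cdf (mu_ n) a| <= t / (4 * (`|c| + 1)).
  by near: n; apply: (cvgrPdist_le _ _).1 (fine_cdf_cvg a0) _ tc0.
have h5 : `|cdf nu b - cdf (mu_ n) b| <= t / (4 * (`|c| + 1)).
  by near: n; apply: (cvgrPdist_le _ _).1 (fine_cdf_cvg b0) _ tc0.
move: h0 h1 h2 (h3 _ a0 h4) (h3 _ b0 h5); rewrite -/(int _ _ _) !ler_norml.
move=> /andP[h0 h0'] /andP[h1 h1'] /andP[h2 h2'] /andP[h6 h6'] /andP[h7 h7'].
apply/andP; split; lra.
Unshelve. all: by end_near. Qed.

Lemma half_line_continuity s e : 0 <= s -> 0 < e -> exists2 d, 0 < d &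
  forall x, 0 <= x -> `|x - s| < d -> `|f x - f s| <= e.
Proof.
move=> s0 e0; have := fc; rewrite subspace_continuousP => /(_ s).
rewrite /= in_itv/= andbT => /(_ s0) /(cvgrPdist_le _ _).1 /(_ e e0).
rewrite near_withinE => -[d /= d0 hd]; exists d => // x x0 xs.
by rewrite distrC; apply: hd; rewrite /= ?in_itv/= ?x0// distrC.
Qed.

(** Continuous induction: near the supremum s of the admissible points f is within e of f(s), so
    admissibility passes from a point just left of s to min(s + r/2, M). Hence M is reached, with no
    uniform partition. *)
Let close_all e M : 0 < e -> 0 < M -> close e M.
Proof.
move=> e0 M0; pose S := [set a | 0 < a <= M /\ close e a].
have [d d0 hd] := half_line_continuity (lexx 0) e0.
(* The starting point is positive because convergence of the distribution functions is only assumed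
   there. *)
have m0 : 0 < Num.min (d / 2) M by rewrite lt_min M0 divr_gt0.
have S0 : S (Num.min (d / 2) M).
  split; first by rewrite m0 ge_min lexx orbT.
  apply: (@close_start _ (f 0)) => // x /andP[x0 xd]; apply: hd => //.
  by rewrite subr0 ger0_norm//; move: xd; rewrite le_min => /andP[xd _]; lra.
have Sup : has_sup S.
  by split; [exists (Num.min (d / 2) M)|exists M => a [/andP[_ ]]].
have sS : 0 < sup S by apply: lt_le_trans m0 _; exact: ub_le_sup Sup.2 _ S0.
have [r r0 hr] := half_line_continuity (ltW sS) e0.
have [a [/andP[a0 aM] ca] ra] := sup_adherent r0 Sup.
have as_ : a <= sup S by apply: ub_le_sup Sup.2 _ _; split => //; rewrite a0.
have ab : a <= Num.min (sup S + r / 2) M by rewrite le_min aM andbT; lra.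
have cb : close e (Num.min (sup S + r / 2) M).
  apply: (@close_extend a _ (f (sup S))) => //; first by rewrite a0.
  move=> x /andP[ax]; rewrite le_min => /andP[xs xM]; apply: hr; first by lra.
  by rewrite ltr_norml; apply/andP; split; lra.
have bs : Num.min (sup S + r / 2) M <= sup S.
  apply: ub_le_sup Sup.2 _ _; split => //.
  by rewrite (lt_le_trans a0 ab) ge_min lexx orbT.
move: bs cb; rewrite ge_min => /orP[|Ms cb]; first by lra.
by move: cb; rewrite min_r//; lra.
Qed.

Lemma cdf_le1 (mu : {measure set (measurableTypeR R) -> \bar R}) a :
  mu half_line = 1%E -> cdf mu a <= 1.
Proof.
move=> m1; have -> : 1 = fine (mu half_line) by rewrite m1.
have sa := @segment_half_line a.
apply: fine_le; [exact: half_line_finite|exact: half_line_finite|].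
by apply: le_measure => //; rewrite inE.
Qed.

Lemma cvg_Rintegral_half_line :
  (\int[mu_ n]_(x in `[0%R, +oo[) f x)%R @[n --> \oo] -->
  (\int[nu]_(x in `[0%R, +oo[) f x)%R.
Proof.
have [B B0 hB] := bounded_on_half_line fb.
apply: (cvgrPdist_le _ _).2 => e e0.
(* The tail of [nu] then costs e/8, that of [mu_ n] e/4, and the segment [0, M] 3e/8. *)
have eB : 0 < e / (8 * B) by rewrite divr_gt0// mulr_gt0.
have [M M0 hM] := cdf_gt1B eB.
have e8 : 0 < e / 8 by rewrite divr_gt0.
have M0' := ltW M0.
have BB : B * (e / (8 * B)) = e / 8 by field; rewrite gt_eqF.
near=> n.
have m1 : mu_ n half_line = 1%E by near: n.
have h0 : `|int (mu_ n) f M - int nu f M| <= e / 8 * (cdf (mu_ n) M + cdf nu M) + e / 8.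
  by near: n; exact: close_all.
have h1 := Rintegral_tail m1 fc fb M0' hB.
have h2 := Rintegral_tail nu1 fc fb M0' hB.
have h3 : `|cdf nu M - cdf (mu_ n) M| <= e / (8 * B).
  by near: n; apply: (cvgrPdist_le _ _).1 (fine_cdf_cvg M0) _ eB.
have h4 := cdf_le1 M m1.
have h5 := cdf_le1 M nu1.
have h6 : B * (1 - cdf nu M) <= e / 8 by rewrite -BB ler_pM2l//; lra.
have h7 : B * (cdf nu M - cdf (mu_ n) M) <= e / 8.
  by rewrite -BB ler_pM2l//; move: h3; rewrite ler_norml => /andP[].
have h8 : e / 8 * (cdf (mu_ n) M + cdf nu M) <= e / 8 * 2 by rewrite ler_pM2l//; lra.
move: h0 h1 h2; rewrite /cdf /int in h3 h4 h5 h6 h7 h8 *; rewrite !ler_norml.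
move=> /andP[h0 h0'] /andP[h1 h1'] /andP[h2 h2'].
apply/andP; split; lra.
Unshelve. all: by end_near. Qed.

End Convergence.

Lemma cdf_cvg_weak (mu_ : nat -> {measure set (measurableTypeR R) -> \bar R})
    (nu : {measure set (measurableTypeR R) -> \bar R}) :
  (\forall n \near \oo, mu_ n half_line = 1%E) -> nu half_line = 1%E ->
  (forall a, 0 < a -> mu_ n `[0, a]%classic @[n --> \oo] --> nu `[0, a]%classic) ->
  weak_cvg_nneg mu_ nu.
Proof.
move=> mu1 nu1 h f fc fb.
have fin (mu : {measure set (measurableTypeR R) -> \bar R}) : mu half_line = 1%E ->
    (\int[mu]_(x in `[0%R, +oo[) (f x)%:E)%E =
    (\int[mu]_(x in `[0%R, +oo[) f x)%R%:E.
  move=> m1; rewrite /Rintegral fineK//; apply: integrable_fin_num => //.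
  exact: half_line_integrable.
rewrite (fin _ nu1).
apply: cvg_EFin; last exact: cvg_Rintegral_half_line.
by near=> n; rewrite fin//; near: n; exact: mu1.
Unshelve. all: by end_near. Qed.

End WeakConvergence.

(** * The measure with a given distribution function *)

Section DistributionOnHalfLine.
Variables (R : realType) (F : R -> R).
Hypotheses (F_nd : {homo F : x y / x <= y}) (F_cont : continuous F).
Hypotheses (F0 : forall x, x <= 0 -> F x = 0) (F1 : F x @[x --> +oo] --> (1 : R)).

Let F_rc : right_continuous F := right_continuousW F_cont.

#[local] HB.instance Definition _ := isCumulative.Build R _ R F F_nd F_rc.

Let FNy : F x @[x --> -oo] --> (0 : R).
Proof.
apply: cvg_near_cst; near=> x; rewrite F0//; near: x; exact: nbhs_ninfty_le.
Unshelve. all: by end_near. Qed.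

#[local] HB.instance Definition _ := isCumulativeBounded.Build R 0 1 F FNy F1.

Let nu : probability (measurableTypeR R) R := lebesgue_stieltjes_measure F.

Let nu_oc (a b : R) : a <= b -> nu `]a, b]%classic = (F b - F a)%:E.
Proof.
move=> ab; transitivity (lebesgue_stieltjes_measure F `]a, b]%classic) => //.
rewrite /lebesgue_stieltjes_measure /measure_extension/=.
by rewrite measurable_mu_extE/= ?wlength_itv_bnd//; exact: is_ocitv.
Qed.

(** [F] vanishes up to 0, so not even the point 0 carries mass; this passes from half-open intervals
    to [0, xi]. *)
Let nu_negative (a : R) : nu `]a, 0[%classic = 0%E.
Proof.
have [a0|a0] := leP a 0; last by rewrite set_itv_ge ?measure0// bnd_simp -leNgt ltW.
apply/eqP; rewrite eq_le measure_ge0 andbT.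
have <- : nu `]a, 0]%classic = 0%E by rewrite nu_oc// !F0 ?subrr.
apply: le_measure; rewrite ?inE//.
by move=> x /=; rewrite !in_itv/= => /andP[-> /ltW].
Qed.

Let nu_segment (xi : R) : 0 <= xi -> nu `[0, xi]%classic = (F xi)%:E.
Proof.
move=> x0.
have E : `]-1, xi]%classic = `]-1, 0[%classic `|` `[0, xi]%classic :> set R.
  by apply: itv_bndbnd_setU; rewrite bnd_simp//; lra.
have <- : nu `]-1, xi]%classic = (F xi)%:E.
  by rewrite nu_oc ?(F0 (x := -1)); [congr EFin; lra|lra|lra].
 rewrite E measureU//; last first.
  rewrite -subset0 => x [] /=; rewrite !in_itv/= => /andP[_ h] /andP[h' _]; lra.
by rewrite [X in (X + _)%E](nu_negative (-1)) add0e.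
Qed.

Lemma distribution_on_half_line : exists P : probability (measurableTypeR R) R,
  P `[0, +oo[%classic = 1%E /\ forall xi, 0 <= xi -> P `[0, xi]%classic = (F xi)%:E.
Proof.
exists nu; split; last exact: nu_segment.
apply/eqP; rewrite eq_le probability_le1//=.
have h : (F n%:R)%:E @[n --> \oo] --> (1%:E : \bar R).
  by apply: cvg_EFin; [exact: nearW|exact/(cvg_comp _ _ (@cvgr_idn R))].
rewrite -(cvg_lim _ h)//; apply: lime_le; first by apply/cvg_ex; exists 1%:E.
apply: nearW => n; rewrite -nu_segment//.
apply: le_measure; rewrite ?inE//.
by move=> x /=; rewrite !in_itv/= andbT => /andP[].
Qed.

End DistributionOnHalfLine.

Section MonotoneLimits.
Variable R : realType.

(** The value at the moving point is squeezed between the values at t - d/2 and t + d/2, where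
    pointwise convergence applies; continuity of [H] closes the squeeze. *)
Lemma cvg_nondecreasing_diagonal (x : nat -> R -> R) (H : R -> R) (tau : nat -> R) t :
  (\forall n \near \oo, {homo x n : a b / a <= b}) ->
  (forall a, x n a @[n --> \oo] --> H a) -> {for t, continuous H} ->
  tau n @[n --> \oo] --> t -> x n (tau n) @[n --> \oo] --> H t.
Proof.
move=> xnd xH Hc tt; apply: (cvgrPdist_le _ _).2 => e e0.
have e2 : 0 < e / 2 by rewrite divr_gt0.
have [d /= d0 hd] := (cvgrPdist_le _ _).1 Hc _ e2.
have hd' a : `|a - t| < d -> `|H t - H a| <= e / 2.
  by move=> h; apply: hd; rewrite /ball_ /= distrC.
have d2 : 0 < d / 2 by rewrite divr_gt0.
have h1 : `|H t - H (t - d / 2)| <= e / 2.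
  by apply: hd'; rewrite ltr_norml; apply/andP; split; lra.
have h2 : `|H t - H (t + d / 2)| <= e / 2.
  by apply: hd'; rewrite ltr_norml; apply/andP; split; lra.
near=> n.
have nd : {homo x n : a b / a <= b} by near: n; exact: xnd.
have h3 : `|H (t - d / 2) - x n (t - d / 2)| <= e / 2.
  by near: n; apply: (cvgrPdist_le _ _).1 (xH _) _ e2.
have h4 : `|H (t + d / 2) - x n (t + d / 2)| <= e / 2.
  by near: n; apply: (cvgrPdist_le _ _).1 (xH _) _ e2.
have : `|t - tau n| <= d / 2 by near: n; apply: (cvgrPdist_le _ _).1 tt _ d2.
rewrite ler_norml => /andP[h5 h5'].
have h6 : x n (t - d / 2) <= x n (tau n) by apply: nd; lra.
have h7 : x n (tau n) <= x n (t + d / 2) by apply: nd; lra.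
move: h1 h2 h3 h4; rewrite !ler_norml => /andP[? ?] /andP[? ?] /andP[? ?] /andP[? ?].
apply/andP; split; lra.
Unshelve. all: by end_near. Qed.

Lemma nbhs_le_dist (a r : R) : 0 < r -> \forall x \near a, `|a - x| <= r.
Proof. by move=> r0; exists r => //= x /ltW. Qed.

Section NondecreasingFunction.
Variable G : R -> R.
Hypothesis G_nd : {homo G : x y / x <= y}.

Lemma nondecreasing_continuous a : G (a + n.+1%:R^-1) @[n --> \oo] --> G a ->
  G (a - n.+1%:R^-1) @[n --> \oo] --> G a -> {for a, continuous G}.
Proof.
move=> Gr Gl; apply: (cvgrPdist_le _ _).2 => e e0.
have [N _ hN] := (cvgrPdist_le _ _).1 Gr e e0.
have [M _ hM] := (cvgrPdist_le _ _).1 Gl e e0.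
have := hN N (leqnn N); have := hM M (leqnn M) => /=.
rewrite !ler_norml => /andP[h1 h2] /andP[h3 h4].
near=> x; rewrite ler_norml.
have xN : G x <= G (a + N.+1%:R^-1).
  apply: G_nd; rewrite -lerBlDl; apply: le_trans (ler_norm _) _.
  by rewrite distrC; near: x; apply: nbhs_le_dist; rewrite invr_gt0.
have xM : G (a - M.+1%:R^-1) <= G x.
  apply: G_nd; rewrite lerBlDr -lerBlDl; apply: le_trans (ler_norm _) _.
  by near: x; apply: nbhs_le_dist; rewrite invr_gt0.
by rewrite lerBlDr -lerBlDl lerBrDl (le_trans _ xM)//=; lra.
Unshelve. all: by end_near. Qed.

Lemma nondecreasing_cvgy c : (forall x, G x <= c) ->
  G n%:R @[n --> \oo] --> c -> G x @[x --> +oo] --> c.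
Proof.
move=> Gc Gn; apply: (cvgrPdist_le _ _).2 => e e0.
have [N _ hN] := (cvgrPdist_le _ _).1 Gn e e0.
have := hN N (leqnn N); rewrite /= ler_norml => /andP[h1 h2].
near=> x.
have xN : G N%:R <= G x by apply: G_nd; near: x; exact: nbhs_pinfty_ge.
by rewrite ger0_norm ?subr_ge0//; lra.
Unshelve. all: by end_near. Qed.

End NondecreasingFunction.

Variables (O : set (R * R)) (g : R * R -> R).
Hypothesis gO : gap_function O g.

Lemma gap_area_continuous : continuous (gap_area O g).
Proof.
move=> a; apply: nondecreasing_continuous.
- by move=> x y; exact: (gap_area_le gO).
- exact: (@cvg_gap_area_right _ _ _ gO a).
- exact: (@cvg_gap_area_left _ _ _ gO a).
Qed.

Lemma cvgy_gap_area : gap_area O g x @[x --> +oo] --> (2^-1 : R).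
Proof.
apply: nondecreasing_cvgy (cvg_gap_area_infty gO) => [x y|x].
  exact: (gap_area_le gO).
rewrite -(gap_area_split gO x) lerDl.
by rewrite fine_ge0// measure_ge0.
Qed.

End MonotoneLimits.

(** * The limiting gap distribution *)

Section LimitingDistribution.
Variables (R : realType) (l : nat).
Hypothesis l2 : (1 < l)%N.

Local Notation K := (K_const R l).
Local Notation kappa := (C_const R l / l%:R).
Local Notation alpha := ((zeta R 2)^-1 - 2 * kappa).

Let l0 : (0 < l)%N. Proof. exact: ltnW. Qed.

Lemma C_const1 : C_const R 1 = (zeta R 2)^-1.
Proof. by rewrite /C_const big_nil mulr1. Qed.

Lemma C_const_le : C_const R l <= (zeta R 2)^-1.
Proof.
rewrite /C_const ler_piMr ?invr_ge0 ?(ltW (zeta2_gt0 R))//.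
have : 0 <= \prod_(p <- primes l) (1 + p%:R^-1 : R)^-1 <= 1.
  elim/big_rec: _ => [|p x _ /andP[x0 x1]]; first by rewrite ler01 lexx.
  have p0 : 0 <= (1 + p%:R^-1 : R)^-1 by rewrite invr_ge0 addr_ge0// invr_ge0.
  rewrite mulr_ge0//= mulr_ile1// invf_le1 ?ltr_wpDr ?invr_ge0//.
  by rewrite lerDl invr_ge0.
by case/andP.
Qed.

(** Here l >= 2 enters: it makes [alpha] nonnegative, so that [limit_cdf] is nondecreasing. *)
Lemma C_const_ratio_le : kappa <= (zeta R 2)^-1 / 2.
Proof.
apply: ler_pM; rewrite ?C_const_ge0 ?invr_ge0 ?C_const_le//.
by rewrite lef_pV2 ?posrE ?ltr0n// ler_nat.
Qed.

Lemma C_const_ratio_ge0 : 0 <= kappa.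
Proof. by rewrite divr_ge0 ?C_const_ge0. Qed.

Lemma hyp_coef_ge0 : 0 <= alpha.
Proof. have := C_const_ratio_le; lra. Qed.

Lemma K_constE : K = alpha / 2 + kappa / 2.
Proof.
rewrite /K_const; field.
by rewrite pnatr_eq0 -lt0n l0 gt_eqF// zeta2_gt0.
Qed.

Lemma K_const_gt0 : 0 < K.
Proof.
have z0 : 0 < (zeta R 2)^-1 by rewrite invr_gt0 zeta2_gt0.
have := C_const_ratio_le; rewrite K_constE; lra.
Qed.

(** The limiting number of gaps at most a / Q^2, divided by Q^2; its total mass is [K], not 1. In
    [alpha], all Farey gaps are counted once and the two gaps next to each deleted fraction are
    subtracted; the other term restores the merged gaps. *)
Definition limit_cdf (a : R) : R :=
  alpha * gap_area (@open_triangle R) (@gap1 R) a +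
  kappa * gap_area (@cells R) (@gap2 R) a.

Lemma G_funE xi : 0 < xi -> G_fun l xi = limit_cdf xi.
Proof. by move=> xi0; rewrite /G_fun /limit_cdf area_hypE// sum_area_KE// -mulrA. Qed.

Lemma limit_cdf_nd : {homo limit_cdf : a b / a <= b}.
Proof.
move=> a b ab; apply: lerD.
  by apply: (ler_wpM2l hyp_coef_ge0); exact: (gap_area_le (gap_function1 R)).
by apply: (ler_wpM2l C_const_ratio_ge0); exact: (gap_area_le (gap_function2 R)).
Qed.

Lemma limit_cdf_continuous : continuous limit_cdf.
Proof.
move=> a; apply: cvgD; apply: cvgZr.
- exact: (gap_area_continuous (gap_function1 R)).
- exact: (gap_area_continuous (gap_function2 R)).
Qed.

Lemma limit_cdf0 a : a <= 0 -> limit_cdf a = 0.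
Proof.
move=> a0; rewrite /limit_cdf (gap_area_le0 (gap_function1 R))//.
by rewrite (gap_area_le0 (gap_function2 R))// !mulr0 addr0.
Qed.

Lemma limit_cdfy : limit_cdf x @[x --> +oo] --> K.
Proof.
rewrite K_constE; apply: cvgD; apply: cvgZr.
- exact: (cvgy_gap_area (gap_function1 R)).
- exact: (cvgy_gap_area (gap_function2 R)).
Qed.

(** Absorbs the gap from 0 to 1/Q and the difference between the numbers of points and of gaps. *)
Lemma cvg_bounded_difference (a b : nat -> R) (c : R) :
  (\forall Q \near \oo, `|a Q - b Q| <= 1) ->
  b Q / Q%:R ^+ 2 @[Q --> \oo] --> c -> a Q / Q%:R ^+ 2 @[Q --> \oo] --> c.
Proof.
move=> ab bc.
suff h : (a Q - b Q) / Q%:R ^+ 2 @[Q --> \oo] --> (0 : R).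
  have E Q : a Q / Q%:R ^+ 2 = (a Q - b Q) / Q%:R ^+ 2 + b Q / Q%:R ^+ 2.
    by rewrite -mulrDl subrK.
  by under eq_fun do rewrite E; rewrite -[c]add0r; exact: cvgD.
apply: (cvgr0Pnorm_le _).2 => e e0; near=> Q.
have Q0 : (0 < Q)%N by near: Q; exact: nbhs_infty_gt.
have Q1 : (1 : R) <= Q%:R by rewrite ler1n.
have Qe : e^-1 <= Q%:R by near: Q; exact: nbhs_infty_ger.
have abQ : `|a Q - b Q| <= 1 by near: Q; exact: ab.
rewrite normrM normfV [X in _ / X]ger0_norm ?exprn_ge0//.
rewrite ler_pdivrMr ?exprn_gt0 ?ltr0n//; apply: le_trans abQ _.
rewrite -ler_pdivrMl// mulr1; apply: le_trans Qe _.
by rewrite expr2 ler_peMr.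
Unshelve. all: by end_near. Qed.

Local Notation L Q := (sort <=%O (farey_ndvd l Q)).
Local Notation N Q := (size (L Q)).-1.

Definition small_gap_density (Q : nat) (tau : R) : R :=
  (\sum_(j < N Q) (ratr ((L Q)`_j.+1 - (L Q)`_j)%R <= tau / Q%:R ^+ 2)%R)%N%:R / Q%:R ^+ 2.

Lemma small_gap_density_nd Q : {homo small_gap_density Q : a b / a <= b}.
Proof.
move=> a b ab; rewrite ler_wpM2r ?invr_ge0 ?exprn_ge0// ler_nat.
apply: leq_sum => j _; case h : (_ <= a / _) => //.
by rewrite (le_trans h)// ler_wpM2r ?invr_ge0 ?exprn_ge0.
Qed.

Lemma small_gap_density_cvg tau :
  small_gap_density Q tau @[Q --> \oo] --> limit_cdf tau.
Proof.
pose Y Q : R := (pair_number true Q 1 (gap1_set tau))%:R +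
  (pair_number true Q l (gap2_set tau))%:R - (pair_number true Q l (gap1_set tau))%:R -
  (pair_number false Q l (gap1_set tau))%:R.
apply: (@cvg_bounded_difference _ Y).
  near=> Q; have Q0 : (0 < Q)%N by near: Q; exact: nbhs_infty_gt.
  have [b] := gap_number_identity (tau / Q%:R ^+ 2) l2 Q0.
  rewrite divfK ?expf_neq0 ?pnatr_eq0 -?lt0n// => /(congr1 (fun n => n%:R : R)).
  rewrite !natrD /Y => h; set s := (X in `|X - _|).
  set y := (X in `|_ - X|); have -> : s - y = - b%:R.
    by rewrite -/s in h; rewrite /y; lra.
  by rewrite normrN; case: (b); rewrite ?normr1 ?normr0.
have E Q : Y Q / Q%:R ^+ 2 = pair_density true Q 1 (gap1_set tau) +
  pair_density true Q l (gap2_set tau) - pair_density true Q l (gap1_set tau) -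
  pair_density false Q l (gap1_set tau) by rewrite /Y !mulrBl mulrDl.
under eq_fun do rewrite E.
have -> : limit_cdf tau = C_const R 1 / 1%:R * gap_area (@open_triangle R) (@gap1 R) tau +
  kappa * gap_area (@cells R) (@gap2 R) tau -
  kappa * gap_area (@open_triangle R) (@gap1 R) tau -
  kappa * gap_area (@open_triangle R) (@gap1 R) tau.
  by rewrite C_const1 /limit_cdf divr1; ring.
apply: cvgB; first apply: cvgB; first apply: cvgD.
- exact: (pair_density_gap (gap_function1 R)).
- exact: (pair_density_gap (gap_function2 R)).
- exact: (pair_density_gap (gap_function1 R)).
- exact: (pair_density_gap (gap_function1 R)).
Unshelve. all: by end_near. Qed.

Lemma pair_number_total_cvg s k : (0 < k)%N ->
  (pair_number s Q k [set: R * R])%:R / Q%:R ^+ 2 @[Q --> \oo] -->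
  C_const R k / k%:R / 2.
Proof.
move=> k0; have := @pair_count_total R s k k0; apply: cvg_trans.
apply: near_eq_cvg; near=> Q; congr (_%:R / _).
rewrite /pair_number /pair_count; apply: eq_bigr => n _; apply: eq_bigr => a _.
by rewrite asboolT.
Unshelve. all: by end_near. Qed.

Lemma size_ndvd_cvg : (N Q)%:R / Q%:R ^+ 2 @[Q --> \oo] --> K.
Proof.
apply: (@cvg_bounded_difference _ (fun Q => (pair_number true Q 1 [set: R * R])%:R -
   (pair_number true Q l [set: R * R])%:R)).
  near=> Q; have Q0 : (0 < Q)%N by near: Q; exact: nbhs_infty_gt.
  rewrite -(@size_farey_ndvd R l Q) natrD addrK.
  case: (size (L Q)) => [|n] /=; first by rewrite subrr normr0.
  by rewrite -natr1 opprD addrA subrr add0r normrN normr1.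
under eq_fun do rewrite mulrBl.
have -> : K = C_const R 1 / 1%:R / 2 - kappa / 2 by rewrite K_constE C_const1 divr1; lra.
by apply: cvgB; exact: pair_number_total_cvg.
Unshelve. all: by end_near. Qed.

Lemma ratr_nth (s : seq rat) k : [seq (ratr x : R) | x <- s]`_k = ratr s`_k.
Proof.
have [ks|ks] := ltnP k (size s); first exact: nth_map.
by rewrite !nth_default ?size_map// rmorph0.
Qed.

Lemma farey_ndvd_list_sorted Q : sorted <=%R (farey_ndvd_list R l Q).
Proof.
rewrite sorted_map; apply: sub_sorted (sort_le_sorted (farey_ndvd l Q)) => x y /=.
by rewrite ler_rat.
Qed.

Lemma size_farey_ndvd_list Q : size (farey_ndvd_list R l Q) = size (L Q).
Proof. exact: size_map. Qed.

Lemma gap_farey_ndvd_list Q j : (0 < Q)%N -> gap (farey_ndvd_list R l Q) j =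
  (N Q)%:R * ratr ((L Q)`_j.+1 - (L Q)`_j) / (1 - Q%:R^-1).
Proof.
move=> Q0; rewrite /gap size_farey_ndvd_list /farey_ndvd_list !ratr_nth.
rewrite (last_sorted_ndvd l2 Q0) (head_sorted_ndvd l2 Q0) /frac/= rmorph1.
by rewrite fmorph_div /= !ratr_nat -mulrBl -mulrBr rmorphB /= div1r.
Qed.

(** The value of tau at which a gap tau / Q^2, multiplied by N and divided by the total length 1 -
    1/Q, equals xi. *)
Definition gap_threshold (xi : R) (Q : nat) : R :=
  xi * (1 - Q%:R^-1) / ((N Q)%:R / Q%:R ^+ 2).

Lemma gap_threshold_cvg xi : gap_threshold xi Q @[Q --> \oo] --> xi / K.
Proof.
have h : xi * (1 - Q%:R^-1) @[Q --> \oo] --> xi.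
  rewrite -[X in _ --> X]mulr1 -[X in xi * X]subr0; apply: cvgZr; apply: cvgB.
    exact: cvg_cst.
  apply: (gtr0_cvgV0 _).2 cvgr_idn.
  by near=> Q; rewrite ltr0n; near: Q; exact: nbhs_infty_gt.
by apply: cvgM h _; apply: cvgV; [rewrite gt_eqF ?K_const_gt0|exact: size_ndvd_cvg].
Unshelve. all: by end_near. Qed.

Lemma gap_le_threshold xi Q j : (1 < Q)%N -> (0 < N Q)%N ->
  (gap (farey_ndvd_list R l Q) j <= xi) =
  (ratr ((L Q)`_j.+1 - (L Q)`_j) <= gap_threshold xi Q / Q%:R ^+ 2).
Proof.
move=> Q1 NQ; have Q0 : (0 < Q)%N by exact: ltnW.
have Q0' : 0 < Q%:R :> R by rewrite ltr0n.
have d0 : 0 < 1 - Q%:R^-1 :> R by rewrite subr_gt0 invf_lt1// ltr1n.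
have N0 : 0 < (N Q)%:R :> R by rewrite ltr0n.
rewrite (gap_farey_ndvd_list _ Q0) /gap_threshold ler_pdivrMr// mulrC -ler_pdivlMr//.
congr (_ <= _); rewrite invf_div; field.
by rewrite !gt_eqF.
Qed.

Lemma near_size_ndvd_gt1 : \forall Q \near \oo, (0 < N Q)%N.
Proof.
have h : 0 < K := K_const_gt0.
near=> Q.
have : 0 < (N Q)%:R / Q%:R ^+ 2 :> R.
  by near: Q; exact: (cvgr_gt _ size_ndvd_cvg).
by case: (N Q) => //; rewrite mul0r ltxx.
Unshelve. all: by end_near. Qed.

Lemma gap_measure_segment_cvg xi : 0 <= xi ->
  gap_measure (farey_ndvd_list R l Q) `[0, xi]%classic @[Q --> \oo] -->
  (K^-1 * limit_cdf (xi / K))%:E.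
Proof.
move=> xi0.
have h : ((N Q)%:R / Q%:R ^+ 2)^-1 * small_gap_density Q (gap_threshold xi Q)
    @[Q --> \oo] --> K^-1 * limit_cdf (xi / K).
  apply: cvgM; first by apply: cvgV; [rewrite gt_eqF ?K_const_gt0|exact: size_ndvd_cvg].
  apply: cvg_nondecreasing_diagonal.
  - by apply: nearW => Q; exact: small_gap_density_nd.
  - exact: small_gap_density_cvg.
  - exact: limit_cdf_continuous.
  - exact: gap_threshold_cvg.
suff E : \forall Q \near \oo,
    gap_measure (farey_ndvd_list R l Q) `[0, xi]%classic =
    (((N Q)%:R / Q%:R ^+ 2)^-1 * small_gap_density Q (gap_threshold xi Q))%:E.
  apply: cvg_trans; first by apply: near_eq_cvg; near=> Q; apply/esym; near: Q; exact: E.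
  by apply: cvg_EFin; [exact: nearW|exact: h].
near=> Q.
have Q1 : (1 < Q)%N by near: Q; exact: nbhs_infty_gt.
have NQ : (0 < N Q)%N by near: Q; exact: near_size_ndvd_gt1.
rewrite gap_measure_cdf ?farey_ndvd_list_sorted//; congr (_%:E).
have Q2 : Q%:R ^+ 2 != 0 :> R by rewrite expf_neq0// pnatr_eq0 -lt0n ltnW.
have cancel (q n s : R) : q != 0 -> q / n * (s / q) = n^-1 * s.
  by move=> q0; rewrite mulrCA (mulrAC q) divff// mul1r mulrC.
rewrite /small_gap_density invf_div cancel// size_farey_ndvd_list; congr (_ * _%:R).
rewrite -sum1dep_card [LHS]big_mkcond/=; apply: eq_bigr => j _.
by rewrite gap_le_threshold//; case: (_ <= _).
Unshelve. all: by end_near. Qed.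

Lemma gap_measure_half_line : \forall Q \near \oo,
  gap_measure (farey_ndvd_list R l Q) `[0, +oo[%classic = 1%E.
Proof.
near=> Q.
have Q0 : (0 < Q)%N by near: Q; exact: nbhs_infty_gt.
have NQ : (0 < N Q)%N by near: Q; exact: near_size_ndvd_gt1.
transitivity (((size (farey_ndvd_list R l Q)).-1%:R^-1)%:E *
  \sum_(j < (size (farey_ndvd_list R l Q)).-1)
    (\d_(gap (farey_ndvd_list R l Q) j : measurableTypeR R) `[0%R, +oo[%classic
      : \bar R))%E => //.
rewrite size_farey_ndvd_list (eq_bigr (fun=> 1%E)) => [|j _].
  by rewrite sumEFin sumr_const card_ord -EFinM mulVf// pnatr_eq0 -lt0n.
transitivity ((gap (farey_ndvd_list R l Q) j \in `[0, +oo[%classic)%:R%:E : \bar R).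
  exact: diracE.
rewrite mem_set//= in_itv/= andbT (gap_farey_ndvd_list _ Q0).
apply: divr_ge0; first apply: mulr_ge0 => //.
  by rewrite ler0q subr_ge0 nth_sorted_ndvd_le// -ltn_predRL.
by rewrite subr_ge0 invf_le1 ?ltr0n// ler1n.
Unshelve. all: by end_near. Qed.

End LimitingDistribution.

Unset Implicit Arguments.

Theorem mainTheorem4 (R : realType) (l : nat) (hl : (2 <= l)%N) :
  exists nu : probability (measurableTypeR R) R,
    limiting_gap_measure (farey_ndvd_list R l) nu /\
    forall xi : R, 0 < xi ->
      nu `[0, xi]%classic = ((K_const R l)^-1 * G_fun l (xi / K_const R l))%:E.
Proof.
have K0 := K_const_gt0 R hl.
(* [limit_cdf] is used rather than [G_fun] because it is continuous and monotone on the whole line;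
   the two are identified only at positive arguments. *)
pose F (x : R) : R := (K_const R l)^-1 * limit_cdf l (x / K_const R l).
have F_nd : {homo F : x y / x <= y}.
  move=> x y xy; rewrite ler_wpM2l ?invr_ge0 ?(ltW K0)//; apply: limit_cdf_nd => //.
  by rewrite ler_wpM2r ?invr_ge0 ?(ltW K0).
have F_cont : continuous F.
  move=> x; apply: cvgZr.
  apply: (@continuous_comp _ _ _ (fun x : R => x / K_const R l) (@limit_cdf R l)).
    by apply: cvgMl; exact: cvg_id.
  exact: limit_cdf_continuous.
have F0 x : x <= 0 -> F x = 0.
  by move=> x0; rewrite /F limit_cdf0 ?mulr0// pmulr_lle0 ?invr_gt0.
have F1 : F x @[x --> +oo] --> (1 : R).
  rewrite -(mulVf (lt0r_neq0 K0)); apply: cvgZr.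
  apply: (cvg_comp _ _ _ (@limit_cdfy R l hl)).
  by apply: gt0_cvgMly; [rewrite invr_gt0|exact: cvg_id].
have [nu [nu1 nuE]] := distribution_on_half_line F_nd F_cont F0 F1.
exists nu; split; last first.
  move=> xi xi0; rewrite (nuE _ (ltW xi0)) G_funE// divr_gt0//.
split => //; apply: cdf_cvg_weak => //.
  exact: gap_measure_half_line.
move=> a a0; have := @gap_measure_segment_cvg R l hl a (ltW a0).
by rewrite -/(F a) -(nuE _ (ltW a0)).
Qed.
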